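(* Let $\underline{u}<0<\bar{u}$ be real and let $-\infty\le\underline{x}_k<0<\bar{x}_k\le+\infty$ for $k=1,2$. For $x_0,x_f\in\mathbb{R}^3$, consider the time-optimal control problem for the triple integrator without position constraints: $$\min_{(u,t_f)}\ t_f\quad\text{s.t.}\quad \dot x_1=u,\ \dot x_2=x_1,\ \dot x_3=x_2,\quad \underline u\le u\le\bar u,\quad \underline x_k\le x_k\le\bar x_k\ (k=1,2),\quad x(0)=x_0,\ x(t_f)=x_f .$$ For fixed $x_f$, take the manifolds (curves, surfaces and three-dimensional regions) labelled by augmented switching laws (ASLs) $\mathfrak L$ that are constructed by backward integration from $x_f$ as described in the context. Let $\operatorname{relint}(\mathfrak L)$ denote the relative interior of the manifold whose ASL is $\mathfrak L$, and define the closed-loop control $$u(x)=\begin{cases}\bar u,& x\in\operatorname{relint}(\mathfrak L),\ \mathfrak L\text{ begins with }\bar 0,\\ \underline u,& x\in\operatorname{relint}(\mathfrak L),\ \mathfrak L\text{ begins with }\underline 0,\\ 0,&\text{otherwise.}\end{cases}$$ Then this control law is complete for the triple integrator without position constraints. In other words, for all $x_0,x_f\in\mathbb{R}^3$, if the optimal control problem from $x_0$ to $x_f$ is feasible, then the trajectory given by this control law satisfies Pontryagin's maximum principle (PMP), in the form stated in the context.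
   Context: Arcs and ASL. Arc types: $\bar 0$: $u\equiv\bar u$; $\underline 0$: $u\equiv\underline u$; for $k=1,2$, $\bar k$: $x_k\equiv\bar x_k$ (hence $u\equiv0$ and $x_j\equiv0$ for $1\le j<k$); $\underline k$: $x_k\equiv\underline x_k$ (hence $u\equiv0$ and $x_j\equiv0$ for $1\le j<k$). Without position constraints, an augmented switching law (ASL) is a sequence of arc types in temporal order; e.g. $\bar0\underline0\bar0$ means a $\bar0$-arc, then a $\underline0$-arc, then a $\bar0$-arc, after which $x_f$ is reached. Construction of the manifolds by backward integration from $x_f$. Put $$\varphi(x,u,t)=\left(x_1+ut,\ x_2+x_1t+\tfrac12ut^2,\ x_3+x_2t+\tfrac12x_1t^2+\tfrac16ut^3\right).$$ All backward integrations below are kept only as long as the bounds $\underline x_k\le x_k\le\bar x_k$ ($k=1,2$) hold; sets with empty ranges are empty. (1) Curves. $\bar0=\{\varphi(x_f,\bar u,-t): t\in[0,\frac{x_{f1}-\underline x_1}{\bar u}]\}$. Let $x_{\bar0}=\varphi(x_f,\bar u,\frac{\underline x_1-x_{f1}}{\bar u})$, with components $x_{\bar0,k}$, and $\underline1\bar0=\{\varphi(x_{\bar0},0,-t): t\in[0,\frac{x_{\bar0,2}-\bar x_2}{\underline x_1}]\}$. (2) Without loss of generality assume $x_{\underline1\bar0,2}:=\bar x_2+\frac{\underline x_1^2}{2\underline u}\ge x_{\bar0,2}$ (see (6) otherwise). Surfaces: $\underline0\bar0=\{\varphi(\hat x,\underline u,-t):\hat x\in\bar0,\ t\in[0,\frac{\hat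 x_1-\bar x_1}{\underline u}]\}$; $\underline0\underline1\bar0=\{\varphi(\hat x,\underline u,-t):\hat x\in\underline1\bar0,\ t\in[0,\tau(\hat x)]\}$, where $\tau(x)=\frac{x_1-\bar x_1}{\underline u}$ if $x_2\le x_{\underline1\bar0,2}$ and $\tau(x)=\frac{x_1+\sqrt{x_1^2-2\underline u(x_2-\bar x_2)}}{\underline u}$ otherwise; $\bar1\underline0\bar0=\{\varphi(\hat x,0,-t):\hat x\in\underline0\bar0,\ \hat x_1=\bar x_1,\ t\in[0,\frac{\hat x_2-\underline x_2}{\bar x_1}]\}$; $\bar1\underline0\underline1\bar0=\{\varphi(\hat x,0,-t):\hat x\in\underline0\underline1\bar0,\ \hat x_1=\bar x_1,\ t\in[0,\frac{\hat x_2-\underline x_2}{\bar x_1}]\}$. (3) Manifolds involving $\bar2$. Let $x_{\underline1\bar0}=\varphi(x_{\bar0},0,-\frac{x_{\bar0,2}-x_{\underline1\bar0,2}}{\underline x_1})$ and $x_{\bar2\underline0\underline1\bar0}=\varphi(x_{\underline1\bar0},\underline u,-\frac{\underline x_1}{\underline u})$; the latter is the point where the line $\{x_1=0,\ x_2=\bar x_2\}$ meets the surface $\underline0\underline1\bar0$. Then $\bar2\underline0\underline1\bar0=\{x: x_1=0,\ x_2=\bar x_2,\ x_3\le x_{\bar2\underline0\underline1\bar0,3}\}$ (a curve); $\underline0\bar2\underline0\underline1\bar0=\{\varphi(\hat x,\underline u,-t):\hat x\in\bar2\underline0\underline1\bar0,\ t\in[0,-\frac{\bar x_1}{\underline u}]\}$;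 $\bar1\underline0\bar2\underline0\underline1\bar0=\{\varphi(\hat x,0,-t):\hat x\in\underline0\bar2\underline0\underline1\bar0,\ \hat x_1=\bar x_1,\ t\in[0,\frac{\hat x_2-\underline x_2}{\bar x_1}]\}$. (4) Three-dimensional regions. Each of the six surfaces $\mathfrak s$ in (2)–(3) is extruded backward with $u\equiv\bar u$, giving the region with ASL $\bar0\mathfrak s$. For example, $\bar0\underline0\bar0=\{\varphi(\hat x,\bar u,-t):\hat x\in\underline0\bar0,\ t\in[0,\frac{\hat x_1-\underline x_1}{\bar u}]\}$ and $\bar0\underline0\underline1\bar0=\{\varphi(\hat x,\bar u,-t):\hat x\in\underline0\underline1\bar0,\ t\in[0,\sigma(\hat x)]\}$, where $\sigma(x)=\frac{x_1-\underline x_1}{\bar u}$ if $x_1\le0$ or $x_2\ge\underline x_2+\frac{x_1^2}{2\bar u}$, and $\sigma(x)=\frac{x_1-\sqrt{x_1^2-2\bar u(x_2-\underline x_2)}}{\bar u}$ otherwise. The regions are $\bar0\underline0\bar0$, $\bar0\bar1\underline0\bar0$, $\bar0\underline0\underline1\bar0$, $\bar0\bar1\underline0\underline1\bar0$, $\bar0\underline0\bar2\underline0\underline1\bar0$, $\bar0\bar1\underline0\bar2\underline0\underline1\bar0$. (5) Mirror family. The manifolds whose ASLs end with $\underline0$ are obtained in the same way with the roles of upper and lower bounds exchanged: apply (1)–(4) to $-x_f$ with bounds $-\bar u\le u\le-\underline u$, $-\bar x_k\le x_k\le-\underline x_k$, replace each resulting set by its negative, and interchange overlines and underlines in the labels (with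 the corresponding mirrored assumption $\underline x_2+\frac{\bar x_1^2}{2\bar u}\le x_{\underline0,2}$, where $x_{\underline0}=\varphi(x_f,\underline u,\frac{\bar x_1-x_{f1}}{\underline u})$). (6) If the assumption in (2) fails, the curve $\bar2\underline0\underline1\bar0$ is replaced by the curve $\bar2\underline0\bar0$, i.e. the part of the line $\{x_1=0,\ x_2=\bar x_2\}$ with $x_3$ at most that of the point where the line meets the surface $\underline0\bar0$, and the manifolds built from it are replaced accordingly; similarly for the mirrored curve $\underline2\bar0\bar1\underline0$. If a bound is infinite, all manifolds whose ASL contains the corresponding arc are omitted. These surfaces partition the state space into regions, each corresponding to a unique ASL. The relative interior of a manifold is the manifold without its relative boundary. The trajectory given by the law starts at $x_0$ and has $u(t)=u(x(t))$; once the state enters a lower-dimensional switching manifold, the control switches and the state moves along that manifold, until $x_f$ is reached. PMP. A feasible trajectory $(x(t),u(t))$, $t\in[0,t_f]$, satisfies PMP if there exist a constant $\lambda_0\ge0$, a costate $\lambda=(\lambda_1,\lambda_2,\lambda_3):[0,t_f]\to\mathbb{R}^3$ and multipliers $\eta_k^{\pm}(t)\ge0$, $k=1,2$ (zero for infinite bounds), such that: (i) almost everywhere, $\dot\lambda_3=0$ and $\dot\lambda_k=-(\lambda_{k+1}+\eta_k^+-\eta_k^-)$ for $k=1,2$; (ii) almost everywhere, $\eta_k^+(x_k-\bar x_k)=0$ and $\eta_k^-(\underline x_k-x_k)=0$; (iii) $\lambda_0+\lambda_1u+\lambda_2x_1+\lambda_3x_2\equiv0$ along the trajectory; (iv) $u(t)=\bar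 u$ if $\lambda_1(t)<0$, $u(t)=0$ if $\lambda_1(t)=0$, $u(t)=\underline u$ if $\lambda_1(t)>0$ (almost everywhere); (v) junction condition: if a state constraint $h(x)\le0$, with $h(x)=x_k-\bar x_k$ or $h(x)=\underline x_k-x_k$ ($k=1,2$), switches between active and inactive at time $t_i$, then $\lambda(t_i^+)-\lambda(t_i^-)=\zeta(t_i)\,\partial h/\partial x$ for some $\zeta(t_i)\le0$; $\lambda$ has no other jumps; (vi) nontriviality: $(\lambda_0,\lambda(t),\eta(t),\zeta)\ne0$ for all $t\in[0,t_f]$, where $\zeta$ collects all the $\zeta(t_i)$.
   Formalization: For some x_f the manifolds overlap, so u(x) and ''the trajectory'' are not unique; u(x) is taken multivalued there and the claim is that some trajectory given by the law satisfies PMP. The relative boundary is read as the part of a manifold lying on lower-dimensional manifolds. *)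

(* Defs.v *)
From mathcomp Require Import all_boot all_order all_algebra.
From mathcomp Require Import all_classical all_reals all_analysis.

Set Implicit Arguments.
Unset Strict Implicit.
Unset Printing Implicit Defensive.

Import Order.TTheory GRing.Theory Num.Theory.
Import numFieldNormedType.Exports.

Local Open Scope classical_set_scope.
Local Open Scope ring_scope.

(* Coordinates are numbered from 0: the state (x_1, x_2, x_3) has entries
   x 0 0, x 0 1, x 0 2, and for k : 'I_2 (standing for the constraint index
   k.+1) [cur k] is the coordinate x_{k.+1} and [nxt k] the coordinate
   x_{k.+2}. *)
Definition state (R : realType) := 'rV[R]_3.
Definition mkst (R : realType) (a b c : R) : state R :=
  \row_(i < 3) [:: a; b; c]`_i.
Definition cur (k : 'I_2) : 'I_3 := widen_ord (leqnSn 2) k.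
Definition nxt (k : 'I_2) : 'I_3 := lift ord0 k.

Notation "x '.c1'" := (x 0 0) (at level 1, format "x '.c1'") : ring_scope.
Notation "x '.c2'" := (x 0 1) (at level 1, format "x '.c2'") : ring_scope.
Notation "x '.c3'" := (x 0 2%:R) (at level 1, format "x '.c3'") : ring_scope.

(* Bounds on the control and on x_1, x_2; the latter may be infinite. *)
Record bounds (R : realType) := Bounds {
  ulo : R; uhi : R;
  xlo : 'I_2 -> \bar R; xhi : 'I_2 -> \bar R }.

Definition mirror (R : realType) (p : bounds R) : bounds R :=
  Bounds (- uhi p) (- ulo p) (fun k => - xhi p k)%E (fun k => - xlo p k)%E.

Definition within (R : realType) (p : bounds R) (x : state R) : Prop :=
  forall k : 'I_2, (xlo p k <= (x 0 (cur k))%:E <= xhi p k)%E.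

Section Trajectories.
Variables (R : realType) (p : bounds R).
Let mu := @lebesgue_measure R.

(* (x, u) on [0, tf] is feasible for the problem from x0 to xf; the dynamics
   x_1' = u, x_2' = x_1, x_3' = x_2 are meant in the sense of Caratheodory. *)
Definition feasible (x0 xf : state R) (tf : R) (x : R -> state R) (u : R -> R)
    : Prop :=
  [/\ 0 <= tf,
      measurable_fun `[0, tf] u /\
        {ae mu, forall t, t \in `[0, tf] -> ulo p <= u t <= uhi p},
      (forall t, t \in `[0, tf] ->
        (x t).c1 = x0.c1 + \int[mu]_(s in `[0, t]) u s /\
        forall k : 'I_2, x t 0 (nxt k) =
          x0 0 (nxt k) + \int[mu]_(s in `[0, t]) x s 0 (cur k)),
      (forall t, t \in `[0, tf] -> within p (x t)) &
      x tf = xf].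

End Trajectories.

Section PMP.
Variables (R : realType) (p : bounds R).
Let mu := @lebesgue_measure R.

Definition abs_continuous (a b : R) (f : R -> R) : Prop :=
  forall e, 0 < e -> exists2 d, 0 < d & forall s : seq (R * R),
    (forall q, q \in s -> [&& a <= q.1, q.1 <= q.2 & q.2 <= b]) ->
    pairwise (fun q r => (q.2 <= r.1) || (r.2 <= q.1)) s ->
    \sum_(q <- s) (q.2 - q.1) < d ->
    \sum_(q <- s) `|f q.2 - f q.1| < e.

(* Constraint (k, true) is x_k <= xhi k and (k, false) is xlo k <= x_k. *)
Definition active (x : state R) (k : 'I_2) (b : bool) : Prop :=
  (x 0 (cur k))%:E = (if b then xhi p k else xlo p k).

(* The constraint switches between active and inactive at time t; isolated
   contacts are included. *)
Definition junction (tf : R) (x : R -> state R) (k : 'I_2) (b : bool) (t : R)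
    : Prop :=
  [/\ 0 < t < tf,
      closure [set s | s \in `[0, tf] /\ active (x s) k b] t &
      closure [set s | s \in `[0, tf] /\ ~ active (x s) k b] t].

(* The gradient in x of the constraint function h, written h(x) <= 0. *)
Definition grad (k : 'I_2) (b : bool) : state R :=
  (if b then 1 else -1) *: delta_mx 0 (cur k).

(* [J] lists the jump times of the costate [lam], [eta k true] and
   [eta k false] are the multipliers of the upper and of the lower bound on
   x_{k.+1}, and [zeta k b t] is the jump coefficient of the constraint (k, b)
   at time t.  On intervals whose interior contains no jump time the costate
   agrees with an absolutely continuous function. *)
Definition pmp (tf : R) (x : R -> state R) (u : R -> R) : Prop :=
  exists (lam0 : R) (lam : R -> state R) (eta zeta : 'I_2 -> bool -> R -> R)
         (J : seq R),
  (0 <= lam0 /\ forall k b t, t \in `[0, tf] -> 0 <= eta k b t) /\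
  (forall k t, t \in `[0, tf] ->
     (xhi p k = +oo%E -> eta k true t = 0) /\
     (xlo p k = -oo%E -> eta k false t = 0)) /\
  (forall t, t \in J -> exists k b, junction tf x k b t) /\
  (forall a b, 0 <= a -> a < b -> b <= tf ->
     (forall t, t \in J -> ~~ (a < t < b)) ->
     exists2 nu : R -> state R,
       forall i : 'I_3, abs_continuous a b (fun t => nu t 0 i) &
       forall t, t \in `[a, b] -> t \notin J -> lam t = nu t) /\
  {ae mu, forall t, t \in `[0, tf] ->
     is_derive t 1 (fun s => (lam s).c3) 0 /\
     forall k : 'I_2, is_derive t 1 (fun s => lam s 0 (cur k))
       (- (lam t 0 (nxt k) + eta k true t - eta k false t))} /\
  {ae mu, forall t, t \in `[0, tf] -> forall k b,
     eta k b t = 0 \/ active (x t) k b} /\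
  {ae mu, forall t, t \in `[0, tf] ->
     lam0 + (lam t).c1 * u t + (lam t).c2 * (x t).c1
       + (lam t).c3 * (x t).c2 = 0} /\
  {ae mu, forall t, t \in `[0, tf] ->
     [/\ (lam t).c1 < 0 -> u t = uhi p,
         (lam t).c1 = 0 -> u t = 0 &
         0 < (lam t).c1 -> u t = ulo p]} /\
  (forall k b t, zeta k b t <= 0 /\ (~ junction tf x k b t -> zeta k b t = 0)) /\
  (forall t, 0 < t < tf -> exists l r : state R,
     [/\ lam s @[s --> t^'-] --> l, lam s @[s --> t^'+] --> r &
         r - l = \sum_(k < 2) \sum_(b : bool) zeta k b t *: grad k b]) /\
  (forall t, t \in `[0, tf] ->
     lam0 != 0 \/ lam t != 0 \/ (exists k b, eta k b t != 0) \/
     (exists k b s, zeta k b s != 0)).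

End PMP.

(* hi_k and lo_k are the arcs written k with an overline, resp. underline. *)
Inductive arc := hi0 | lo0 | hi1 | lo1 | hi2 | lo2.

Definition flip (a : arc) : arc :=
  match a with
  | hi0 => lo0 | lo0 => hi0 | hi1 => lo1 | lo1 => hi1 | hi2 => lo2 | lo2 => hi2
  end.

Definition asl := seq arc.

Definition flow (R : realType) (x : state R) (u t : R) : state R :=
  mkst (x.c1 + u * t)
       (x.c2 + x.c1 * t + u * t ^+ 2 / 2)
       (x.c3 + x.c2 * t + x.c1 * t ^+ 2 / 2 + u * t ^+ 3 / 6).

Section Manifolds.
Variables (R : realType) (p : bounds R) (xf : state R).

Let um := ulo p.
Let uM := uhi p.
Let l1 := xlo p 0.
Let h1 := xhi p 0.
Let l2 := xlo p 1.
Let h2 := xhi p 1.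

(* Backward integration with control v from the points x of S, for times in
   [0, T x], kept only as long as the state constraints hold.  T is
   extended-real valued: the range is [0, +oo[ when the relevant bound is
   infinite, and a negative T x gives an empty range. *)
Definition sweep (S : set (state R)) (v : R) (T : state R -> \bar R)
    : set (state R) :=
  [set y | exists x t, [/\ S x, 0 <= t /\ (t%:E <= T x)%E,
     forall s, 0 <= s <= t -> within p (flow x v (- s)) &
     y = flow x v (- t)]].

Definition to_l1 (x : state R) : \bar R := ((x.c1%:E - l1) * (uM^-1)%:E)%E.
Definition to_h1 (x : state R) : \bar R := ((x.c1%:E - h1) * (um^-1)%:E)%E.

Definition c_0 : set (state R) := sweep [set xf] uM to_l1.

(* x_{\bar 0}; only used for finite l1 *)
Definition pt_0 : state R := flow xf uM ((fine l1 - xf.c1) / uM).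

(* pt_0 must itself be kept in the curve it terminates *)
Definition c_10 : set (state R) :=
  if l1 \is a fin_num then
    sweep ([set pt_0] `&` c_0) 0
      (fun x => (x.c2%:E - h2) * ((fine l1)^-1)%:E)%E
  else set0.

Definition x2_10 : \bar R := (h2 + (fine l1 ^+ 2 / (2 * um))%:E)%E.

(* The "without loss of generality" assumption.  It fails for l1 = -oo:
   x2_10 is then -oo when h2 is finite, and when h2 = +oo the sets depending
   on the alternative are empty. *)
Definition touches : Prop := l1 \is a fin_num /\ (pt_0.c2%:E <= x2_10)%E.

Definition tau (x : state R) : \bar R :=
  if (x.c2%:E <= x2_10)%E then to_h1 x
  else ((x.c1 + Num.sqrt (x.c1 ^+ 2 - 2 * um * (x.c2 - fine h2))) / um)%:E.

Definition s_00 : set (state R) := sweep c_0 um to_h1.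
Definition s_010 : set (state R) := sweep c_10 um tau.

(* \bar 1 followed by the law of S *)
Definition along_h1 (S : set (state R)) : set (state R) :=
  sweep (S `&` [set x | x.c1%:E = h1]) 0
    (fun x => (x.c2%:E - l2) * ((fine h1)^-1)%:E)%E.

Definition pt_10 : state R :=
  flow pt_0 0 (- ((pt_0.c2 - fine x2_10) / fine l1)).
Definition pt_2010 : state R := flow pt_10 um (- (fine l1 / um)).

(* the points of the line x_1 = 0, x_2 = h2; empty for h2 = +oo *)
Definition line2 : set (state R) := [set x | x.c1 = 0 /\ x.c2%:E = h2].

Definition c_2010 : set (state R) :=
  [set x | [/\ touches, s_010 pt_2010, line2 x & x.c3 <= pt_2010.c3]].

Definition c_200 : set (state R) :=
  [set x | [/\ ~ touches, line2 x &
     exists2 y, (s_00 `&` line2) y & x.c3 <= y.c3]].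

Definition below_2 (C : set (state R)) : set (state R) :=
  sweep C um (fun _ => (- h1) * (um^-1)%:E)%E.

Definition sigma (x : state R) : \bar R :=
  if (x.c1 <= 0) || (l2 + (x.c1 ^+ 2 / (2 * uM))%:E <= x.c2%:E)%E then to_l1 x
  else ((x.c1 - Num.sqrt (x.c1 ^+ 2 - 2 * uM * (x.c2 - fine l2))) / uM)%:E.

Definition extrude (S : set (state R)) : set (state R) := sweep S uM to_l1.

Definition manifold_hi (L : asl) : set (state R) :=
  match L with
  | [::] => [set xf]
  | [:: hi0] => c_0
  | [:: lo1; hi0] => c_10
  | [:: lo0; hi0] => s_00
  | [:: lo0; lo1; hi0] => s_010
  | [:: hi1; lo0; hi0] => along_h1 s_00
  | [:: hi1; lo0; lo1; hi0] => along_h1 s_010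
  | [:: hi2; lo0; lo1; hi0] => c_2010
  | [:: lo0; hi2; lo0; lo1; hi0] => below_2 c_2010
  | [:: hi1; lo0; hi2; lo0; lo1; hi0] => along_h1 (below_2 c_2010)
  | [:: hi2; lo0; hi0] => c_200
  | [:: lo0; hi2; lo0; hi0] => below_2 c_200
  | [:: hi1; lo0; hi2; lo0; hi0] => along_h1 (below_2 c_200)
  | [:: hi0; lo0; hi0] => extrude s_00
  | [:: hi0; lo0; lo1; hi0] => sweep s_010 uM sigma
  | [:: hi0; hi1; lo0; hi0] => extrude (along_h1 s_00)
  | [:: hi0; hi1; lo0; lo1; hi0] => extrude (along_h1 s_010)
  | [:: hi0; lo0; hi2; lo0; lo1; hi0] => extrude (below_2 c_2010)
  | [:: hi0; hi1; lo0; hi2; lo0; lo1; hi0] =>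
      extrude (along_h1 (below_2 c_2010))
  | [:: hi0; lo0; hi2; lo0; hi0] => extrude (below_2 c_200)
  | [:: hi0; hi1; lo0; hi2; lo0; hi0] => extrude (along_h1 (below_2 c_200))
  | _ => set0
  end.

End Manifolds.

Section ClosedLoop.
Variables (R : realType) (p : bounds R) (xf : state R).
Let mu := @lebesgue_measure R.

(* The manifold with law L: a member of the family ending with \bar 0, or,
   mirrored, of the family ending with \underline 0.  It is set0 if L is not
   one of the laws of the construction, and {xf} if L is empty. *)
Definition manifold (L : asl) : set (state R) :=
  manifold_hi p xf L `|`
  [set x | manifold_hi (mirror p) (- xf) (map flip L) (- x)].

Definition arc_order (a : arc) : nat :=
  match a with hi0 | lo0 => 0 | hi1 | lo1 => 1 | hi2 | lo2 => 2 end.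

(* The dimension of the manifold with law L: an arc of order k starts from the
   points of the previous manifold satisfying k additional equations. *)
Fixpoint mdim (L : asl) : nat :=
  if L is a :: L' then ((mdim L').+1 - arc_order a)%N else 0%N.

(* The manifolds stratify the set of states from which xf can be reached; the
   relative boundary of a manifold is its part lying on manifolds of lower
   dimension, where the control switches.  Faces contained in a state
   constraint, or shared by two manifolds of equal dimension and equal first
   arc (such as the common face of the regions hi0 lo0 hi0 and
   hi0 lo0 lo1 hi0), are not part of it: the control does not switch there. *)
Definition relint (L : asl) : set (state R) :=
  manifold L `\` \bigcup_(L' in [set L' | (mdim L' < mdim L)%N]) manifold L'.

Definition relint_from (a : arc) : set (state R) :=
  \bigcup_(L in [set L | ohead L = Some a]) relint L.

(* [control x v] : v is the value u(x) of the closed-loop control at x.  It is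
   a function of x wherever the manifolds do not overlap. *)
Definition control (x : state R) (v : R) : Prop :=
  [\/ relint_from hi0 x /\ v = uhi p,
      relint_from lo0 x /\ v = ulo p |
      ~ (relint_from hi0 `|` relint_from lo0) x /\ v = 0].

(* (x, u) is a trajectory of the closed-loop control from x0 to xf: u(t) is the
   value of the control at x(t), and the state moves along the manifold with
   law L until time ts 1, then along the lower-dimensional manifold with law
   [behead L] until time ts 2, and so on. *)
Definition closed_loop (x0 : state R) (tf : R) (x : R -> state R) (u : R -> R)
    : Prop :=
  feasible p x0 xf tf x u /\
  {ae mu, forall t, t \in `[0, tf] -> control (x t) (u t)} /\
  exists (L : asl) (ts : nat -> R),
    [/\ ts 0%N = 0, ts (size L) = tf &
        forall i, (i < size L)%N -> ts i <= ts i.+1 /\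
          forall t, t \in `[ts i, ts i.+1] -> manifold (drop i L) (x t)].

End ClosedLoop.

(* Main.v *)
(* Consider the trajectories that accelerate first: [hi0], a hold of [x_1] at
   its upper bound, [lo0], possibly interrupted by a cruise at [x_1 = 0],
   [x_2 = h2], a hold at the lower bound, [hi0].  They are parametrized by the
   peak [P] of [x_1], its trough [- Q] and the durations [d], [e], [c] of the
   two holds and of the cruise.  Any feasible trajectory of duration [T] is
   dominated, in [x_2] and in the displacement of [x_3], by a member of this
   family with the same duration and the same end values of [x_1], [x_2];
   symmetrically it dominates a member of the mirror family.  At the least [T]
   for which the displacement from [x0] to [xf] lies between those of two such
   members, a perturbation of the parameters shows that one of them realizes
   it and cannot be improved to first order, unless the parameters are rigid.
   First-order stationarity is what makes the costate satisfy PMP.  The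
   trajectory runs through the manifolds of the closed loop, and it meets those
   of at most its dimension that carry another control only finitely often,
   since every such meeting is a root of a nonzero polynomial of degree at
   most four. *)
Require Import Defs.
From HB Require Import structures.
From mathcomp Require Import all_boot all_order all_algebra.
From mathcomp Require Import all_classical all_reals all_analysis.
From mathcomp Require Import measurable_realfun ring lra.
Import Order.TTheory GRing.Theory Num.Theory.
Import numFieldNormedType.Exports.
(* The topology library has its own [within]. *)
Import Defs.

Set Implicit Arguments.
Unset Strict Implicit.
Unset Printing Implicit Defensive.

Local Open Scope classical_set_scope.
Local Open Scope ring_scope.

(** * States and the flow of a constant control *)

Section Basics.
Variable R : realType.
Implicit Types (x y : state R) (v t : R).

(** Along [lo0] the quantity [x_2 + n x_1^2 / 2], with [n] the inverse of the deceleration, is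
    constant; call it [V]. Each half law depends on a single variable, the time [q] (resp. [r])
    between its own end and the crossing of [x_1 = 0], with [dV = P dq] and
    [dX = (V + n P^2 / 2) dq] for its displacement [X]. Equal velocities mean [P dq = Q dr], so the
    total displacement changes by [(V + n P Q / 2) (dq + dr)]; this rate becomes the multiplier of
    time. It can be negative, and a shorter law then goes further; hence reaching the target exactly
    does not stop the descent, and the two families must be shortened together. The variation is
    blocked if [q] or [r] has its least value or if [P + Q = 0]. Then any trajectory with the same
    duration and the same end values of [x_1], [x_2] goes at least as far as the law, so the member
    of the mirror family pins its displacement to the target, and a costate with vanishing third
    component serves. The lower bound on [x_2] gets no arc of its own: a law inherits it from the
    trajectory that it dominates. *)

Lemma mkst1 (a b c : R) : (mkst a b c).c1 = a.
Proof. by rewrite mxE. Qed.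

Lemma mkst2 (a b c : R) : (mkst a b c).c2 = b.
Proof. by rewrite mxE. Qed.

Lemma mkst3 (a b c : R) : (mkst a b c).c3 = c.
Proof. by rewrite mxE. Qed.

Lemma cur0 : cur 0 = 0 :> 'I_3. Proof. exact/val_inj. Qed.
Lemma cur1 : cur 1 = 1 :> 'I_3. Proof. exact/val_inj. Qed.
Lemma nxt0 : nxt 0 = 1 :> 'I_3. Proof. exact/val_inj. Qed.
Lemma nxt1 : nxt 1 = 2%:R :> 'I_3. Proof. exact/val_inj. Qed.
Definition mkstE := (mkst1, mkst2, mkst3, cur0, cur1, nxt0, nxt1).

Lemma I2P (P : 'I_2 -> Prop) : P 0 -> P 1 -> forall k, P k.
Proof.
move=> P0 P1 k; suff [->|->] : k = 0 \/ k = 1 by [].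
by case: k => [[|[|//]] ?]; [left|right]; exact/val_inj.
Qed.

Lemma I3P (P : 'I_3 -> Prop) : P 0 -> P 1 -> P 2%:R -> forall k, P k.
Proof.
move=> P0 P1 P2 k; suff [->|->|->] : [\/ k = 0, k = 1 | k = 2%:R] by [].
by case: k => [[|[|[|//]]] ?]; [constructor 1|constructor 2|constructor 3];
  exact/val_inj.
Qed.

Lemma stP x y : x.c1 = y.c1 -> x.c2 = y.c2 -> x.c3 = y.c3 -> x = y.
Proof.
by move=> h1 h2 h3; apply/rowP => k; elim/I3P: k.
Qed.

Lemma flow0 x v : flow x v 0 = x.
Proof. by apply: stP; rewrite /flow mkstE; lra. Qed.

Lemma flow_c1 x v t : (flow x v t).c1 = x.c1 + v * t.
Proof. by rewrite mkst1. Qed.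

Lemma flow_c2 x v t : (flow x v t).c2 = x.c2 + x.c1 * t + v * t ^+ 2 / 2.
Proof. by rewrite mkst2. Qed.

Lemma flow_c3 x v t : (flow x v t).c3 =
  x.c3 + x.c2 * t + x.c1 * t ^+ 2 / 2 + v * t ^+ 3 / 6.
Proof. by rewrite mkst3. Qed.

Definition flowE := (flow_c1, flow_c2, flow_c3).

Lemma flowD x v s t : flow (flow x v s) v t = flow x v (s + t).
Proof. by apply: stP; rewrite /flow !mkstE; field. Qed.

Lemma withinE (p : bounds R) x : within p x <->
  ((xlo p 0%R <= x.c1%:E <= xhi p 0%R)%E /\ (xlo p 1%R <= x.c2%:E <= xhi p 1%R)%E).
Proof.
split=> [h|[h0 h1] k]; first by have := h 0; have := h 1; rewrite cur0 cur1.
by elim/I2P: k; rewrite ?cur0 ?cur1.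
Qed.

End Basics.

(** * Piecewise constant controls *)

Section ArcLists.
Variable R : realType.
Implicit Types (x y : state R) (v t d : R) (l : seq (R * R)).
Let mu := @lebesgue_measure R.

(* Lists of arcs (control, duration) are in reverse temporal order. *)
Fixpoint dur l : R := if l is (_, d) :: l' then dur l' + d else 0.
Fixpoint fin x l : state R := if l is (v, d) :: l' then flow (fin x l') v d else x.
Fixpoint st x l t : state R :=
  if l is (v, d) :: l' then
    if t <= dur l' then st x l' t else flow (fin x l') v (t - dur l')
  else x.
(** At a switching time the value is that of the arc that ends there. For nonnegative durations and
    [t <= 0] the recursion reaches the empty list and returns the default 0, so [ct_arc] leaves out
    the left end of an arc and [ct_bnd] asks that 0 be an admissible value. *)
Fixpoint ct l t : R :=
  if l is (v, d) :: l' then if t <= dur l' then ct l' t else v else 0.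

Definition durs_ge0 l := forall a, a \in l -> 0 <= a.2.

Lemma durs_ge0_cons a l : durs_ge0 (a :: l) -> 0 <= a.2 /\ durs_ge0 l.
Proof.
move=> h; split; first by apply: h; rewrite inE eqxx.
by move=> b bl; apply: h; rewrite inE bl orbT.
Qed.

Lemma durs_ge0_cat l1 l2 : durs_ge0 (l2 ++ l1) -> durs_ge0 l1.
Proof. by elim: l2 => // a l2 IH /= /durs_ge0_cons[_ /IH]. Qed.

Lemma dur_ge0 l : durs_ge0 l -> 0 <= dur l.
Proof.
elim: l => //= -[v d] l IH /durs_ge0_cons[/= d0 /IH h].
exact: addr_ge0.
Qed.

Lemma dur_cat l1 l2 : durs_ge0 (l2 ++ l1) -> dur l1 <= dur (l2 ++ l1).
Proof.
elim: l2 => //= -[v d] l2 IH /durs_ge0_cons[/= d0 /IH h].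
by rewrite (le_trans h)// lerDl.
Qed.

Lemma st_0 x l : durs_ge0 l -> st x l 0 = x.
Proof.
elim: l => //= -[v d] l IH /durs_ge0_cons[/= d0 l0].
by rewrite dur_ge0// IH.
Qed.

Lemma st_dur x l : durs_ge0 l -> st x l (dur l) = fin x l.
Proof.
elim: l => //= -[v d] l IH /durs_ge0_cons[/= d0 l0].
rewrite gerDl; case: ifPn => [d0'|_].
  have -> : d = 0 by apply/eqP; rewrite eq_le d0' d0.
  by rewrite addr0 IH// flow0.
by rewrite addrAC subrr add0r.
Qed.

Lemma st_cat x l1 l2 t : durs_ge0 (l2 ++ l1) -> t <= dur l1 ->
  st x (l2 ++ l1) t = st x l1 t.
Proof.
elim: l2 => //= -[v d] l2 IH /durs_ge0_cons[/= d0 l0] tl.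
by rewrite (le_trans tl (dur_cat l0)) IH.
Qed.

Lemma ct_cat l1 l2 t : durs_ge0 (l2 ++ l1) -> t <= dur l1 ->
  ct (l2 ++ l1) t = ct l1 t.
Proof.
elim: l2 => //= -[v d] l2 IH /durs_ge0_cons[/= d0 l0] tl.
by rewrite (le_trans tl (dur_cat l0)) IH.
Qed.

Lemma st_arc x l1 l2 v d t : durs_ge0 (l2 ++ (v, d) :: l1) ->
  dur l1 <= t <= dur l1 + d ->
  st x (l2 ++ (v, d) :: l1) t = flow (fin x l1) v (t - dur l1).
Proof.
move=> h /andP[t1 t2]; rewrite st_cat//=.
have /durs_ge0_cons[/= d0 l0] := durs_ge0_cat h.
case: ifPn => // t1'.
have -> : t = dur l1 by apply/eqP; rewrite eq_le t1' t1.
by rewrite subrr flow0 st_dur.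
Qed.

Lemma ct_arc l1 l2 v d t : durs_ge0 (l2 ++ (v, d) :: l1) ->
  dur l1 < t <= dur l1 + d -> ct (l2 ++ (v, d) :: l1) t = v.
Proof. by move=> h /andP[t1 t2]; rewrite ct_cat//= leNgt t1. Qed.

Lemma measurable_ct l (D : set R) : measurable D -> measurable_fun D (ct l).
Proof.
move=> mD; apply: (@measurable_funS _ _ _ _ setT) => //.
elim: l => [|[v d] l IH] /=; first exact: measurable_cst.
apply: measurable_fun_ifT => //.
exact: measurable_realfun.measurable_fun_ler.
Qed.

Lemma ct_bnd l (a b : R) : a <= 0 <= b -> (forall q, q \in l -> a <= q.1 <= b) ->
  forall t, a <= ct l t <= b.
Proof.
move=> ab; elim: l => //= -[v d] l IH h t; case: ifPn => _; last first.
  by apply: (h (v, d)); rewrite inE eqxx.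
by apply: IH => q ql; apply: h; rewrite inE ql orbT.
Qed.

Lemma integrable_ct l (a b : R) : mu.-integrable `[a, b] (EFin \o ct l).
Proof.
pose M := \sum_(q <- l) `|q.1|.
apply: measurable_bounded_integrable => //.
- by rewrite [ltLHS](lebesgue_measure_itv `[a, b]) /=; case: ifPn => //; rewrite -EFinB ltry.
- exact: measurable_ct.
- exists M; split; first by rewrite num_real.
  move=> z Mz y _ /=; apply: le_trans (ltW Mz); rewrite /M {M Mz}.
  elim: l => [|[v d] l IH] /=; first by rewrite normr0 big_nil.
  rewrite big_cons /=; case: ifPn => _; first by rewrite (le_trans IH)// lerDr.
  by rewrite lerDl sumr_ge0.
Qed.

Lemma flow_derive x v c s :
  [/\ is_derive s (1:R) (fun s => (flow x v (s - c)).c1) v,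
      is_derive s (1:R) (fun s => (flow x v (s - c)).c2) (flow x v (s - c)).c1 &
      is_derive s (1:R) (fun s => (flow x v (s - c)).c3) (flow x v (s - c)).c2].
Proof.
split; rewrite /flow ?mkstE; under eq_fun do rewrite mkstE.
- by apply: is_derive_eq; rewrite /GRing.scale /=; ring.
- by apply: is_derive_eq; rewrite /GRing.scale /=; field.
- by apply: is_derive_eq; rewrite /GRing.scale /=; field.
Qed.

Lemma is_derive_cts (f : R -> R) s df : is_derive s (1:R) f df ->
  {for s, continuous f}.
Proof. by move=> [df1 _]; apply/differentiable_continuous/derivable1_diffP. Qed.

Lemma flow_cts x v c (k : 'I_3) : continuous (fun s => flow x v (s - c) 0 k : R).
Proof.
by move=> s; have [d1 d2 d3] := flow_derive x v c s; elim/I3P: k;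
  [exact: (is_derive_cts d1)|exact: (is_derive_cts d2)|exact: (is_derive_cts d3)].
Qed.

(** The trajectory is a sum of two pieces with clipped clocks: the earlier arcs frozen after
    [dur l], and the last flow frozen before it, minus the common state, which is counted twice. No
    case analysis at the switching time is left. *)
Lemma st_cts x l (k : 'I_3) : durs_ge0 l -> continuous (fun t => st x l t 0 k : R).
Proof.
elim: l => [_|[v d] l IH /durs_ge0_cons[/= d0 l0]]; first exact: cst_continuous.
have -> : (fun t => (if t <= dur l then st x l t
     else flow (fin x l) v (t - dur l)) 0 k : R) =
  (fun t => (st x l \o (fun t => Num.min t (dur l))) t 0 k
    + flow (fin x l) v (Num.max t (dur l) - dur l) 0 k - fin x l 0 k).
  apply/funext => t /=; case: (leP t (dur l)) => h.
    by rewrite subrr flow0 addrK.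
  by rewrite st_dur// addrAC subrr add0r.
move=> t; apply: cvgB; last exact: cvg_cst.
apply: cvgD.
- apply: (@continuous_comp _ _ _ (fun t => Num.min t (dur l))
    (fun t => st x l t 0 k)); last exact: IH.
  by apply: continuous_min; [exact: cvg_id|exact: cvg_cst].
- apply: (@continuous_comp _ _ _ (fun t => Num.max t (dur l))
    (fun s => flow (fin x l) v (s - dur l) 0 k)); last exact: flow_cts.
  by apply: continuous_max; [exact: cvg_id|exact: cvg_cst].
Qed.

(** The fundamental theorem of calculus on the last arc. The integrand agrees with [g] only on []c,
    t]], because at [c] it still has the value of the previous arc. *)
Lemma integral_step (f g G : R -> R) (c t : R) :
  mu.-integrable `[0, t] (EFin \o f) -> 0 <= c <= t ->
  (forall s, c < s <= t -> f s = g s) -> continuous g ->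
  (forall s, is_derive s (1:R) G (g s)) ->
  \int[mu]_(s in `[0, t]) f s = \int[mu]_(s in `[0, c]) f s + (G t - G c).
Proof.
move=> fi /andP[c0 ct] fg gc dG; apply/eqP; rewrite addrC -subr_eq; apply/eqP.
rewrite Rintegral_itvB ?bnd_simp//.
transitivity (\int[mu]_(s in `]c, t]) g s).
  by apply: eq_Rintegral => s; rewrite inE /= in_itv /= => h; exact: fg.
have gi : mu.-integrable `[c, t] (EFin \o g).
  apply: continuous_compact_integrable; first exact: segment_compact.
  exact: continuous_subspaceT.
rewrite Rintegral_itv_obnd_cbnd; last first.
  by apply: integrableS gi => //; exact: subset_itv_oc_cc.
move: ct; rewrite le_eqVlt => /predU1P[<-|ct].
  by rewrite subrr set_itv1 Rintegral_set1.
rewrite /Rintegral (@continuous_FTC2 _ _ G)//.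
- exact: continuous_subspaceT.
- split.
  + by move=> s _; have [] := dG s.
  + by apply: cvg_at_right_filter; exact: is_derive_cts (dG c).
  + by apply: cvg_at_left_filter; exact: is_derive_cts (dG t).
- by move=> s _; rewrite derive1E; apply: derive_val.
Qed.

Lemma st_integrable x l (k : 'I_3) t : durs_ge0 l ->
  mu.-integrable `[0, t] (EFin \o (fun s => st x l s 0 k : R)).
Proof.
move=> l0; apply: continuous_compact_integrable; first exact: segment_compact.
exact/continuous_subspaceT/st_cts.
Qed.

Lemma st_integral x l : durs_ge0 l -> forall t, 0 <= t <= dur l ->
  (st x l t).c1 = x.c1 + \int[mu]_(s in `[0, t]) ct l s /\
  forall k : 'I_2, st x l t 0 (nxt k) =
     x 0 (nxt k) + \int[mu]_(s in `[0, t]) st x l s 0 (cur k).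
Proof.
elim: l => [_ t|[v d] l IH vl0].
  move=> /= h; have -> : t = 0 by apply/eqP; rewrite eq_le andbC.
  by rewrite !set_itv1; split => [|k]; rewrite !Rintegral_set1 addr0.
have /durs_ge0_cons[/= d0 l0] := vl0.
move=> t /andP[t0 td].
case: ifPn => tl.
  have [|h1 h2] := IH l0 t; first by rewrite t0.
  rewrite h1; split=> [|k].
    congr +%R; apply: eq_Rintegral => s; rewrite inE /= in_itv /= => /andP[_ st].
    by rewrite (le_trans st tl).
  rewrite h2; congr +%R; apply: eq_Rintegral => s.
  rewrite inE /= in_itv /= => /andP[_ st].
  by rewrite (le_trans st tl).
rewrite -ltNge in tl.
have c0 : 0 <= dur l <= t by rewrite dur_ge0//= ltW.
have [|h1 h2] := IH l0 (dur l); first by rewrite dur_ge0/=.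
rewrite st_dur// in h1; rewrite st_dur// in h2.
have eqI (f : R -> R) (g : R -> R) : (forall s, s <= dur l -> f s = g s) ->
    \int[mu]_(s in `[0, dur l]) f s = \int[mu]_(s in `[0, dur l]) g s.
  move=> fg; apply: eq_Rintegral => s.
  by rewrite inE /= in_itv /= => /andP[_]; exact: fg.
have fint s := flow_derive (fin x l) v (dur l) s.
split=> [|k].
  have E : \int[mu]_(s in `[0, t]) ct ((v, d) :: l) s =
      \int[mu]_(s in `[0, dur l]) ct ((v, d) :: l) s +
      ((flow (fin x l) v (t - dur l)).c1 - (flow (fin x l) v (dur l - dur l)).c1).
    apply: (@integral_step _ (cst v) (fun s => (flow (fin x l) v (s - dur l)).c1)).
    - exact: (@integrable_ct ((v, d) :: l)).
    - by [].
    - by move=> s /andP[]/=; rewrite ltNge => /negbTE ->.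
    - exact: cst_continuous.
    - by move=> s; have [] := fint s.
  rewrite [X in _ = _ + X]E (eqI _ (ct l)); last by move=> s /= ->.
  by rewrite subrr flow0 addrA -h1 addrCA subrr addr0.
have E : \int[mu]_(s in `[0, t]) st x ((v, d) :: l) s 0 (cur k) =
    \int[mu]_(s in `[0, dur l]) st x ((v, d) :: l) s 0 (cur k) +
    (flow (fin x l) v (t - dur l) 0 (nxt k) -
     flow (fin x l) v (dur l - dur l) 0 (nxt k)).
  apply: (@integral_step _ (fun s => flow (fin x l) v (s - dur l) 0 (cur k))
    (fun s => flow (fin x l) v (s - dur l) 0 (nxt k))).
  - exact: (@st_integrable x ((v, d) :: l)).
  - by [].
  - by move=> s /andP[]/=; rewrite ltNge => /negbTE ->.
  - exact: flow_cts.
  - move=> s; have [? ? ?] := fint s; elim/I2P: k.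
    + by rewrite nxt0 cur0.
    + by rewrite nxt1 cur1.
rewrite [X in _ = _ + X]E (eqI _ (fun s => st x l s 0 (cur k))); last first.
  by move=> s /= ->.
by rewrite subrr flow0 addrA -h2 addrCA subrr addr0.
Qed.

Lemma st_feasible p x l : durs_ge0 l ->
  ulo p <= 0 <= uhi p -> (forall q, q \in l -> ulo p <= q.1 <= uhi p) ->
  (forall t, 0 <= t <= dur l -> within p (st x l t)) ->
  feasible p x (fin x l) (dur l) (st x l) (ct l).
Proof.
move=> l0 u0 ul wl; split.
- exact: dur_ge0.
- split; first exact: measurable_ct.
  by apply: aeW => t _; exact: ct_bnd.
- by move=> t; rewrite in_itv /=; exact: st_integral.
- by move=> t; rewrite in_itv /=; exact: wl.
- exact: st_dur.
Qed.

End ArcLists.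

(** * Comparison of trajectories by integration of inequalities *)

Section Kinematics.
Variable R : realType.
Implicit Types (y z : R -> state R) (s t T K m : R).
Let mu := @lebesgue_measure R.

(* The consequences of feasibility that do not mention the control. *)
Definition kinematic m K T y : Prop :=
  (forall s t, 0 <= s -> s <= t -> t <= T ->
     - m * (t - s) <= (y t).c1 - (y s).c1 <= K * (t - s)) /\
  forall k : 'I_2, mu.-integrable `[0, T] (EFin \o (fun s => y s 0 (cur k) : R)) /\
    forall t, 0 <= t <= T -> y t 0 (nxt k) =
      y 0 0 (nxt k) + \int[mu]_(s in `[0, t]) y s 0 (cur k).

Lemma Rintegral_itv_diff (f : R -> R) s t T :
  mu.-integrable `[0, T] (EFin \o f) -> 0 <= s -> s <= t -> t <= T ->
  \int[mu]_(r in `[0, t]) f r - \int[mu]_(r in `[0, s]) f r =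
  \int[mu]_(r in `]s, t]) f r.
Proof.
move=> fi s0 st tT; rewrite Rintegral_itvB ?bnd_simp//.
by apply: integrableS fi => //; apply: subset_itv; rewrite bnd_simp.
Qed.

Lemma Rintegral_cst_itv (c s t : R) : s <= t ->
  \int[mu]_(r in `]s, t]) c = c * (t - s).
Proof.
move=> st; rewrite Rintegral_cst//= lebesgue_measure_itv/= lte_fin.
move: st; rewrite le_eqVlt => /predU1P[->|st]; first by rewrite ltxx subrr.
by rewrite st.
Qed.

Lemma integrable_cst_itv (c s t : R) :
  mu.-integrable `]s, t] (EFin \o (fun=> c)).
Proof.
have ci : mu.-integrable `[s, t] (EFin \o (fun=> c)).
  apply: continuous_compact_integrable; first exact: segment_compact.
  exact/continuous_subspaceT/cst_continuous.
by apply: integrableS ci => //; exact: subset_itv_oc_cc.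
Qed.

Lemma le_Rintegral_itv (f g : R -> R) s t T :
  mu.-integrable `[0, T] (EFin \o f) -> mu.-integrable `[0, T] (EFin \o g) ->
  0 <= s -> t <= T -> (forall r, s < r <= t -> f r <= g r) ->
  \int[mu]_(r in `]s, t]) f r <= \int[mu]_(r in `]s, t]) g r.
Proof.
move=> fi gi s0 tT fg.
have sub : [set` `]s, t]] `<=` [set` `[0, T]].
  by apply: subset_itv; rewrite bnd_simp.
apply: le_Rintegral => //; [exact: integrableS fi|exact: integrableS gi].
Qed.

Lemma kinematic_cmp m K T y m' K' z (k : 'I_2) s t :
  kinematic m K T y -> kinematic m' K' T z -> 0 <= s -> s <= t -> t <= T ->
  (forall r, s < r <= t -> y r 0 (cur k) <= z r 0 (cur k)) ->
  y t 0 (nxt k) - y s 0 (nxt k) <= z t 0 (nxt k) - z s 0 (nxt k).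
Proof.
move=> [_ /(_ k)[yi yE]] [_ /(_ k)[zi zE]] s0 st tT yz.
rewrite (yE t) ?(le_trans s0 st)// (yE s) ?s0 ?(le_trans st tT)//.
rewrite (zE t) ?(le_trans s0 st)// (zE s) ?s0 ?(le_trans st tT)//.
rewrite !opprD [X in X <= _]addrACA [X in _ <= X]addrACA !subrr !add0r.
rewrite (Rintegral_itv_diff yi)// (Rintegral_itv_diff zi)//.
exact: le_Rintegral_itv yi zi _ _ _.
Qed.

(** The difference of the two [x_2] is convex on [[s, t]], its derivative being the nondecreasing
    difference of the [x_1]; a convex function that is nonpositive at both ends is nonpositive in
    between. *)
Lemma kinematic_chord m K T y m' K' z s t :
  kinematic m K T y -> kinematic m' K' T z -> 0 <= s -> t <= T ->
  (forall r r', s <= r -> r <= r' -> r' <= t ->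
     (y r).c1 - (z r).c1 <= (y r').c1 - (z r').c1) ->
  (y s).c2 <= (z s).c2 -> (y t).c2 <= (z t).c2 ->
  forall r, s <= r <= t -> (y r).c2 <= (z r).c2.
Proof.
move=> ky kz s0 tT mono ys yt r /andP[sr rt]; rewrite leNgt; apply/negP => yr.
(* A positive difference at [r] needs an earlier time at which the difference of the [x_1] is
   positive; by monotonicity it stays positive after [r], and the end value at [t] would be positive
   too. *)
have [w /andP[sw wr] yw] : exists2 w, s < w <= r & (z w).c1 < (y w).c1.
  apply: contrapT => /forall2NP H.
  have := kinematic_cmp (k := 0) ky kz s0 sr (le_trans rt tT).
  rewrite cur0 nxt0 => /(_ _)/wrap[|]; last by lra.
  by move=> q sq; have [//|/negP] := H q; rewrite -leNgt.
have := kinematic_cmp (k := 0) kz ky (le_trans s0 sr) rt tT.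
rewrite cur0 nxt0 => /(_ _)/wrap[|]; last by lra.
move=> q /andP[rq qt].
have := mono w q (ltW sw) (le_trans wr (ltW rq)) qt; lra.
Qed.

Lemma feasible_kinematic p x0 xf T y u : ulo p <= uhi p ->
  feasible p x0 xf T y u -> kinematic (- ulo p) (uhi p) T y /\ y 0 = x0.
Proof.
move=> lu [T0 [mfu ubnd] yE _ _].
have y00 : y 0 = x0.
  have [|h1 h2] := yE 0; first by rewrite in_itv /= lexx.
  apply: stP.
  - by rewrite h1 set_itv1 Rintegral_set1 addr0.
  - by have := h2 0; rewrite nxt0 set_itv1 Rintegral_set1 addr0.
  - by have := h2 1; rewrite nxt1 set_itv1 Rintegral_set1 addr0.
split=> //.
(* The bounds on [u] hold only almost everywhere. The truncation [w] satisfies them everywhere and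
   has the same integrals. *)
pose w t := Num.max (ulo p) (Num.min (u t) (uhi p)).
have wb t : ulo p <= w t <= uhi p.
  by rewrite /w le_max lexx/= ge_max lu ge_min lexx orbT.
have mw : measurable_fun `[0, T] w.
  apply: measurable_realfun.measurable_maxr; first exact: measurable_cst.
  by apply: measurable_realfun.measurable_minr => //; exact: measurable_cst.
have wi : mu.-integrable `[0, T] (EFin \o w).
  apply: measurable_bounded_integrable => //.
  - rewrite [ltLHS](lebesgue_measure_itv `[0, T]) /=.
    by case: ifPn => //; rewrite -EFinB ltry.
  - exists (`|ulo p| + `|uhi p|); split; first by rewrite num_real.
    move=> M hM t _; apply: le_trans (ltW hM).
    have /andP[w1 w2] := wb t; rewrite ler_norml; apply/andP; split.
      rewrite (le_trans _ w1)// lerNl (le_trans (ler_norm _))// normrN lerDl.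
      exact: normr_ge0.
    by rewrite (le_trans w2)// (le_trans (ler_norm _))// lerDr normr_ge0.
have uw t : 0 <= t <= T -> \int[mu]_(s in `[0, t]) u s = \int[mu]_(s in `[0, t]) w s.
  move=> /andP[t0 tT]; congr fine.
  have sub : [set` `[0, t]] `<=` [set` `[0, T]] by apply: subset_itv; rewrite bnd_simp.
  apply: ae_eq_integral => //.
  - by apply/measurable_EFinP; apply: measurable_funS mfu.
  - by apply/measurable_EFinP; apply: measurable_funS mw.
  - move: ubnd; apply: filterS; first exact: (ae_filter_ringOfSetsType mu).
    move=> r h rt; congr EFin.
    have /andP[h1 h2] := h (sub _ rt).
    by rewrite /w min_l// max_r.
have y1E t : 0 <= t <= T -> (y t).c1 = (y 0).c1 + \int[mu]_(s in `[0, t]) w s.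
  move=> tT; have [|-> _] := yE t; first by rewrite in_itv.
  by rewrite y00 uw.
have y2E (k : 'I_2) t : 0 <= t <= T -> y t 0 (nxt k) =
    y 0 0 (nxt k) + \int[mu]_(s in `[0, t]) y s 0 (cur k).
  by move=> tT; have [|_ ->] := yE t; rewrite ?in_itv// y00.
(* An indefinite integral is continuous, hence integrable on a compact interval: integrability
   passes from the control to [x_1] and then to [x_2]. *)
have ctsI (f g : R -> R) c : mu.-integrable `[0, T] (EFin \o f) ->
    (forall t, 0 <= t <= T -> g t = c + \int[mu]_(s in `[0, t]) f s) ->
    mu.-integrable `[0, T] (EFin \o g).
  move=> fi gE; apply: continuous_compact_integrable; first exact: segment_compact.
  have cf := parameterized_integral_continuous T0 fi.
  apply: (@subspace_eq_continuous _ _ _ (fun t => c + parameterized_integral mu 0 t f)).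
    by move=> t; rewrite inE /= in_itv /= => tT; rewrite /from_subspace /= (gE t tT).
  by move=> t; apply: cvgD; [exact: cvg_cst|exact: cf].
have y1i := ctsI _ _ _ wi y1E.
split.
- move=> s t s0 st tT; rewrite y1E ?(le_trans s0 st)// (y1E s) ?s0 ?(le_trans st tT)//.
  rewrite opprD addrACA subrr add0r (Rintegral_itv_diff wi)//.
  rewrite opprK -!Rintegral_cst_itv//.
  have sub : [set` `]s, t]] `<=` [set` `[0, T]] by apply: subset_itv; rewrite bnd_simp.
  have wsi : mu.-integrable `]s, t] (EFin \o w) by apply: integrableS wi.
  by apply/andP; split; apply: le_Rintegral => //; try exact: integrable_cst_itv;
    move=> r _; have /andP[] := wb r.
- apply: I2P; rewrite ?cur0 ?nxt0 ?cur1 ?nxt1.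
  + by split=> [//|]; have := y2E 0; rewrite cur0 nxt0.
  + split; last by have := y2E 1; rewrite cur1 nxt1.
    by have := y2E 0; rewrite cur0 nxt0; exact: ctsI.
Qed.

End Kinematics.

(** * The laws that accelerate first *)

Section HalfLaw.
Variable R : realType.
(* [k] and [n] are the inverses of the two extreme accelerations. *)
Variables (k n : R).
Hypotheses (k0 : 0 < k) (n0 : 0 < n).
Implicit Types (a v P d : R) (h l : \bar R).

(** Along [hi0], [x_2 - k x_1^2 / 2] is constant; [low] is its value for the start [(a, v)], the
    velocity at which that arc crosses [x_1 = 0]. Along [lo0], [x_2 + n x_1^2 / 2] is constant;
    [vel] is its value after a rise to [P] and a hold of length [d]. [vsw] is the velocity at the
    end of the hold, [tcr] and [dsp] are the time and the displacement up to the crossing of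
    [x_1 = 0] by the [lo0] line, and [tail] is the share of that line in [dsp]. *)
Definition vel a v P d := v - k * a ^+ 2 / 2 + (k + n) * P ^+ 2 / 2 + P * d.
Definition low a v := v - k * a ^+ 2 / 2.
Definition vsw a v P d := low a v + k * P ^+ 2 / 2 + P * d.
Definition tcr a P d := (k + n) * P + d - k * a.
Definition tail V P := V * P * n - P ^+ 3 * n ^+ 2 / 6.
Definition dsp0 a v P d := low a v * ((P - a) * k) + (P ^+ 3 - a ^+ 3) * k ^+ 2 / 6
  + (low a v + k * P ^+ 2 / 2) * d + P * d ^+ 2 / 2.
Definition dsp a v P d := dsp0 a v P d + tail (vel a v P d) P.

Let kpos x y : 0 <= x -> 0 <= y -> 0 <= k * (x * y).
Proof. by move=> x0 y0; rewrite !mulr_ge0// ltW. Qed.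

Lemma vswE a v P d : vsw a v P d = vel a v P d - n * P ^+ 2 / 2.
Proof. by rewrite /vsw /vel /low; field. Qed.

(** Along [hi0], [x_2] is convex in time with its minimum at [x_1 = 0], which lies inside the arc
    only if [a < 0 < P]; on the hold it is monotone. Given the lower bound at the start, it has to
    be asked only at that minimum and at the end of the hold. The upper bound on [x_2] involves both
    halves and is left to [hi_ok]. *)
Definition half h l a v P d : Prop :=
  [/\ a <= P, (P%:E <= h)%E /\ 0 <= d, d = 0 \/ P%:E = h,
      [\/ P <= 0, 0 <= a | (l <= (low a v)%:E)%E] &
      (l <= (vsw a v P d)%:E)%E].

(** The velocity on the arc is [low + k x^2 / 2], bounded by its end values by convexity. The value
    at the peak matters only for [P >= 0], when the hold can only increase it to [vsw]. *)
Lemma half_up h l a v P d x : half h l a v P d -> (0 < h)%E -> a <= x <= P ->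
  low a v + k * x ^+ 2 / 2 <= v \/
  0 <= P /\ low a v + k * x ^+ 2 / 2 <= vsw a v P d.
Proof.
move=> [aP [Ph d0] dh _ _] h0 /andP[ax xP].
have [P0|P0] := ltP P 0.
  left; rewrite /low.
  have : 0 <= k * ((x - a) * (- x - a)) by apply: kpos; lra.
  lra.
have [xa|xa] := leP (x ^+ 2) (a ^+ 2).
  left; rewrite /low.
  have : 0 <= k * (a ^+ 2 - x ^+ 2) by rewrite mulr_ge0 ?subr_ge0// ltW.
  lra.
right; split => //; rewrite /vsw.
have x0 : 0 <= x.
  rewrite leNgt; apply/negP => x0.
  have : 0 <= (x - a) * (- x - a) by apply: mulr_ge0; lra.
  lra.
have : 0 <= k * ((P - x) * (P + x)) by apply: kpos; lra.
have := mulr_ge0 P0 d0; lra.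
Qed.

Lemma half_low h l a v P d x : half h l a v P d -> (0 < h)%E -> a <= x <= P ->
  (l <= v%:E)%E -> (l <= (low a v + k * x ^+ 2 / 2)%:E)%E.
Proof.
move=> [aP [Ph d0] dh lc ls] h0 /andP[ax xP] lv.
have case1 : v <= low a v + k * x ^+ 2 / 2 -> (l <= (low a v + k * x ^+ 2 / 2)%:E)%E.
  by move=> h1; apply: le_trans lv _; rewrite lee_fin.
have kx : 0 <= k * x ^+ 2 by rewrite mulr_ge0 ?sqr_ge0 ?ltW.
case: lc => [P0|a0|lc].
- apply: le_trans ls _; rewrite lee_fin /vsw.
  have : 0 <= k * ((P - x) * (- P - x)) by apply: kpos; lra.
  have := mulr_ge0 d0 (_ : 0 <= - P); rewrite oppr_ge0 => /(_ P0); lra.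
- apply: case1; rewrite /low.
  have : 0 <= k * ((x - a) * (x + a)) by apply: kpos; lra.
  lra.
- by apply: le_trans lc _; rewrite lee_fin; lra.
Qed.

Lemma half_hold h l a v P d s : half h l a v P d -> (0 < h)%E -> 0 <= s <= d ->
  (l <= v%:E)%E ->
  (l <= (low a v + k * P ^+ 2 / 2 + P * s)%:E)%E /\
  (0 <= P -> low a v + k * P ^+ 2 / 2 + P * s <= vsw a v P d) /\
  (P < 0 -> low a v + k * P ^+ 2 / 2 + P * s <= v).
Proof.
move=> hh h0 /andP[s0 sd] lv; have [aP [Ph d0] dh lc ls] := hh.
have [P0|P0] := leP 0 P.
  split; last first.
    split=> [_|]; last by lra.
    have := mulr_ge0 P0 (_ : 0 <= d - s); rewrite subr_ge0 => /(_ sd); rewrite /vsw; lra.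
  apply: le_trans (half_low (x := P) hh h0 _ lv) _; first by rewrite aP lexx.
  by rewrite lee_fin lerDl mulr_ge0.
have d00 : d = 0.
  case: dh => // Pe; move: h0; rewrite -Pe lte_fin => ?; lra.
have -> : s = 0 by lra.
split; last first.
  split=> [|_]; first by lra.
  have : 0 <= k * ((P - a) * (- P - a)) by apply: kpos; lra.
  rewrite /low; lra.
by move: ls; rewrite /vsw d00 !mulr0.
Qed.

Lemma half_neg h l a v P d : half h l a v P d -> (0 < h)%E -> P <= 0 ->
  vsw a v P d <= v.
Proof.
move=> [aP [Ph d0] dh lc ls] h0 P0; rewrite /vsw /low.
have : 0 <= k * ((P - a) * (- P - a)) by apply: kpos; lra.
have := mulr_ge0 d0 (_ : 0 <= - P); rewrite oppr_ge0 => /(_ P0); lra.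
Qed.

End HalfLaw.

(** * The seven-arc law and its state constraints *)

Section HiLaw.
Variables (R : realType) (p : bounds R) (x0 xf : state R).
Hypotheses (hulo : ulo p < 0) (huhi : 0 < uhi p).
Hypothesis hxlo : forall k : 'I_2, (xlo p k < 0)%E.
Hypothesis hxhi : forall k : 'I_2, (0 < xhi p k)%E.
Hypotheses (wx0 : within p x0) (wxf : within p xf).
Implicit Types (P d Q e c : R).

Local Notation K := (uhi p).
Local Notation k := ((uhi p)^-1).
Local Notation n := ((- ulo p)^-1).
Local Notation l1 := (xlo p 0).
Local Notation h1 := (xhi p 0).
Local Notation l2 := (xlo p 1).
Local Notation h2 := (xhi p 1).
Local Notation a := (x0.c1).
Local Notation v := (x0.c2).
Local Notation b := (- xf.c1).
Local Notation w := (xf.c2).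

Lemma kgt0 : 0 < k. Proof. by rewrite invr_gt0. Qed.
Lemma ngt0 : 0 < n. Proof. by rewrite invr_gt0 oppr_gt0. Qed.

(** Without a cruise there is a single [lo0] arc, from [x_1 = P] to [x_1 = - Q], and all of it is
    put in third place: it need not meet [x_1 = 0], and splitting it there could give a negative
    duration. With a cruise it is split at [x_1 = 0]. Every law thus has the same seven arcs, some
    possibly of length 0. *)
Definition mid3 P Q c := if c == 0 then (P + Q) * n else P * n.
Definition mid5 Q c := if c == 0 then 0 else Q * n.

Definition hi_arcs P d Q e c : seq (R * R) :=
  [:: (K, (Q - b) * k); (0, e); (ulo p, mid5 Q c); (0, c);
      (ulo p, mid3 P Q c); (0, d); (K, (P - a) * k)].

Definition hi_tot P d Q e c := tcr k n a P d + tcr k n b Q e + c.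
Definition hi_dsp P d Q e c :=
  dsp k n a v P d + dsp k n b w Q e + c * vel k n a v P d.

(* Velocities are parametrized by the crossing of [x_1 = 0] by the (extended)
   [lo0] line, where the two half laws, the second one reversed in time, must
   agree; [c] is the time spent on [x_2 = h2]. *)
Definition hi_ok P d Q e c : Prop :=
  [/\ half k h1 l2 a v P d /\ half k (- l1)%E l2 b w Q e,
      0 <= P + Q /\ vel k n a v P d = vel k n b w Q e,
      0 <= c,
      c = 0 \/ [/\ 0 <= P, 0 <= Q & (vel k n a v P d)%:E = h2] &
      [\/ P <= 0, Q <= 0 | ((vel k n a v P d)%:E <= h2)%E]].

Lemma dur_hi_arcs P d Q e c : dur (hi_arcs P d Q e c) = hi_tot P d Q e c.
Proof.
rewrite /= /hi_tot /tcr /mid3 /mid5; case: ifPn => [/eqP->|_]; lra.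
Qed.

Definition z1 P d : state R := fin x0 [:: (0, d); (K, (P - a) * k)].

Let K0 : K != 0. Proof. exact: lt0r_neq0. Qed.
Let m0 : - ulo p != 0. Proof. by rewrite lt0r_neq0// oppr_gt0. Qed.
Let u0 : ulo p != 0. Proof. by rewrite ltr0_neq0. Qed.

Lemma z1E P d : z1 P d = mkst P (vsw k a v P d) (x0.c3 + dsp0 k a v P d).
Proof.
apply: stP; rewrite /z1 /= /flow !mkstE /vsw /dsp0 /low; field; exact: K0.
Qed.

Definition z2 P d Q e c : state R :=
  fin (z1 P d) [:: (ulo p, mid5 Q c); (0, c); (ulo p, mid3 P Q c)].

(** The state before the second hold is reached from the left but described by the data of the
    second half: both halves use the same [lo0] parabola because their crossing velocities agree. *)
Lemma z2E P d Q e c : vel k n a v P d = vel k n b w Q e ->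
   z2 P d Q e c = mkst (- Q) (vsw k b w Q e)
     (x0.c3 + hi_dsp P d Q e c - dsp0 k b w Q e).
Proof.
move=> VW; rewrite /z2 z1E /= /flow !mkstE.
rewrite /hi_dsp /dsp -VW /tail !(vswE _ n) -VW.
rewrite /mid3 /mid5; case: ifPn => [/eqP->|_]; apply: stP; rewrite !mkstE;
  field; rewrite ?u0 ?m0//.
Qed.

Lemma fin_hi_arcs P d Q e c : vel k n a v P d = vel k n b w Q e ->
  fin x0 (hi_arcs P d Q e c) = mkst (xf.c1) w (x0.c3 + hi_dsp P d Q e c).
Proof.
move=> VW.
have -> : fin x0 (hi_arcs P d Q e c) =
  flow (flow (z2 P d Q e c) 0 e) K ((Q - b) * k) by [].
rewrite z2E// /flow !mkstE /vsw /dsp0 /low; apply: stP; rewrite !mkstE;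
  field; exact: K0.
Qed.

Lemma within_mkst (s : state R) :
  (l1 <= s.c1%:E)%E -> (s.c1%:E <= h1)%E ->
  (l2 <= s.c2%:E)%E -> (s.c2%:E <= h2)%E -> within p s.
Proof. by move=> s1 s2 s3 s4; apply/withinE; rewrite s1 s2 s3 s4. Qed.

Fixpoint arcs_within (x : state R) (l : seq (R * R)) : Prop :=
  if l is (u, d) :: l' then
    arcs_within x l' /\
    forall s, 0 <= s <= d -> within p (flow (fin x l') u s)
  else within p x.

Lemma st_within x l : durs_ge0 l -> arcs_within x l ->
  forall t, 0 <= t <= dur l -> within p (st x l t).
Proof.
elim: l => [//|[u d] l IH] /durs_ge0_cons[/= d0 l0] [wl wa] t /andP[t0 td].
case: ifPn => tl; first by apply: IH => //; rewrite t0.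
by apply: wa; rewrite -ltNge in tl; lra.
Qed.

Section Admissible.
Variables (P d Q e c : R).
Hypothesis ok : hi_ok P d Q e c.
Local Notation V := (vel k n a v P d).

Let halfL : half k h1 l2 a v P d. Proof. by case: ok => -[]. Qed.
Let halfR : half k (- l1)%E l2 b w Q e. Proof. by case: ok => -[]. Qed.
Let PQ : 0 <= P + Q. Proof. by case: ok => _ []. Qed.
Let VW : V = vel k n b w Q e. Proof. by case: ok => _ []. Qed.
Let c_ge0 : 0 <= c. Proof. by case: ok. Qed.
Let h1_gt0 : (0 < h1)%E. Proof. exact: hxhi. Qed.
Let l1_gt0 : (0 < - l1)%E. Proof. by rewrite oppe_gt0. Qed.
Let k_gt0 : 0 < k. Proof. exact: kgt0. Qed.
Let n_gt0 : 0 < n. Proof. exact: ngt0. Qed.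
Let vl : (l2 <= v%:E)%E /\ (v%:E <= h2)%E.
Proof. by have /withinE[_ /andP[]] := wx0. Qed.
Let wl : (l2 <= w%:E)%E /\ (w%:E <= h2)%E.
Proof. by have /withinE[_ /andP[]] := wxf. Qed.
Let al : (l1 <= a%:E)%E /\ (a%:E <= h1)%E.
Proof. by have /withinE[/andP[]] := wx0. Qed.
Let bl : (l1 <= xf.c1%:E)%E /\ (xf.c1%:E <= h1)%E.
Proof. by have /withinE[/andP[]] := wxf. Qed.

(** [hi_ok] bounds the crossing velocity only if [P] and [Q] are both positive, when the top of the
    [lo0] parabola lies inside the arc. If [P <= 0], then [x_2] decreases from [v] to the first
    switch, and [Q >= - P] puts the second switch no higher on the same parabola; the case [Q <= 0]
    is symmetric. *)
Lemma vsw_le : ((vsw k a v P d)%:E <= h2)%E /\ ((vsw k b w Q e)%:E <= h2)%E.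
Proof.
have PQ' := PQ.
have nP x : 0 <= n * x ^+ 2 by rewrite mulr_ge0 ?sqr_ge0 ?ltW ?ngt0.
have [Ea Eb] := (vswE k n a v P d, vswE k n b w Q e).
have [P0|P0] := leP P 0.
  have Q0 : 0 <= Q by lra.
  have va : vsw k a v P d <= v by apply: half_neg halfL _ _.
  split; first by apply: le_trans (proj2 vl); rewrite lee_fin.
  apply: le_trans (proj2 vl); rewrite lee_fin; apply: le_trans va.
  rewrite Ea Eb -VW.
  have : 0 <= n * ((Q - P) * (P + Q)).
    by apply: mulr_ge0; [exact: ltW|apply: mulr_ge0 => //; lra].
  lra.
have [Q0|Q0] := leP Q 0.
  have va : vsw k b w Q e <= w by apply: half_neg halfR _ _.
  split; last by apply: le_trans (proj2 wl); rewrite lee_fin.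
  apply: le_trans (proj2 wl); rewrite lee_fin; apply: le_trans va.
  rewrite Ea Eb -VW.
  have : 0 <= n * ((P - Q) * (P + Q)).
    by apply: mulr_ge0; [exact: ltW|apply: mulr_ge0 => //; lra].
  lra.
have Vh : (V%:E <= h2)%E by case: ok => _ _ _ _ [h|h|//]; exfalso; lra.
rewrite Ea Eb -VW; split; apply: le_trans Vh; rewrite lee_fin gerBl;
  apply: divr_ge0 => //; exact: nP.
Qed.

(** On the [lo0] arc [x_2 = V - n x_1^2 / 2] is least at one of the ends; it is greatest at
    [x_1 = 0] if the arc contains that point, and at an end otherwise. *)
Lemma mid_bounds x : - Q <= x <= P ->
  (l2 <= (V - n * x ^+ 2 / 2)%:E)%E /\ ((V - n * x ^+ 2 / 2)%:E <= h2)%E.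
Proof.
move=> /andP[Qx xP]; have PQ' := PQ.
have [Ea Eb] := (vswE k n a v P d, vswE k n b w Q e).
have npos y z : 0 <= y -> 0 <= z -> 0 <= n * (y * z).
  by move=> y0 z0; apply: mulr_ge0; [exact: ltW|exact: mulr_ge0].
split.
  have [xx|xx] := leP 0 x.
    case: halfL => _ _ _ _ /le_trans -> //; rewrite lee_fin Ea.
    have := npos (P - x) (P + x) _ _; lra.
  case: halfR => _ _ _ _ /le_trans -> //; rewrite lee_fin Eb -VW.
  have := npos (Q - x) (Q + x) _ _; lra.
have [hP hQ] := vsw_le.
have [P0|P0] := leP P 0.
  apply: le_trans hP; rewrite lee_fin Ea.
  have := npos (P - x) (- P - x) _ _; lra.
have [Q0|Q0] := leP Q 0.
  apply: le_trans hQ; rewrite lee_fin Eb -VW.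
  have := npos (Q + x) (x - Q) _ _; lra.
have Vh : (V%:E <= h2)%E by case: ok => _ _ _ _ [h|h|//]; exfalso; lra.
apply: le_trans Vh; rewrite lee_fin gerBl.
by have := npos 1 (x ^+ 2) _ _; rewrite sqr_ge0; lra.
Qed.

Lemma mid_ge0 : 0 <= mid3 P Q c /\ 0 <= mid5 Q c.
Proof.
have PQ' := PQ; have n0' := n_gt0.
rewrite /mid3 /mid5; case: ifPn => c0; first by rewrite mulr_ge0// ltW.
case: ok => _ _ _ [cE|[P0 Q0 _]] _; first by rewrite cE eqxx in c0.
by split; rewrite mulr_ge0// ltW.
Qed.

Lemma hi_durs : durs_ge0 (hi_arcs P d Q e c).
Proof.
have [m3 m5] := mid_ge0.
case: halfL => aP [_ d0] _ _ _; case: halfR => bQ [_ e0] _ _ _.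
move=> q; rewrite !inE => /or4P[/eqP->|/eqP->|/eqP->|/or4P[|||]/eqP->] //=.
- by rewrite mulr_ge0 ?subr_ge0// ltW.
- by rewrite mulr_ge0 ?subr_ge0// ltW.
Qed.

Let wR (s : state R) (x : R) : s.c1 = - x -> b <= x <= Q -> (l2 <= s.c2%:E)%E ->
  (s.c2%:E <= h2)%E -> within p s.
Proof.
move=> sx /andP[bx xQ] s1 s2; apply: within_mkst => //; rewrite sx.
- case: halfR => _ [Ql _] _ _ _; rewrite leeNr in Ql; apply: le_trans Ql _.
  by rewrite -EFinN lee_fin lerN2.
- by apply: le_trans (proj2 bl); rewrite lee_fin lerNl.
Qed.

Let wL (s : state R) (x : R) : s.c1 = x -> a <= x <= P -> (l2 <= s.c2%:E)%E ->
  (s.c2%:E <= h2)%E -> within p s.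
Proof.
move=> sx /andP[ax xP] s1 s2; apply: within_mkst => //; rewrite sx.
- by apply: le_trans (proj1 al) _; rewrite lee_fin.
- case: halfL => _ [Ph _] _ _ _; apply: le_trans _ Ph.
  by rewrite lee_fin.
Qed.

Let w_mid (s : state R) (x : R) : s.c1 = x -> s.c2 = V - n * x ^+ 2 / 2 -> - Q <= x <= P ->
  within p s.
Proof.
move=> sx s2 /andP[Qx xP]; have [m1 m2] : (l2 <= s.c2%:E)%E /\ (s.c2%:E <= h2)%E.
  by rewrite s2; apply: mid_bounds; rewrite Qx.
have [x0'|x0'] := leP 0 x.
  apply: within_mkst => //; rewrite sx.
    by apply: ltW; apply: lt_le_trans (hxlo 0) _; rewrite lee_fin.
  by case: halfL => _ [Ph _] _ _ _; apply: le_trans Ph; rewrite lee_fin.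
apply: within_mkst => //; rewrite sx.
  case: halfR => _ [Ql _] _ _ _; rewrite leeNr in Ql; apply: le_trans Ql _.
  by rewrite -EFinN lee_fin.
by apply: ltW; apply: le_lt_trans (hxhi 0); rewrite lee_fin ltW.
Qed.

Lemma lo_arc_le s (x : R) : 0 <= s <= x * n -> 0 <= - ulo p * s <= x.
Proof.
have m_gt0 : 0 < - ulo p by rewrite oppr_gt0.
move=> /andP[s0 sx]; rewrite mulr_ge0 ?(ltW m_gt0)//=.
rewrite -(ler_pM2l m_gt0) in sx; apply: le_trans sx _.
by rewrite mulrCA mulfV// mulr1.
Qed.

Lemma hi_arc_le s (x : R) : 0 <= s <= x * k -> 0 <= K * s <= x.
Proof.
move=> /andP[s0 sx]; rewrite mulr_ge0 ?(ltW huhi)//=.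
rewrite -(ler_pM2l huhi) in sx; apply: le_trans sx _.
by rewrite mulrCA mulfV// mulr1.
Qed.

Lemma lo_arc_c2 (x0' V' s : R) :
  (V' - n * x0' ^+ 2 / 2) + x0' * s + ulo p * s ^+ 2 / 2 =
  V' - n * (x0' + ulo p * s) ^+ 2 / 2.
Proof. by field; rewrite ?u0 ?m0. Qed.

Lemma hi_arc_c2 (x0' V' s : R) :
  (V' + k * x0' ^+ 2 / 2) + x0' * s + K * s ^+ 2 / 2 =
  V' + k * (x0' + K * s) ^+ 2 / 2.
Proof. by field; exact: K0. Qed.

Lemma hi_arcs_within : arcs_within x0 (hi_arcs P d Q e c).
Proof.
have [vP vQ] := vsw_le; have [m3 m5] := mid_ge0.
have [Ea Eb] := (vswE k n a v P d, vswE k n b w Q e).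
have vlow : v = low k a v + k * a ^+ 2 / 2 by rewrite /low; lra.
have up y z : y <= z -> (z%:E <= h2)%E -> (y%:E <= h2)%E.
  by move=> yz; apply: le_trans; rewrite lee_fin.
have mid_in x : 0 <= x <= P + Q -> - Q <= P - x <= P by lra.
split; last first.
  move=> s /hi_arc_le/andP[s0 sx].
  have -> : fin x0 [:: (0, e); (ulo p, mid5 Q c); (0, c); (ulo p, mid3 P Q c);
     (0, d); (K, (P - a) * k)] = flow (z2 P d Q e c) 0 e by [].
  rewrite z2E// /flow !mkstE.
  have xr : b <= Q - K * s <= Q by lra.
  apply: (@wR _ (Q - K * s)); rewrite ?mkstE//; first lra.
  - have := half_low kgt0 halfR l1_gt0 xr (proj1 wl).
    congr (_ <= EFin _)%E; rewrite /vsw /=; field; exact: K0.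
  - set y := (X in (X%:E <= _)%E).
    have -> : y = low k b w + k * (Q - K * s) ^+ 2 / 2.
      by rewrite /y /vsw; field; exact: K0.
    have [h|[_ h]] := half_up kgt0 halfR l1_gt0 xr.
      exact: up h (proj2 wl).
    exact: up h vQ.
split; last first.
  move=> s /andP[s0 se].
  have -> : fin x0 [:: (ulo p, mid5 Q c); (0, c); (ulo p, mid3 P Q c);
     (0, d); (K, (P - a) * k)] = z2 P d Q e c by [].
  rewrite z2E// /flow !mkstE.
  have [|h1' [h2' h3']] := half_hold kgt0 (s := e - s) halfR l1_gt0 _ (proj1 wl).
    by lra.
  have bQ : b <= Q by case: halfR.
  apply: (@wR _ Q); rewrite ?mkstE ?lexx ?bQ//; first lra.
  - by move: h1'; congr (_ <= EFin _)%E; rewrite /vsw; lra.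
  - set y := (X in (X%:E <= _)%E).
    have -> : y = low k b w + k * Q ^+ 2 / 2 + Q * (e - s) by rewrite /y /vsw; lra.
    have [Q0|Q0] := leP 0 Q; first exact: up (h2' Q0) vQ.
    exact: up (h3' Q0) (proj2 wl).
have Ez1 : fin x0 [:: (0, d); (K, (P - a) * k)] = z1 P d by [].
have arc3 s : 0 <= s <= mid3 P Q c -> within p (flow (z1 P d) (ulo p) s).
  move=> /andP[s0 sm].
  have : 0 <= s <= (P + Q) * n.
    rewrite s0 (le_trans sm)// /mid3; case: ifPn => // c0.
    case: ok => _ _ _ [cE|[P0 Q0 _]] _; first by rewrite cE eqxx in c0.
    by rewrite ler_pM2r ?ngt0// lerDl.
  move=> /lo_arc_le us; apply: (@w_mid _ (P - - ulo p * s)).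
  - by rewrite z1E /flow !mkstE; lra.
  - by rewrite z1E /flow !mkstE Ea lo_arc_c2; do 3 congr (_ _ _); lra.
  - exact: mid_in.
have cruise s : c != 0 -> flow (flow (z1 P d) (ulo p) (mid3 P Q c)) 0 s =
    mkst 0 V ((flow (z1 P d) (ulo p) (mid3 P Q c)).c3 + V * s).
  move=> c0; apply: stP; rewrite z1E /flow !mkstE /mid3 (negbTE c0) ?Ea;
    by field; rewrite ?u0 ?m0.
have PQ0 : c != 0 -> 0 <= P /\ 0 <= Q.
  by move=> c0; case: ok => _ _ _ [cE|[]//] _; rewrite cE eqxx in c0.
split; last first.
  move=> s; rewrite /mid5; case: ifPn => c0.
    move=> s0; have -> : s = 0 by lra.
    rewrite /= (eqP c0) !flow0 [flow _ 0 d]Ez1; apply: arc3.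
    by move: m3; rewrite (eqP c0) => ->; rewrite lexx.
  move=> /lo_arc_le us; rewrite /= [flow _ 0 d]Ez1 cruise//.
  have [P0 Q0] := PQ0 c0.
  apply: (@w_mid _ (0 - - ulo p * s)).
  - by rewrite /flow !mkstE; lra.
  - have -> : 0 - - ulo p * s = 0 + ulo p * s by lra.
    by rewrite -lo_arc_c2 /flow !mkstE; lra.
  - by lra.
split; last first.
  move=> s; have [c0|c0] := eqVneq c 0.
    rewrite c0 => s0; have -> : s = 0 by lra.
    rewrite flow0; apply: arc3.
    by move: m3; rewrite c0 => ->; rewrite lexx.
  move=> _; rewrite /= [flow _ 0 d]Ez1 cruise//.
  have [P0 Q0] := PQ0 c0.
  by apply: (@w_mid _ 0); rewrite ?mkstE; lra.
split; first split => //.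
  - split => //.
    move=> s /hi_arc_le/andP[s0 sx] /=.
    have xr : a <= a + K * s <= P by lra.
    apply: (@wL _ (a + K * s)); rewrite /flow ?mkstE//.
    + rewrite {1}vlow hi_arc_c2.
      by have := half_low kgt0 halfL h1_gt0 xr (proj1 vl).
    + rewrite {1}vlow hi_arc_c2.
      have [h|[_ h]] := half_up kgt0 halfL h1_gt0 xr; first exact: up h (proj2 vl).
      exact: up h vP.
  - move=> s sd.
    have [h1' [h2' h3']] := half_hold kgt0 (s := s) halfL h1_gt0 sd (proj1 vl).
    have aP : a <= P by case: halfL.
    have KP : K * ((P - a) * k) = P - a by field; exact: K0.
    have c2E : (flow (fin x0 [:: (K, (P - a) * k)]) 0 s).c2 =
        low k a v + k * P ^+ 2 / 2 + P * s.
      by rewrite /= /flow !mkstE /low; field; exact: K0.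
    apply: (@wL _ P); rewrite ?c2E ?lexx ?aP//.
      by rewrite /= /flow !mkstE; lra.
    have [P0|P0] := leP 0 P; first exact: up (h2' P0) vP.
    exact: up (h3' P0) (proj2 vl).
by move=> s; rewrite [fin _ _]Ez1; exact: arc3.
Qed.

Lemma hi_feasible :
  feasible p x0 (mkst xf.c1 w (x0.c3 + hi_dsp P d Q e c)) (hi_tot P d Q e c)
    (st x0 (hi_arcs P d Q e c)) (ct (hi_arcs P d Q e c)).
Proof.
rewrite -(fin_hi_arcs c VW) -dur_hi_arcs; apply: st_feasible.
- exact: hi_durs.
- by rewrite !ltW.
- by move=> q; rewrite !inE => /or4P[/eqP->|/eqP->|/eqP->|/or4P[|||]/eqP->] /=;
    rewrite ?lexx !ltW// (lt_trans hulo).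
- by apply: st_within; [exact: hi_durs|exact: hi_arcs_within].
Qed.

End Admissible.

End HiLaw.

(** * Switching times and extremality of the law in x_1 *)

Section HiArcs.
Variables (R : realType) (p : bounds R) (x0 xf : state R).
Hypotheses (hulo : ulo p < 0) (huhi : 0 < uhi p).
Hypothesis hxlo : forall k : 'I_2, (xlo p k < 0)%E.
Hypothesis hxhi : forall k : 'I_2, (0 < xhi p k)%E.
Hypotheses (wx0 : within p x0) (wxf : within p xf).
Implicit Types (P d Q e c : R).

Local Notation K := (uhi p).
Local Notation k := ((uhi p)^-1).
Local Notation n := ((- ulo p)^-1).
Local Notation l1 := (xlo p 0).
Local Notation h1 := (xhi p 0).
Local Notation a := (x0.c1).
Local Notation v := (x0.c2).
Local Notation b := (- xf.c1).
Local Notation w := (xf.c2).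

(** Serves before the law is known to respect the state bounds: domination, from which its lower
    bound on [x_2] is deduced, already compares with it. Feasibility is therefore invoked for
    infinite bounds. *)
Lemma st_kinematic x (l : seq (R * R)) : durs_ge0 l ->
  (forall q, q \in l -> ulo p <= q.1 <= K) ->
  kinematic (- ulo p) K (dur l) (st x l).
Proof.
move=> l0 lb.
pose q := Bounds (ulo p) K (fun=> -oo%E) (fun=> +oo%E).
have /feasible_kinematic[] : feasible q x (fin x l) (dur l) (st x l) (ct l).
  apply: st_feasible => //=; first by rewrite !ltW.
  by move=> t _; apply/withinE; rewrite !leNye !leey.
- by rewrite ltW// (lt_trans hulo).
- by [].
Qed.

Let K0 : K != 0. Proof. exact: lt0r_neq0. Qed.
Let m0 : - ulo p != 0. Proof. by rewrite lt0r_neq0// oppr_gt0. Qed.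
Let u0 : ulo p != 0. Proof. by rewrite ltr0_neq0. Qed.

Section Arcs.
Variables (P d Q e c : R).
Local Notation l := (hi_arcs p x0 xf P d Q e c).
Local Notation m3 := (mid3 p P Q c).
Local Notation m5 := (mid5 p Q c).
Hypothesis l_ge0 : durs_ge0 l.

Lemma hi_arcs_ctrl q : q \in l -> ulo p <= q.1 <= K.
Proof.
rewrite !inE => /or4P[/eqP->|/eqP->|/eqP->|/or4P[|||]/eqP->] /=;
  by rewrite ?lexx !ltW// (lt_trans hulo).
Qed.

Definition T1 := (P - a) * k.
Definition T2 := T1 + d.
Definition T3 := T2 + m3.
Definition T4 := T3 + c.
Definition T5 := T4 + m5.
Definition T6 := T5 + e.
Definition T7 := T6 + (Q - b) * k.

Lemma T7E : T7 = hi_tot p x0 xf P d Q e c.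
Proof.
rewrite -dur_hi_arcs /= /T7 /T6 /T5 /T4 /T3 /T2 /T1.
by rewrite add0r.
Qed.

Lemma hi_arcs_times :
  [/\ 0 <= T1, T1 <= T2, T2 <= T3 & T3 <= T4] /\
  [/\ T4 <= T5, T5 <= T6 & T6 <= T7].
Proof.
have mem q : q \in l -> 0 <= q.2 by exact: l_ge0.
have /= ? := mem (K, (Q - b) * k); have /= ? := mem (0, e).
have /= ? := mem (ulo p, m5); have /= ? := mem (0, c).
have /= ? := mem (ulo p, m3); have /= ? := mem (0, d).
have /= ? := mem (K, (P - a) * k).
rewrite /T7 /T6 /T5 /T4 /T3 /T2 !lerDl /T1.
by do !split; match goal with H : _ -> is_true ?g |- is_true ?g => apply: H end;
  rewrite !inE eqxx ?orbT.
Qed.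

Local Notation s1 := (flow x0 K T1).
Local Notation s2 := (z1 p x0 P d).
Definition s3 := flow s2 (ulo p) m3.
Definition s4 := flow s3 0 c.
Local Notation s5 := (z2 p x0 P d Q e c).
Definition s6 := flow s5 0 e.

Let stE ll lr u dd t : l = ll ++ (u, dd) :: lr -> dur lr <= t <= dur lr + dd ->
  st x0 l t = flow (fin x0 lr) u (t - dur lr).
Proof. by move=> lE; rewrite lE; apply: st_arc; rewrite -lE. Qed.

Let ctE ll lr u dd t : l = ll ++ (u, dd) :: lr -> dur lr < t <= dur lr + dd ->
  ct l t = u.
Proof. by move=> lE; rewrite lE; apply: ct_arc; rewrite -lE. Qed.

Lemma arc1 t : 0 <= t <= T1 -> st x0 l t = flow x0 K t.
Proof.
move=> tT; rewrite (@stE (take 6 l) (drop 7 l) K ((P - a) * k))//= ?subr0//.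
by rewrite add0r.
Qed.

Lemma arc2 t : T1 <= t <= T2 -> st x0 l t = flow s1 0 (t - T1).
Proof.
move=> tT; rewrite (@stE (take 5 l) (drop 6 l) 0 d)//= ?add0r//.
Qed.

Lemma arc3 t : T2 <= t <= T3 -> st x0 l t = flow s2 (ulo p) (t - T2).
Proof.
by move=> tT; rewrite (@stE (take 4 l) (drop 5 l) (ulo p) m3)//= ?add0r.
Qed.

Lemma arc4 t : T3 <= t <= T4 -> st x0 l t = flow s3 0 (t - T3).
Proof.
by move=> tT; rewrite (@stE (take 3 l) (drop 4 l) 0 c)//= ?add0r.
Qed.

Lemma arc5 t : T4 <= t <= T5 -> st x0 l t = flow s4 (ulo p) (t - T4).
Proof.
by move=> tT; rewrite (@stE (take 2 l) (drop 3 l) (ulo p) m5)//= ?add0r.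
Qed.

Lemma arc6 t : T5 <= t <= T6 -> st x0 l t = flow s5 0 (t - T5).
Proof.
by move=> tT; rewrite (@stE (take 1 l) (drop 2 l) 0 e)//= ?add0r.
Qed.

Lemma arc7 t : T6 <= t <= T7 -> st x0 l t = flow s6 K (t - T6).
Proof.
by move=> tT; rewrite (@stE (take 0 l) (drop 1 l) K ((Q - b) * k))//= ?add0r.
Qed.

Lemma ctl1 t : 0 < t <= T1 -> ct l t = K.
Proof.
by move=> tT; apply: (@ctE (take 6 l) (drop 7 l) K ((P - a) * k)) => //=; rewrite add0r.
Qed.
Lemma ctl2 t : T1 < t <= T2 -> ct l t = 0.
Proof.
by move=> tT; apply: (@ctE (take 5 l) (drop 6 l) 0 d) => //=; rewrite add0r.
Qed.
Lemma ctl3 t : T2 < t <= T3 -> ct l t = ulo p.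
Proof.
by move=> tT; apply: (@ctE (take 4 l) (drop 5 l) (ulo p) m3) => //=; rewrite add0r.
Qed.
Lemma ctl4 t : T3 < t <= T4 -> ct l t = 0.
Proof.
by move=> tT; apply: (@ctE (take 3 l) (drop 4 l) 0 c) => //=; rewrite add0r.
Qed.
Lemma ctl5 t : T4 < t <= T5 -> ct l t = ulo p.
Proof.
by move=> tT; apply: (@ctE (take 2 l) (drop 3 l) (ulo p) m5) => //=; rewrite add0r.
Qed.
Lemma ctl6 t : T5 < t <= T6 -> ct l t = 0.
Proof.
by move=> tT; apply: (@ctE (take 1 l) (drop 2 l) 0 e) => //=; rewrite add0r.
Qed.
Lemma ctl7 t : T6 < t <= T7 -> ct l t = K.
Proof.
by move=> tT; apply: (@ctE (take 0 l) (drop 1 l) K ((Q - b) * k)) => //=; rewrite add0r.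
Qed.

Lemma st_hi_T7 : st x0 l T7 = fin x0 l.
Proof. by rewrite T7E -dur_hi_arcs st_dur. Qed.

(** Even if the velocities do not match, the law ends with the right [x_1] and misses [x_2] exactly
    by the gap between the crossing velocities. The sign of the gap can thus be read off a
    comparison of end points. *)
Lemma fin_c1_c2 : c = 0 -> (fin x0 l).c1 = xf.c1 /\
  (fin x0 l).c2 = w + (vel k n a v P d - vel k n b w Q e).
Proof.
move=> c0; have -> : fin x0 l = flow (flow (flow (flow (flow s2 (ulo p) m3) 0 c)
  (ulo p) m5) 0 e) K ((Q - b) * k) by [].
have := z1E x0 huhi P d; move: s2 => S Sz; rewrite !flowE Sz.
rewrite !mkstE /mid3 /mid5 c0 eqxx (vswE _ n).
move: (vel k n a v P d) => V; rewrite /vel.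
by split; field; rewrite ?K0 ?m0 ?u0.
Qed.

End Arcs.

Section Compare.
Variables (y : R -> state R) (P d Q e c : R).
Local Notation T := (hi_tot p x0 xf P d Q e c).
Local Notation l := (hi_arcs p x0 xf P d Q e c).
Hypothesis l_ge0 : durs_ge0 l.
Hypotheses (ky : kinematic (- ulo p) K T y) (y0 : y 0 = x0).
Hypothesis yT : (y T).c1 = xf.c1.
Hypothesis wy : forall t : R, 0 <= t <= T -> within p (y t).

(** The law raises [x_1] at the greatest rate and then keeps it at its upper bound; where that bound
    is not attained the hold is empty. *)
Lemma cmp_left : d = 0 \/ P%:E = h1 -> forall t : R, 0 <= t <= T2 P d ->
  (y t).c1 <= (st x0 l t).c1.
Proof.
move=> dh t /andP[t0 tT2].
have [[T10 T12 T23 T34] [T45 T56 T67]] := hi_arcs_times l_ge0.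
have tT : t <= T by rewrite -T7E; lra.
have sl := proj1 ky 0 t (lexx _) t0 tT.
have hi : (y t).c1 <= a + K * t by move: sl; rewrite y0; lra.
have [tT1|tT1] := leP t (T1 P).
  by rewrite (arc1 l_ge0) ?t0// !flowE.
rewrite (arc2 l_ge0) ?tT2 ?(ltW tT1)//.
have -> : (flow (flow x0 K (T1 P)) 0 (t - T1 P)).c1 = P.
  by rewrite !flowE /T1; field.
case: dh => [d0|Ph].
  have tE : t = T1 P by move: tT2 tT1; rewrite /T2 d0; lra.
  rewrite (le_trans hi)// tE /T1 le_eqVlt; apply/orP; left; apply/eqP.
  by field.
rewrite -lee_fin Ph.
by have /wy/withinE[/andP[]] : 0 <= t <= T by rewrite t0.
Qed.

Lemma z2_c1 : (z2 p x0 P d Q e c).c1 = - Q.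
Proof.
have s2c1 : (z1 p x0 P d).c1 = P by rewrite z1E// mkstE.
have -> : z2 p x0 P d Q e c = flow (flow (flow (z1 p x0 P d) (ulo p)
  (mid3 p P Q c)) 0 c) (ulo p) (mid5 p Q c) by [].
move: (z1 p x0 P d) s2c1 => S s2c1.
by rewrite !flowE s2c1 /mid3 /mid5; case: ifPn => _; field; rewrite ?u0 ?m0.
Qed.

(** The argument of [cmp_left] read backwards from the common final value of [x_1]. *)
Lemma cmp_right : e = 0 \/ Q%:E = (- l1)%E -> forall t : R, T5 P d Q c <= t <= T ->
  (st x0 l t).c1 <= (y t).c1.
Proof.
move=> eh t /andP[tT5 tT].
have [[T10 T12 T23 T34] [T45 T56 T67]] := hi_arcs_times l_ge0.
have t0 : 0 <= t by lra.
have sl := proj1 ky t T t0 tT (lexx _); rewrite yT in sl.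
have T7E' := T7E P d Q e c.
have KQ : K * ((Q - b) * k) = Q - b by field; exact: K0.
have s5c1 := z2_c1.
have hi : - Q + K * (t - T6 P d Q e c) <= (y t).c1.
  have TE : T = T6 P d Q e c + (Q - b) * k by rewrite -T7E.
  have : K * (T - t) = K * (T6 P d Q e c - t) + (Q - b) by rewrite TE; field.
  by move: sl; lra.
have [tT6|tT6] := leP (T6 P d Q e c) t.
  rewrite (arc7 l_ge0) ?tT6 ?T7E// flow_c1 /s6 flow_c1 s5c1; lra.
rewrite (arc6 l_ge0) ?tT5 ?(ltW tT6)//.
rewrite flow_c1 s5c1 mul0r addr0.
case: eh => [e0|Qh]; first by move: tT6; rewrite /T6 e0; lra.
rewrite -lee_fin EFinN Qh oppeK.
by have /wy/withinE[/andP[]] : 0 <= t <= T by rewrite t0.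
Qed.

(** The law lowers [x_1] at the greatest admissible rate; this gives the monotonicity that
    [kinematic_chord] asks for. *)
Lemma cmp_mid3 r r' : T2 P d <= r -> r <= r' -> r' <= T3 P d Q c ->
  (y r).c1 - (st x0 l r).c1 <= (y r').c1 - (st x0 l r').c1.
Proof.
move=> r2 rr r3.
have [[T10 T12 T23 T34] [T45 T56 T67]] := hi_arcs_times l_ge0.
have T7E' := T7E P d Q e c.
have := proj1 ky r r' _ rr _; rewrite -T7E' => /(_ _ _)/wrap[||]; [lra|lra|].
rewrite !(arc3 l_ge0) ?r2 ?r3 ?(le_trans r2 rr) ?(le_trans rr r3)//.
rewrite !flowE; lra.
Qed.

Lemma cmp_mid5 r r' : T4 P d Q c <= r -> r <= r' -> r' <= T5 P d Q c ->
  (y r).c1 - (st x0 l r).c1 <= (y r').c1 - (st x0 l r').c1.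
Proof.
move=> r2 rr r3.
have [[T10 T12 T23 T34] [T45 T56 T67]] := hi_arcs_times l_ge0.
have T7E' := T7E P d Q e c.
have := proj1 ky r r' _ rr _; rewrite -T7E' => /(_ _ _)/wrap[||]; [lra|lra|].
rewrite !(arc5 l_ge0) ?r2 ?r3 ?(le_trans r2 rr) ?(le_trans rr r3)//.
rewrite !flowE; lra.
Qed.

Lemma hi_arcs_kinematic : kinematic (- ulo p) K T (st x0 l).
Proof. by rewrite -dur_hi_arcs; apply: st_kinematic => // q; exact: hi_arcs_ctrl. Qed.

End Compare.
End HiArcs.

(** * Existence and domination *)

Section Peak.
Variable R : realType.
Variables (k n : R) (h : \bar R) (a v : R).
Hypotheses (k0 : 0 < k) (n0 : 0 < n) (h0 : (0 < h)%E) (ah : (a%:E <= h)%E).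
Implicit Types q : R.

(* The peak velocity and the time spent at it, as functions of the crossing
   time [q] of [x_1 = 0]. *)
Definition pk q := let A := (q + k * a) / (k + n) in
  if h is h'%:E then Num.min A h' else A.
Definition hd q := q + k * a - (k + n) * pk q.
Definition vq q := vel k n a v (pk q) (hd q).

Let c0 : 0 < k + n. Proof. exact: addr_gt0. Qed.
Let cK x : (k + n) * (x / (k + n)) = x.
Proof. by rewrite mulrC divfK// gt_eqF. Qed.

Lemma pk_dich q : ((pk q = (q + k * a) / (k + n)) /\ hd q = 0) \/
  ((pk q)%:E = h /\ 0 <= hd q /\ pk q <= (q + k * a) / (k + n)).
Proof.
have E0 : pk q = (q + k * a) / (k + n) -> hd q = 0.
  by move=> E; rewrite /hd E cK subrr.
rewrite /hd /pk in E0 *; case: h h0 E0 => [h'| |] //= h'0 E0; last by left; split; [|exact: E0].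
have [hA|hA] := leP ((q + k * a) / (k + n)) h'.
  by left; split => //; rewrite (min_l hA) in E0; exact: E0.
right; split => //; split; last exact: ltW.
by rewrite subr_ge0 -[leRHS]cK ler_pM2l// ltW.
Qed.

Lemma pk_le q : ((pk q)%:E <= h)%E.
Proof.
rewrite /pk; case: h h0 => [h'| |]//= _; first by rewrite lee_fin ge_min lexx orbT.
by rewrite leey.
Qed.

Lemma hd_ge0 q : 0 <= hd q.
Proof. by have [[_ ->]|[_ []]] := pk_dich q. Qed.

Lemma hd_pk q : hd q = 0 \/ (pk q)%:E = h.
Proof. by have [[_ ->]|[-> _]] := pk_dich q; [left|right]. Qed.

Lemma tcr_pk q : tcr k n a (pk q) (hd q) = q.
Proof. by rewrite /tcr /hd; lra. Qed.

(** A later crossing raises the peak with slope [1 / (k + n)] until the bound is met; from then on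
    only the hold grows. *)
Lemma pk_mono q q' : q <= q' ->
  0 <= pk q' - pk q /\ (k + n) * (pk q' - pk q) <= q' - q.
Proof.
move=> qq; have c0' := c0.
have E x := cK (x + k * a).
have AA : (q + k * a) / (k + n) <= (q' + k * a) / (k + n).
  by rewrite ler_pM2r ?invr_gt0// lerD2r.
have [[e1 e2]|[e1 [e2 e3]]] := pk_dich q; have [[f1 f2]|[f1 [f2 f3]]] := pk_dich q'.
- split; first by rewrite e1 f1 subr_ge0.
  by rewrite e1 f1 mulrBr !E; lra.
- split.
    by rewrite subr_ge0 -lee_fin f1 pk_le.
  have := ler_wpM2l (ltW c0) f3; rewrite E => h1.
  by rewrite e1 mulrBr E; lra.
- have pp : pk q' <= pk q by rewrite -lee_fin e1 pk_le.
  have -> : pk q' = pk q by apply/eqP; rewrite eq_le pp f1 (le_trans e3).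
  by rewrite subrr mulr0; split=> //; lra.
- have -> : pk q' = pk q by apply: EFin_inj; rewrite e1 f1.
  by rewrite subrr mulr0; split=> //; lra.
Qed.

(** [n * a] is the least crossing time allowed by [a <= P]: no rise and no hold. *)
Lemma pk_at : pk (n * a) = a /\ hd (n * a) = 0.
Proof.
have E : (n * a + k * a) / (k + n) = a by field; rewrite gt_eqF.
have : pk (n * a) = a.
  rewrite /pk E; case: h ah => //= h' ah'.
  by rewrite min_l// -lee_fin.
by move=> pE; split => //; rewrite /hd pE; lra.
Qed.

Lemma pk_ge q : n * a <= q -> a <= pk q.
Proof. by move=> /pk_mono[]; rewrite (proj1 pk_at) subr_ge0. Qed.

Lemma pk_zero : pk (- (k * a)) = 0 /\ hd (- (k * a)) = 0.
Proof.
have E : (- (k * a) + k * a) / (k + n) = 0 by rewrite addrC subrr mul0r.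
have : pk (- (k * a)) = 0.
  rewrite /pk E; case: h h0 => //= h' ah'.
  by rewrite min_l// -lee_fin ltW.
by move=> pE; split => //; rewrite /hd pE; lra.
Qed.

Lemma pk_cts : continuous pk.
Proof.
have Ac : continuous (fun q : R => (q + k * a) / (k + n)).
  by move=> q; apply: cvgMl; apply: cvgD; [exact: cvg_id|exact: cvg_cst].
rewrite /pk; case: h => [h'| |] //= q.
by apply: (@continuous_min _ _ (fun q : R => (q + k * a) / (k + n)) (cst h'));
  [exact: Ac|exact: cvg_cst].
Qed.

Lemma hd_cts : continuous hd.
Proof.
move=> q; apply: cvgB; last by apply: cvgMr; exact: pk_cts.
by apply: cvgD; [exact: cvg_id|exact: cvg_cst].
Qed.

Lemma vq_cts : continuous vq.
Proof.
move=> q; rewrite /vq /vel; apply: cvgD; last by apply: cvgM; [exact: pk_cts|exact: hd_cts].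
apply: cvgD; first exact: cvg_cst.
apply: cvgMl; apply: cvgMr.
have -> : (fun q => pk q ^+ 2) = (fun q => pk q * pk q) by apply/funext => z; rewrite expr2.
by rewrite expr2; apply: cvgM; exact: pk_cts.
Qed.

Lemma IVT_eq (f : R -> R) x y z : x <= y -> continuous f -> f x <= z -> z <= f y ->
  exists2 c, x <= c <= y & f c = z.
Proof.
move=> xy fc fx fy; have [|c cxy fcz] := @IVT _ f x y z xy (continuous_subspaceT fc).
  by rewrite ge_min fx le_max fy orbT.
by exists c => //; rewrite in_itv in cxy.
Qed.

(** The crossing velocity is lowered to the level [H] by the intermediate value theorem, between [q]
    and an earlier crossing time at which the velocity is at most [H] and the peak still
    nonnegative: [n a] (no rise) for [a >= 0], and [- k a] (rise to [x_1 = 0] only) for [a < 0]. *)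
Lemma vq_cross (H q : R) : n * a <= q -> 0 < pk q -> H <= vq q -> v <= H ->
  (0 <= a -> v + n * a ^+ 2 / 2 <= H) ->
  exists q1, [/\ n * a <= q1, q1 <= q, 0 <= pk q1 & vq q1 = H].
Proof.
move=> aq P0 Hq vH aH; have c0' := c0; have k0' := k0; have n0' := n0.
have step s : n * a <= s -> s <= q -> 0 <= pk s -> vq s <= H ->
    exists q1, [/\ n * a <= q1, q1 <= q, 0 <= pk q1 & vq q1 = H].
  move=> as_ sq ps vs; have [c /andP[sc cq] cE] := IVT_eq sq vq_cts vs Hq.
  exists c; split => //; first exact: le_trans sc.
  by have [] := pk_mono sc; lra.
have [a0|a0] := leP 0 a.
  have [pa ha] := pk_at; apply: (step (n * a)) => //; first by rewrite pa.
  rewrite /vq pa ha; have := aH a0; rewrite /vel; lra.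
have [pa ha] := pk_zero.
have n_le : n * a <= - (k * a).
  by rewrite -subr_ge0; have := mulr_gt0 c0' (_ : 0 < - a); rewrite oppr_gt0 => /(_ a0); lra.
apply: (step (- (k * a))) => //.
- rewrite leNgt; apply/negP => /ltW/pk_mono[]; rewrite pa; lra.
- by rewrite pa.
- rewrite /vq pa ha /vel.
  by have := mulr_ge0 (ltW k0') (sqr_ge0 a); lra.
Qed.

End Peak.

(** * Domination of feasible trajectories *)

Section Existence.
Variables (R : realType) (p : bounds R) (x0 xf : state R).
Hypotheses (hulo : ulo p < 0) (huhi : 0 < uhi p).
Hypothesis hxlo : forall k : 'I_2, (xlo p k < 0)%E.
Hypothesis hxhi : forall k : 'I_2, (0 < xhi p k)%E.
Hypotheses (wx0 : within p x0) (wxf : within p xf).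
Implicit Types (P d Q e c : R).

Local Notation K := (uhi p).
Local Notation k := ((uhi p)^-1).
Local Notation n := ((- ulo p)^-1).
Local Notation l1 := (xlo p 0).
Local Notation h1 := (xhi p 0).
Local Notation l2 := (xlo p 1).
Local Notation h2 := (xhi p 1).
Local Notation a := (x0.c1).
Local Notation v := (x0.c2).
Local Notation b := (- xf.c1).
Local Notation w := (xf.c2).

Let K0 : K != 0. Proof. exact: lt0r_neq0. Qed.
Let m0 : - ulo p != 0. Proof. by rewrite lt0r_neq0// oppr_gt0. Qed.
Let u0 : ulo p != 0. Proof. by rewrite ltr0_neq0. Qed.
Let k_gt0 : 0 < k := kgt0 huhi.

Lemma crossing_state P d Q c : c != 0 -> 
  s3 p x0 P d Q c = mkst 0 (vel k n a v P d) (s3 p x0 P d Q c).c3.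
Proof.
move=> c0; apply: stP; last by rewrite [RHS]mkst3.
- rewrite [RHS]mkst1 /s3 flow_c1 z1E// !mkstE /mid3 (negbTE c0).
  by field; rewrite ?u0 ?m0.
- rewrite [RHS]mkst2 /s3 flow_c2 z1E// !mkstE /mid3 (negbTE c0) (vswE _ n).
  by move: (vel k n a v P d) => V; field; rewrite ?u0 ?m0.
Qed.

Section Dominate.
Variables (y : R -> state R) (P d Q e c : R).
Local Notation T := (hi_tot p x0 xf P d Q e c).
Local Notation l := (hi_arcs p x0 xf P d Q e c).
Local Notation V := (vel k n a v P d).
Hypothesis l_ge0 : durs_ge0 l.
Hypotheses (ky : kinematic (- ulo p) K T y) (y0 : y 0 = x0).
Hypotheses (yT1 : (y T).c1 = xf.c1) (yT2 : (y T).c2 = xf.c2).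
Hypothesis wy : forall t : R, 0 <= t <= T -> within p (y t).
Hypothesis dh : d = 0 \/ P%:E = h1.
Hypothesis eh : e = 0 \/ Q%:E = (- l1)%E.
Hypothesis VW : V = vel k n b w Q e.
Hypothesis ch : c = 0 \/ [/\ 0 <= P, 0 <= Q & V%:E = h2].

(** Up to the end of the first hold the ordering of the [x_1] is integrated from the common start,
    from the second hold on it is integrated backwards from the common end, and on the [lo0] arcs
    the chord argument interpolates. The cruise runs at [h2], above every feasible [x_2]. *)
Lemma hi_dominates t : 0 <= t <= T -> (y t).c2 <= (st x0 l t).c2.
Proof.
have [[T10 T12 T23 T34] [T45 T56 T67]] := hi_arcs_times l_ge0.
have TE := T7E p x0 xf P d Q e c.
have kz' := hi_arcs_kinematic hulo huhi l_ge0.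
have z0 : st x0 l 0 = x0 by rewrite st_0.
have zT2 : (st x0 l T).c2 = xf.c2.
  by rewrite -TE st_hi_T7// fin_hi_arcs// mkstE.
have left s : 0 <= s <= T2 p x0 P d -> (y s).c2 <= (st x0 l s).c2.
  move=> /andP[s0 s2].
  have := kinematic_cmp (k := 0) ky kz' (lexx 0) s0 _ _; rewrite nxt0 cur0 z0 y0.
  move=> /(_ _ _)/wrap[||]; [by rewrite -TE; lra| |by lra].
  move=> r /andP[r0 rs]; apply: cmp_left => //.
  by apply/andP; lra.
have right s : T5 p x0 P d Q c <= s <= T -> (y s).c2 <= (st x0 l s).c2.
  move=> /andP[s5 sT].
  have := kinematic_cmp (k := 0) kz' ky (_ : 0 <= s) sT (lexx _) _.
  rewrite nxt0 cur0 zT2 yT2 => /(_ _ _)/wrap[||]; [by lra| |by lra].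
  move=> r /andP[sr rT]; apply: cmp_right => //.
  by apply/andP; lra.
move=> /andP[t0 tT].
have [t2|t2] := leP t (T2 p x0 P d); first by apply: left; rewrite t0.
have [t5|t5] := leP (T5 p x0 P d Q c) t; first by apply: right; rewrite t5.
have l2' := left (T2 p x0 P d) _; have r5' := right (T5 p x0 P d Q c) _.
have {}l2' : (y (T2 p x0 P d)).c2 <= (st x0 l (T2 p x0 P d)).c2 by apply: l2'; lra.
have {}r5' : (y (T5 p x0 P d Q c)).c2 <= (st x0 l (T5 p x0 P d Q c)).c2.
  by apply: r5'; rewrite -TE; lra.
have y2h s : 0 <= s <= T -> ((y s).c2%:E <= h2)%E.
  by move=> /wy/withinE[_ /andP[]].
have [c0|c0] := eqVneq c 0.
  have E5 : T5 p x0 P d Q c = T3 p x0 P d Q c.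
    by rewrite /T5 /T4 /mid5 c0 eqxx !addr0.
  rewrite E5 in t5 r5'.
  apply: (kinematic_chord ky kz' (s := T2 p x0 P d) (t := T3 p x0 P d Q c)) => //.
  - lra.
  - rewrite -TE; lra.
  - by move=> r r' h1' h2' h3'; apply: cmp_mid3.
  - by rewrite !ltW.
case: ch => [cE|[P0 Q0 Vh]]; first by rewrite cE eqxx in c0.
have cs := crossing_state P d Q c0.
have zc s : T3 p x0 P d Q c <= s <= T4 p x0 P d Q c -> (st x0 l s).c2 = V.
  move=> s34; rewrite (arc4 l_ge0)// cs flow_c2 !mkstE; lra.
have yV s : 0 <= s <= T -> (y s).c2 <= V.
  by move=> sT; rewrite -lee_fin Vh y2h.
have [t3|t3] := leP t (T3 p x0 P d Q c).
  apply: (kinematic_chord ky kz' (s := T2 p x0 P d) (t := T3 p x0 P d Q c)) => //.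
  - lra.
  - rewrite -TE; lra.
  - by move=> r r' h1' h2' h3'; apply: cmp_mid3.
  - by rewrite zc ?lexx// yV// -TE; lra.
  - by rewrite t3 ltW.
have [t4|t4] := leP t (T4 p x0 P d Q c).
  by rewrite zc ?t4 ?(ltW t3)// yV// t0.
apply: (kinematic_chord ky kz' (s := T4 p x0 P d Q c) (t := T5 p x0 P d Q c)) => //.
- lra.
- rewrite -TE; lra.
- by move=> r r' h1' h2' h3'; apply: cmp_mid5.
- by rewrite zc ?lexx ?T34// yV// -TE; lra.
- by rewrite !ltW.
Qed.

(** The law inherits the lower bound on [x_2] from the trajectory [y] below it, at the two places
    where [half] asks for it. *)
Lemma dominated_halves : a <= P -> (P%:E <= h1)%E -> 0 <= d ->
  b <= Q -> (Q%:E <= - l1)%E -> 0 <= e ->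
  half k h1 l2 a v P d /\ half k (- l1)%E l2 b w Q e.
Proof.
move=> aP Ph d0 bQ Qh e0; have k0' := k_gt0.
have [[T10 T12 T23 T34] [T45 T56 T67]] := hi_arcs_times l_ge0.
have TE := T7E p x0 xf P d Q e c.
have dom t : 0 <= t <= T -> (l2 <= (st x0 l t).c2%:E)%E.
  move=> tT; have /wy/withinE[_ /andP[h _]] := tT.
  by apply: le_trans h _; rewrite lee_fin; exact: hi_dominates.
split; split => //.
- have [P0|P0] := leP P 0; first by constructor 1.
  have [a0|a0] := leP 0 a; first by constructor 2.
  constructor 3; have ak : 0 <= - a * k by rewrite mulr_ge0 ?ltW// oppr_gt0.
  have t1 : 0 <= - a * k <= T1 p x0 P.
    by rewrite ak /T1 ler_pM2r//; lra.
  have := dom (- a * k); rewrite (arc1 l_ge0)// flow_c2 => /(_ _)/wrap[|].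
    by rewrite -TE; lra.
  by congr (_ <= EFin _)%E; rewrite /low; field.
- have := dom (T2 p x0 P d) _; rewrite (arc3 l_ge0) ?lexx// subrr flow0 z1E// mkst2.
  by apply; rewrite -TE; lra.
- have [Q0|Q0] := leP Q 0; first by constructor 1.
  have [b0|b0] := leP 0 b; first by constructor 2.
  constructor 3; have Qk : 0 <= Q * k by rewrite mulr_ge0 ?ltW.
  have Qb : Q * k <= (Q - b) * k by rewrite ler_pM2r//; lra.
  have t1 : T6 p x0 P d Q e c <= T6 p x0 P d Q e c + Q * k <= T7 p x0 xf P d Q e c.
    by rewrite /T7; lra.
  have := dom (T6 p x0 P d Q e c + Q * k).
  rewrite (arc7 l_ge0)// flow_c2 /s6 flow_c1 flow_c2 (z2E hulo huhi c VW) mkst1 mkst2 => /(_ _)/wrap[|].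
    by rewrite -TE; lra.
  congr (_ <= EFin _)%E; rewrite /vsw /low; field; exact: K0.
- have := dom (T5 p x0 P d Q c) _; rewrite (arc6 l_ge0) ?lexx// subrr flow0 (z2E hulo huhi c VW) mkst2.
  by apply; rewrite -TE; lra.
Qed.

Lemma hi_dominates_c3 : (y T).c3 - x0.c3 <= hi_dsp p x0 xf P d Q e c.
Proof.
have TE := T7E p x0 xf P d Q e c.
have kz' := hi_arcs_kinematic hulo huhi l_ge0.
have T0 : 0 <= T by rewrite -dur_hi_arcs; exact: dur_ge0.
have := kinematic_cmp (k := 1) ky kz' (lexx 0) T0 (lexx _) _.
rewrite nxt1 cur1 -TE st_hi_T7// TE fin_hi_arcs// st_0// y0 mkstE.
move=> /(_ _)/wrap[|]; last by lra.
by move=> r /andP[r0 rT]; apply: hi_dominates; rewrite ltW.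
Qed.

End Dominate.
End Existence.

(** * Existence of a dominating law with the given duration *)

Section MatchVelocity.
Variables (R : realType) (p : bounds R) (x0 xf : state R).
Hypotheses (hulo : ulo p < 0) (huhi : 0 < uhi p).
Hypothesis hxlo : forall k : 'I_2, (xlo p k < 0)%E.
Hypothesis hxhi : forall k : 'I_2, (0 < xhi p k)%E.
Hypotheses (wx0 : within p x0) (wxf : within p xf).
Implicit Types (P d Q e c : R).

Local Notation K := (uhi p).
Local Notation k := ((uhi p)^-1).
Local Notation n := ((- ulo p)^-1).
Local Notation l1 := (xlo p 0).
Local Notation h1 := (xhi p 0).
Local Notation h2 := (xhi p 1).
Local Notation a := (x0.c1).
Local Notation v := (x0.c2).
Local Notation b := (- xf.c1).
Local Notation w := (xf.c2).

Let K0 : K != 0. Proof. exact: lt0r_neq0. Qed.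
Let m0 : - ulo p != 0. Proof. by rewrite lt0r_neq0// oppr_gt0. Qed.
Let u0 : ulo p != 0. Proof. by rewrite ltr0_neq0. Qed.
Let k_gt0 : 0 < k := kgt0 huhi.
Let n_gt0 : 0 < n := ngt0 hulo.
Let Kk : K * k = 1. Proof. exact: mulfV. Qed.
Let mn : - ulo p * n = 1. Proof. exact: mulfV. Qed.
Let h1_gt0 : (0 < h1)%E. Proof. exact: hxhi. Qed.
Let l1_gt0 : (0 < - l1)%E. Proof. by rewrite oppe_gt0. Qed.
Let ah : (a%:E <= h1)%E. Proof. by have /withinE[/andP[]] := wx0. Qed.
Let bh : (b%:E <= - l1)%E.
Proof. by rewrite EFinN leeN2; have /withinE[/andP[]] := wxf. Qed.

Section Exists.
Variables (T : R) (y : R -> state R).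
Hypotheses (ky : kinematic (- ulo p) K T y) (T_ge0 : 0 <= T) (y0 : y 0 = x0).
Hypotheses (yT1 : (y T).c1 = xf.c1) (yT2 : (y T).c2 = xf.c2).
Hypothesis wy : forall t : R, 0 <= t <= T -> within p (y t).

Local Notation PP := (pk k n h1 a).
Local Notation DD := (hd k n h1 a).
Local Notation VV := (vq k n h1 a v).
Local Notation QQ := (pk k n (- l1)%E b).
Local Notation EE := (hd k n (- l1)%E b).
Local Notation WW := (vq k n (- l1)%E b w).

Let aTb : n * a + n * b <= T.
Proof.
have /andP[s1 _] := proj1 ky 0 T (lexx 0) T_ge0 (lexx T).
rewrite yT1 y0 subr0 opprK in s1.
have h : a + b <= - ulo p * T by lra.
rewrite -mulrDr; apply: le_trans (ler_wpM2l (ltW n_gt0) h) _.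
by rewrite mulrA [n * _]mulrC mn mul1r.
Qed.

Let Tab : 0 <= T + k * (a + b).
Proof.
have /andP[_ s1] := proj1 ky 0 T (lexx 0) T_ge0 (lexx T).
rewrite yT1 y0 subr0 in s1.
have h : - (K * T) <= a + b by lra.
have := ler_wpM2l (ltW k_gt0) h.
by rewrite mulrN mulrA [k * K]mulrC Kk mul1r; lra.
Qed.

Let PQ_ge0 q : n * a <= q -> q <= T - n * b -> 0 <= PP q + QQ (T - q).
Proof.
move=> aq qb.
have kn0 : 0 < k + n by exact: addr_gt0.
have bT : n * b <= T - q by lra.
have Pa : a <= PP q by exact: pk_ge.
have Qb : b <= QQ (T - q) by exact: pk_ge.
have [[PE _]|[PE _]] := pk_dich a k_gt0 n_gt0 h1_gt0 q; last first.
  have : - b <= PP q.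
    by rewrite -lee_fin PE opprK; have /withinE[/andP[]] := wxf.
  lra.
have [[QE _]|[QE _]] := pk_dich b k_gt0 n_gt0 l1_gt0 (T - q); last first.
  have : - a <= QQ (T - q).
    by rewrite -lee_fin QE EFinN leeN2; have /withinE[/andP[]] := wx0.
  lra.
rewrite PE QE -mulrDl divr_ge0//; last exact: ltW.
have := Tab; lra.
Qed.

Let durs P d Q e c : a <= P -> b <= Q -> 0 <= d -> 0 <= e -> 0 <= c ->
  0 <= P + Q -> (c = 0 \/ 0 <= P /\ 0 <= Q) -> durs_ge0 (hi_arcs p x0 xf P d Q e c).
Proof.
move=> aP bQ d0 e0 c0 PQ cPQ; have k0' := ltW k_gt0; have n0' := ltW n_gt0.
have m35 : 0 <= mid3 p P Q c /\ 0 <= mid5 p Q c.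
  rewrite /mid3 /mid5; case: ifPn => cN; first by rewrite mulr_ge0.
  case: cPQ => [cE|[P0 Q0]]; first by rewrite cE eqxx in cN.
  by rewrite !mulr_ge0.
move=> q; rewrite !inE => /or4P[/eqP->|/eqP->|/eqP->|/or4P[|||]/eqP->] //=;
  by [case: m35 | rewrite mulr_ge0 ?subr_ge0].
Qed.

Let tcr_at c : tcr k n c c 0 = n * c. Proof. by rewrite /tcr; lra. Qed.

(** At the largest crossing time the second half is trivial: the law rises as long as possible and
    then falls until the end. Its [x_1] is above that of [y] throughout, so its final [x_2] is too,
    and by [fin_c1_c2] this is the sign of the velocity gap. *)
Let upper : WW (n * b) <= VV (T - n * b).
Proof.
have q_ge : n * a <= T - n * b by have := aTb; lra.
have Pa : a <= PP (T - n * b) by exact: pk_ge.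
have [Qb Eb] := pk_at k_gt0 n_gt0 bh.
have PQ : 0 <= PP (T - n * b) + b.
  have := PQ_ge0 q_ge (lexx _).
  by rewrite (_ : T - (T - n * b) = n * b) ?Qb//; lra.
rewrite /vq Qb Eb.
set P := PP _ in Pa PQ *; set d := DD _.
have l0 : durs_ge0 (hi_arcs p x0 xf P d b 0 0).
  by apply: durs => //; [exact: hd_ge0|left].
have tT : hi_tot p x0 xf P d b 0 0 = T.
  by rewrite /hi_tot /P /d tcr_pk tcr_at; lra.
have [f1 f2] := @fin_c1_c2 R p x0 xf hulo huhi P d b 0 0 (erefl 0).
have [[T10 T12 T23 T34] [T45 T56 T67]] := hi_arcs_times l0.
have TE := T7E p x0 xf P d b 0 0; rewrite tT in TE.
have T3E : T3 p x0 P d b 0 = T.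
  by rewrite -TE /T7 /T6 /T5 /T4 /mid5 eqxx subrr mul0r !addr0.
have kz' := hi_arcs_kinematic hulo huhi l0; rewrite tT in kz'.
have zT : st x0 (hi_arcs p x0 xf P d b 0 0) T = fin x0 (hi_arcs p x0 xf P d b 0 0).
  by rewrite -TE st_hi_T7.
have := kinematic_cmp (k := 0) ky kz' (lexx 0) T_ge0 (lexx _) _.
rewrite nxt0 cur0 st_0// y0 yT2 zT f2 => /(_ _)/wrap[|]; last by lra.
move=> r /andP[r0 rT].
have [r2|r2] := leP r (T2 p x0 P d).
  apply: cmp_left => //; rewrite ?tT//; first exact: hd_pk.
  by rewrite r2 ltW.
have := @cmp_mid3 R p x0 xf y P d b 0 0 l0; rewrite tT => /(_ ky r T (ltW r2) rT).
rewrite T3E => /(_ (lexx _)); rewrite zT f1 yT1; lra.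
Qed.

(** The opposite extreme: the law falls at once and rises as late as possible, so its [x_1] is below
    that of [y]. *)
Let lower : VV (n * a) <= WW (T - n * a).
Proof.
have q_le : n * a <= T - n * b by have := aTb; lra.
have bT : n * b <= T - n * a by lra.
have Qb : b <= QQ (T - n * a) by exact: pk_ge.
have [Pa Da] := pk_at k_gt0 n_gt0 ah.
have PQ : 0 <= a + QQ (T - n * a) by have := PQ_ge0 (lexx _) q_le; rewrite Pa.
rewrite /vq Pa Da.
set Q := QQ _ in Qb PQ *; set e := EE _.
have l0 : durs_ge0 (hi_arcs p x0 xf a 0 Q e 0).
  by apply: durs => //; [exact: hd_ge0|left].
have tT : hi_tot p x0 xf a 0 Q e 0 = T.
  by rewrite /hi_tot /Q /e tcr_pk tcr_at; lra.
have [f1 f2] := @fin_c1_c2 R p x0 xf hulo huhi a 0 Q e 0 (erefl 0).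
have [[T10 T12 T23 T34] [T45 T56 T67]] := hi_arcs_times l0.
have TE := T7E p x0 xf a 0 Q e 0; rewrite tT in TE.
have T2E : T2 p x0 a 0 = 0 by rewrite /T2 /T1 subrr mul0r add0r.
have T5E : T5 p x0 a 0 Q 0 = T3 p x0 a 0 Q 0 by rewrite /T5 /T4 /mid5 eqxx !addr0.
have kz' := hi_arcs_kinematic hulo huhi l0; rewrite tT in kz'.
have zT : st x0 (hi_arcs p x0 xf a 0 Q e 0) T = fin x0 (hi_arcs p x0 xf a 0 Q e 0).
  by rewrite -TE st_hi_T7.
have := kinematic_cmp (k := 0) kz' ky (lexx 0) T_ge0 (lexx _) _.
rewrite nxt0 cur0 st_0// y0 yT2 zT f2 => /(_ _)/wrap[|]; last by lra.
move=> r /andP[r0 rT].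
have [r3|r3] := leP (T3 p x0 a 0 Q 0) r.
  apply: cmp_right => //; rewrite ?tT//; first exact: hd_pk.
  by rewrite T5E r3.
have := @cmp_mid3 R p x0 xf y a 0 Q e 0 l0; rewrite tT => /(_ ky 0 r).
by rewrite T2E st_0// y0 => /(_ (lexx _) (ltW r0) (ltW r3)); lra.
Qed.

Lemma match_velocity : exists q, [/\ n * a <= q, n * b <= T - q & VV q = WW (T - q)].
Proof.
have q_le : n * a <= T - n * b by have := aTb; lra.
have fc : continuous (fun q => VV q - WW (T - q)).
  move=> q; apply: cvgB; first exact: vq_cts.
  apply: (@continuous_comp _ _ _ (fun q => T - q) WW); last exact: vq_cts.
  by apply: cvgB; [exact: cvg_cst|exact: cvg_id].
have [||q /andP[q1 q2] qE] := IVT_eq (z := 0) q_le fc.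
- by have := lower; lra.
- by have := upper; rewrite (_ : T - (T - n * b) = n * b); lra.
by exists q; split => //; lra.
Qed.

(** Even full deceleration from [a >= 0] brings [x_2] to [v + n a^2 / 2] at time [n a]; there [y] is
    at least as high, and it respects the bound [H]. *)
Let crossL : 0 <= a -> n * a <= T -> forall H : R, h2 = H%:E -> v + n * a ^+ 2 / 2 <= H.
Proof.
move=> a0 aT H hH.
have na0 : 0 <= n * a by rewrite mulr_ge0// ltW.
have l0 : durs_ge0 [:: (ulo p, T)] by move=> q; rewrite inE => /eqP->.
have kz' : kinematic (- ulo p) K T (st x0 [:: (ulo p, T)]).
  have -> : T = dur [:: (ulo p, T)] by rewrite /= add0r.
  rewrite {2}/dur add0r; apply: st_kinematic => //.
  by move=> q; rewrite inE => /eqP-> /=; rewrite lexx ltW// (lt_trans hulo).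
have zE t : 0 <= t -> st x0 [:: (ulo p, T)] t = flow x0 (ulo p) t.
  by move=> t0; rewrite /= subr0; case: ifPn => // t0'; rewrite (_ : t = 0) ?flow0//; lra.
have := kinematic_cmp (k := 0) kz' ky (lexx 0) na0 aT _.
rewrite nxt0 cur0 st_0// y0 zE// flow_c2 => /(_ _)/wrap[|].
  move=> r /andP[r0 rn]; rewrite zE ?(ltW r0)// flow_c1.
  have /andP[] := proj1 ky 0 r (lexx 0) (ltW r0) (le_trans rn aT).
  rewrite y0; lra.
have : ((y (n * a)).c2 <= H).
  rewrite -lee_fin -hH; have /wy/withinE[_ /andP[]//] : 0 <= n * a <= T by rewrite na0.
move=> h3 h4; apply: le_trans h3; move: h4.
have -> : ulo p * (n * a) ^+ 2 / 2 = - (n * a ^+ 2 / 2) by field; rewrite ?u0 ?m0.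
rewrite [a * (n * a)](_ : _ = n * a ^+ 2); last by ring.
lra.
Qed.

Let crossR : 0 <= b -> n * b <= T -> forall H : R, h2 = H%:E -> w + n * b ^+ 2 / 2 <= H.
Proof.
move=> b0 bT H hH.
have nb0 : 0 <= n * b by rewrite mulr_ge0// ltW.
(* The comparison arc decelerates throughout and ends with the final [x_1]. Its other coordinates
   are arbitrary, since only increments of [x_2] are compared. *)
pose s0 := mkst (xf.c1 - ulo p * T) 0 0.
have l0 : durs_ge0 [:: (ulo p, T)] by move=> q; rewrite inE => /eqP->.
have kz' : kinematic (- ulo p) K T (st s0 [:: (ulo p, T)]).
  have -> : T = dur [:: (ulo p, T)] by rewrite /= add0r.
  rewrite {2}/dur add0r; apply: st_kinematic => //.
  by move=> q; rewrite inE => /eqP-> /=; rewrite lexx ltW// (lt_trans hulo).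
have zE t : 0 <= t -> st s0 [:: (ulo p, T)] t = flow s0 (ulo p) t.
  by move=> t0; rewrite /= subr0; case: ifPn => // t0'; rewrite (_ : t = 0) ?flow0//; lra.
have t0 : 0 <= T - n * b by lra.
have := kinematic_cmp (k := 0) ky kz' t0 (_ : _ <= T) (lexx _) _.
rewrite nxt0 cur0 yT2 !zE// !flow_c2 mkst1 mkst2 => /(_ _ _)/wrap[||].
- lra.
- move=> r /andP[r0 rT]; rewrite zE; last by lra.
  have r0' : 0 <= r by lra.
  have /andP[] := proj1 ky r T r0' rT (lexx _).
  rewrite flow_c1 mkst1 yT1; lra.
have : ((y (T - n * b)).c2 <= H).
  rewrite -lee_fin -hH; have /wy/withinE[_ /andP[]//] : 0 <= T - n * b <= T by lra.
move=> h3 h4; apply: le_trans h3; move: h4.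
have -> : 0 + (xf.c1 - ulo p * T) * T + ulo p * T ^+ 2 / 2 -
  (0 + (xf.c1 - ulo p * T) * (T - n * b) + ulo p * (T - n * b) ^+ 2 / 2) =
  - (n * b ^+ 2 / 2) by field; rewrite ?u0 ?m0.
lra.
Qed.

Lemma hi_exists : exists P d Q e c, [/\ hi_ok p x0 xf P d Q e c,
  hi_tot p x0 xf P d Q e c = T & (y T).c3 - x0.c3 <= hi_dsp p x0 xf P d Q e c].
Proof.
have [q [aq bq Vq]] := match_velocity.
have build P d Q e c : a <= P -> (P%:E <= h1)%E -> 0 <= d -> d = 0 \/ P%:E = h1 ->
    b <= Q -> (Q%:E <= - l1)%E -> 0 <= e -> e = 0 \/ Q%:E = (- l1)%E ->
    0 <= P + Q -> vel k n a v P d = vel k n b w Q e -> 0 <= c ->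
    c = 0 \/ [/\ 0 <= P, 0 <= Q & (vel k n a v P d)%:E = h2] ->
    [\/ P <= 0, Q <= 0 | ((vel k n a v P d)%:E <= h2)%E] ->
    hi_tot p x0 xf P d Q e c = T ->
    exists P d Q e c, [/\ hi_ok p x0 xf P d Q e c,
      hi_tot p x0 xf P d Q e c = T & (y T).c3 - x0.c3 <= hi_dsp p x0 xf P d Q e c].
  move=> aP Ph d0 dh bQ Qh e0 eh PQ VW c0 ch cr tT.
  have l0 : durs_ge0 (hi_arcs p x0 xf P d Q e c).
    by apply: durs => //; case: ch => [|[]]; [left|right].
  exists P, d, Q, e, c; split => //.
    have [] := @dominated_halves R p x0 xf hulo huhi y P d Q e c l0 _ y0 _ _ _
      dh eh VW ch aP Ph d0 bQ Qh e0; rewrite ?tT//.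
  by rewrite -{1}tT; apply: hi_dominates_c3 => //; rewrite ?tT.
set P := PP q; set d := DD q; set Q := QQ (T - q); set e := EE (T - q).
have aP : a <= P by exact: pk_ge.
have bQ : b <= Q by exact: pk_ge.
have PQ : 0 <= P + Q by apply: PQ_ge0 => //; lra.
have tPd : tcr k n a P d = q by exact: tcr_pk.
have tQe : tcr k n b Q e = T - q by exact: tcr_pk.
(* The matched law without cruise is admissible unless [P] and [Q] are positive and the crossing
   velocity exceeds [h2]. In that case both halves are cut down to the velocity [h2], and the time
   they give up is spent on the cruise. *)
have : [\/ P <= 0, Q <= 0 | ((vel k n a v P d)%:E <= h2)%E] \/
    [/\ 0 < P, 0 < Q & (h2 < (vel k n a v P d)%:E)%E].
  have [P0|P0] := leP P 0; first by left; constructor 1.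
  have [Q0|Q0] := leP Q 0; first by left; constructor 2.
  have [V0|V0] := leP (vel k n a v P d)%:E h2; first by left; constructor 3.
  by right.
case=> [cr|[P0 Q0 Vh]].
  apply: (build P d Q e 0) => //.
  - exact: pk_le.
  - exact: hd_ge0.
  - exact: hd_pk.
  - exact: pk_le.
  - exact: hd_ge0.
  - exact: hd_pk.
  - by left.
  - by rewrite /hi_tot tPd tQe; lra.
have h2_gt0 : (0 < h2)%E by exact: hxhi.
have [H hH] : exists H : R, h2 = H%:E.
  by move: h2_gt0 Vh; case: h2 => [H| |]//; exists H.
have vH : v <= H by rewrite -lee_fin -hH; have /withinE[_ /andP[]] := wx0.
have wH : w <= H by rewrite -lee_fin -hH; have /withinE[_ /andP[]] := wxf.
have VH : H <= VV q by rewrite -lee_fin -hH ltW.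
have WH : H <= WW (T - q) by rewrite -Vq.
have pos (x X dd : R) : x <= X -> 0 < X -> 0 <= dd -> 0 <= tcr k n x X dd.
  move=> xX X0 d0; rewrite /tcr.
  have := mulr_ge0 (ltW k_gt0) (_ : 0 <= X - x); rewrite subr_ge0 => /(_ xX).
  have := mulr_gt0 n_gt0 X0; lra.
have qT0 : 0 <= q by rewrite -tPd; apply: pos => //; exact: hd_ge0.
have rT0 : 0 <= T - q by rewrite -tQe; apply: pos => //; exact: hd_ge0.
have aT : n * a <= T by lra.
have bT : n * b <= T by lra.
have [q1 [q1a q1q P1 V1]] := vq_cross k_gt0 n_gt0 h1_gt0 ah aq P0 VH vH
  (fun a0 => crossL a0 aT hH).
have [r1 [r1b r1r Q1 W1]] := vq_cross k_gt0 n_gt0 l1_gt0 bh bq Q0 WH wH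
  (fun b0 => crossR b0 bT hH).
apply: (build (PP q1) (DD q1) (QQ r1) (EE r1) (T - q1 - r1)) => //.
- exact: pk_ge.
- exact: pk_le.
- exact: hd_ge0.
- exact: hd_pk.
- exact: pk_ge.
- exact: pk_le.
- exact: hd_ge0.
- exact: hd_pk.
- exact: addr_ge0.
- by move: V1 W1; rewrite /vq => -> ->.
- lra.
- by right; split => //; rewrite hH -V1.
- by constructor 3; rewrite hH -V1.
- by rewrite /hi_tot !tcr_pk; lra.
Qed.

End Exists.
End MatchVelocity.

(** * Perturbation of the parameters *)

Section Taylor.
Variable R : realType.
Variables (k n : R) (h l : \bar R) (a v : R).
Hypotheses (k0 : 0 < k) (n0 : 0 < n) (h0 : (0 < h)%E) (ah : (a%:E <= h)%E).
Local Notation V P d := (vel k n a v P d).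
Local Notation X P d := (dsp k n a v P d).
Implicit Types (P d : R).

Definition peak_ok P d := [/\ (P%:E <= h)%E, 0 <= d & d = 0 \/ P%:E = h].

Lemma pk_ok q : peak_ok (pk k n h a q) (hd k n h a q).
Proof. by split; [exact: pk_le|exact: hd_ge0|exact: hd_pk]. Qed.

Section Two.
Variables (P d P' d' : R).
Hypotheses (ok : peak_ok P d) (ok' : peak_ok P' d').
Local Notation x := (P' - P).
Local Notation e := (d' - d).
Local Notation delta := (tcr k n a P' d' - tcr k n a P d).

(** The peak and the hold never vary in opposite directions, the hold being empty whenever the peak
    is below its bound. In [delta = (k + n) * x + e] the terms therefore cannot cancel, and the
    change of crossing time controls both. *)
Lemma peak_diff : 0 <= x * e /\ 0 <= x * d' /\ x * d <= 0 /\ 0 <= x * delta /\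
  (k + n) * `|x| <= `|delta| /\ `|e| <= `|delta| /\ `|x * d| <= `|x| * `|delta|.
Proof.
have [Ph d0 dh] := ok; have [Ph' d0' dh'] := ok'.
have c0 : 0 < k + n by exact: addr_gt0.
have dE : delta = (k + n) * x + e by rewrite /tcr; lra.
have [xs|xs|xs] := ltgtP P P'.
- have dE0 : d = 0.
    case: dh => // Pe; have : (h < h)%E; last by rewrite ltxx.
    by rewrite -{1}Pe (lt_le_trans _ Ph')// lte_fin.
  have x0 : 0 <= x by lra.
  have xe : 0 <= x * e by rewrite mulr_ge0// dE0 subr0.
  have cx : 0 <= (k + n) * x by rewrite mulr_ge0// ltW.
  have e0 : 0 <= e by rewrite dE0 subr0.
  have nx : `|x| = x by rewrite ger0_norm.
  have ne : `|e| = e by rewrite ger0_norm.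
  have de0 : 0 <= (k + n) * x + e by exact: addr_ge0.
  have nd : `|delta| = (k + n) * x + e by rewrite dE ger0_norm.
  have xd : x * d = 0 by rewrite dE0 mulr0.
  have xd' : 0 <= x * d' by exact: mulr_ge0.
  have xdel : 0 <= x * ((k + n) * x + e) by exact: mulr_ge0.
  rewrite nd nx ne dE xd normr0.
  by do !split => //; lra.
- have dE0 : d' = 0.
    case: dh' => // Pe; have : (h < h)%E; last by rewrite ltxx.
    by rewrite -{1}Pe (lt_le_trans _ Ph)// lte_fin.
  have x0 : 0 <= - x by lra.
  have cx : 0 <= (k + n) * - x by rewrite mulr_ge0// ltW.
  have e0 : 0 <= - e by rewrite dE0; lra.
  have xd : 0 <= - x * d by rewrite mulr_ge0.
  have xx : 0 <= x ^+ 2 * (k + n) by rewrite mulr_ge0 ?sqr_ge0// ltW.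
  have -> : `|x| = - x by rewrite ler0_norm; lra.
  have -> : `|e| = - e by rewrite ler0_norm; lra.
  have -> : `|x * d| = - x * d by rewrite ler0_norm; lra.
  have -> : `|delta| = (k + n) * - x + - e by rewrite ler0_norm dE; lra.
  rewrite dE dE0 mulr0; do !split; lra.
- have x0 : x = 0 by rewrite xs subrr.
  rewrite dE x0 !mul0r !mulr0 normr0 !mulr0 add0r mul0r; do !split; rewrite ?lexx ?normr_ge0//.
Qed.

Lemma vel_diff : V P' d' - V P d = P * delta + (k + n) * x ^+ 2 / 2 + x * d'.
Proof. by rewrite /vel /tcr; field. Qed.

Lemma vel_convex : V P d + P * delta <= V P' d'.
Proof.
have [_ [xd _]] := peak_diff; have := vel_diff.
have : 0 <= (k + n) * x ^+ 2 by rewrite mulr_ge0 ?sqr_ge0// ltW// addr_gt0.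
lra.
Qed.

Local Notation be := ((k + 2 * n) / 2).
Local Notation al := ((k + n) * (k + 2 * n) / 6).

Lemma dsp_diff : X P' d' - X P d = (V P d + n * P ^+ 2 / 2) * delta
  + (n * P + d / 2) * (x * d) + (3 * al * P + be * d) * x ^+ 2
  + (2 * be * P + d) * (x * e) + P / 2 * e ^+ 2 + al * x ^+ 3 + be * (x ^+ 2 * e)
  + 2^-1 * (x * e ^+ 2).
Proof. by rewrite /dsp /dsp0 /tail /vel /low /tcr; field. Qed.

End Two.

(** Expresses [dV/dq = P] and [dX/dq = V + n P^2 / 2] with a quadratic remainder. The peak has a
    kink where it meets its bound, so the expansions come from the exact identities [vel_diff] and
    [dsp_diff], whose remaining terms are of second order by [peak_diff]. *)
Lemma taylor P d : peak_ok P d -> exists2 B, 0 <= B &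
  forall P' d', peak_ok P' d' ->
  let delta := tcr k n a P' d' - tcr k n a P d in
  `|delta| <= 1 ->
  `|V P' d' - V P d - P * delta| <= B * delta ^+ 2 /\
  `|X P' d' - X P d - (V P d + n * P ^+ 2 / 2) * delta| <= B * delta ^+ 2.
Proof.
move=> ok.
pose c := k + n; pose be := (k + 2 * n) / 2; pose al := (k + n) * (k + 2 * n) / 6.
have c0 : 0 < c by exact: addr_gt0.
have ci0 : 0 <= c^-1 by rewrite invr_ge0 ltW.
(* [B] sums the absolute values of the coefficients of both identities, each with the power of
   [c^-1] that bounds its monomial; cubic terms are absorbed through [|delta| <= 1]. *)
pose B := `|n * P + d / 2| * c^-1 + `|3 * al * P + be * d| * c^-1 ^+ 2
  + `|2 * be * P + d| * c^-1 + `|P / 2| + `|al| * c^-1 ^+ 3 + `|be| * c^-1 ^+ 2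
  + 2^-1 * c^-1 + (`|c / 2| * c^-1 ^+ 2 + 2 * c^-1).
have B0 : 0 <= B by rewrite !addr_ge0// ?mulr_ge0// ?exprn_ge0// ?invr_ge0.
exists B => // P' d' ok' delta d1.
have [xe [xd' [xd [xdel [cx [ee xdd]]]]]] := peak_diff ok ok'.
rewrite -/delta -/c in xdel cx ee xdd.
set x := P' - P in xe xd' xd xdel cx xdd; set e := d' - d in xe ee.
set D := `|delta| in d1 cx ee xdd.
have D0 : 0 <= D by exact: normr_ge0.
have DE : delta ^+ 2 = D ^+ 2 by rewrite /D real_normK// num_real.
have xD : `|x| <= c^-1 * D by rewrite -(ler_pM2l c0) mulrA mulfV ?gt_eqF// mul1r.
have D2 : 0 <= D ^+ 2 by rewrite exprn_ge0.
have D32 : D ^+ 3 <= D ^+ 2.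
  by rewrite exprS -[leRHS]mul1r ler_wpM2r.
have b1 : `|x * d| <= c^-1 * D ^+ 2.
  by rewrite (le_trans xdd)// expr2 mulrA ler_wpM2r.
have b2 : `|x ^+ 2| <= c^-1 ^+ 2 * D ^+ 2.
  by rewrite normrX -exprMn lerXn2r// ?nnegrE// mulr_ge0.
have b3 : `|x * e| <= c^-1 * D ^+ 2.
  by rewrite normrM expr2 mulrA ler_pM.
have b4 : `|e ^+ 2| <= D ^+ 2 by rewrite normrX lerXn2r// ?nnegrE.
have b5 : `|x ^+ 3| <= c^-1 ^+ 3 * D ^+ 2.
  rewrite normrX (le_trans (_ : _ <= (c^-1 * D) ^+ 3))//.
    by rewrite lerXn2r// ?nnegrE// mulr_ge0.
  by rewrite exprMn ler_wpM2l// exprn_ge0.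
have b6 : `|x ^+ 2 * e| <= c^-1 ^+ 2 * D ^+ 2.
  rewrite normrM (le_trans (ler_pM _ _ b2 ee))// -mulrA ler_wpM2l ?exprn_ge0//.
  by rewrite -exprSr.
have b7 : `|x * e ^+ 2| <= c^-1 * D ^+ 2.
  rewrite normrM (le_trans (ler_pM _ _ xD b4))// -mulrA ler_wpM2l//.
have b8 : `|x * d'| <= 2 * c^-1 * D ^+ 2.
  have -> : x * d' = x * d + x * e by rewrite /e; ring.
  by rewrite (le_trans (ler_normD _ _))//; lra.
have mb (u z g : R) : `|z| <= g * D ^+ 2 -> `|u * z| <= `|u| * g * D ^+ 2.
  by move=> h1; rewrite normrM -mulrA ler_wpM2l.
rewrite DE; split.
- rewrite vel_diff -/delta -/x -/c.
  have -> : P * delta + c * x ^+ 2 / 2 + x * d' - P * delta = c / 2 * x ^+ 2 + x * d'.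
    by ring.
  rewrite (le_trans (ler_normD _ _))//.
  have := mb (c / 2) _ _ b2.
  rewrite /B.
  set B1 := `|n * P + d / 2| * _; set B2 := `|3 * al * P + be * d| * _.
  set B3 := `|2 * be * P + d| * _; set B5 := `|al| * _; set B6 := `|be| * _.
  have : 0 <= (B1 + B2 + B3 + `|P / 2| + B5 + B6 + 2^-1 * c^-1) * D ^+ 2.
    by rewrite mulr_ge0// !addr_ge0// ?mulr_ge0// ?exprn_ge0// ?invr_ge0.
  rewrite [leRHS in _ -> _ -> _ <= leRHS]mulrDl; lra.
- rewrite dsp_diff// -/delta -/x -/e -/be -/al.
  set G := (V P d + _) * delta.
  have tri (z1 z2 g1 g2 : R) : `|z1| <= g1 * D ^+ 2 -> `|z2| <= g2 * D ^+ 2 ->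
      `|z1 + z2| <= (g1 + g2) * D ^+ 2.
    by move=> h1 h2; rewrite (le_trans (ler_normD _ _))// mulrDl lerD.
  have := mb (n * P + d / 2) _ _ b1; have := mb (3 * al * P + be * d) _ _ b2.
  have := mb (2 * be * P + d) _ _ b3.
  have := mb (P / 2) _ 1 (_ : `|e ^+ 2| <= 1 * D ^+ 2); rewrite mul1r mulr1 => /(_ b4).
  have := mb al _ _ b5; have := mb be _ _ b6; have := mb 2^-1 _ _ b7.
  rewrite [`|2^-1|]ger0_norm ?invr_ge0// => m7 m6 m5 m4 m3 m2 m1.
  have := tri _ _ _ _ (tri _ _ _ _ (tri _ _ _ _ (tri _ _ _ _ (tri _ _ _ _
    (tri _ _ _ _ m1 m2) m3) m4) m5) m6) m7.
  set S := (X in `|X|) => hS.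
  have -> : forall z, z = G + S -> z - G = S by move=> z ->; ring.
    rewrite (le_trans hS)// ler_wpM2r// /B lerDl.
    by rewrite addr_ge0// ?mulr_ge0// ?exprn_ge0.
  by rewrite /S; ring.
Qed.

End Taylor.

(** * Shortening a law without cruise *)

Section Perturbation.
Variable R : realType.
Variables (k n : R) (l2 h2 : \bar R).
Hypotheses (k0 : 0 < k) (n0 : 0 < n).
Implicit Types (h g : \bar R) (a v b w P d Q e : R).

Definition pair_ok h a v g b w P d Q e : Prop :=
  [/\ half k h l2 a v P d /\ half k g l2 b w Q e, 0 <= P + Q,
      vel k n a v P d = vel k n b w Q e &
      [\/ P <= 0, Q <= 0 | ((vel k n a v P d)%:E <= h2)%E]].

Lemma pair_okC h a v g b w P d Q e :
  pair_ok h a v g b w P d Q e -> pair_ok g b w h a v Q e P d.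
Proof.
move=> [[hP hQ] PQ VW cr]; split => //; first by rewrite addrC.
by rewrite -VW; case: cr; [constructor 2|constructor 1|constructor 3].
Qed.

(** Shortening by [eps] with matched velocities asks, to first order, for [dq = - eps Q / (P + Q)]
    and [dr = - eps P / (P + Q)]. This takes [P + Q > 0], room below [q] if [Q >= 0] and room below
    [r] if [P >= 0]. The least value of [q] is attained exactly for [P = a], [d = 0], that of [r]
    for [Q = b], [e = 0]. *)
Definition nonrigid a b P d Q e : Prop :=
  [/\ 0 < P + Q, ~ [/\ Q = b, e = 0 & 0 <= P] & ~ [/\ P = a, d = 0 & 0 <= Q]].

Lemma half_peak h a v P d : half k h l2 a v P d -> peak_ok h P d.
Proof. by case=> _ [Ph d0] dh _ _. Qed.

Lemma peak_unique h a P d P' d' : peak_ok h P d -> peak_ok h P' d' ->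
  tcr k n a P d = tcr k n a P' d' -> P = P' /\ d = d'.
Proof.
move=> ok ok' tt.
have [_ [_ [_ [_ [cx [ee _]]]]]] := peak_diff a k0 n0 ok ok'.
rewrite tt subrr normr0 in cx ee.
have e0 : d' - d = 0 by apply: normr0_eq0; apply/eqP; rewrite eq_le ee normr_ge0.
have x0 : `|P' - P| <= 0.
  by rewrite -(pmulr_rle0 _ (addr_gt0 k0 n0)).
have {}x0 : P' - P = 0 by apply: normr0_eq0; apply/eqP; rewrite eq_le x0 normr_ge0.
by split; lra.
Qed.

Lemma pair_hyp_half h a v P d : (0 < h)%E -> (l2 <= v%:E)%E ->
  a <= P -> peak_ok h P d -> 0 <= P ->
  0 <= a \/ (l2 <= (low k a v)%:E)%E -> half k h l2 a v P d.
Proof.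
move=> h0 lv aP [Ph d0 dh] P0 al; split => //.
  by case: al; [constructor 2|constructor 3].
have Pd : 0 <= P * d by rewrite mulr_ge0.
have kP : 0 <= k * P ^+ 2 by rewrite mulr_ge0 ?sqr_ge0// ltW.
case: al => [a0|al].
  apply: le_trans lv _; rewrite lee_fin /vsw /low.
  have : 0 <= k * ((P - a) * (P + a)).
    by apply: mulr_ge0; [exact: ltW|apply: mulr_ge0; lra].
  lra.
by apply: le_trans al _; rewrite lee_fin /vsw; lra.
Qed.

Section Direction.
Variables (h g : \bar R) (a v b w P d Q e : R).
Hypotheses (h0 : (0 < h)%E) (g0 : (0 < g)%E).
Hypotheses (ah : (a%:E <= h)%E) (bg : (b%:E <= g)%E).
Hypotheses (lv : (l2 <= v%:E)%E) (lw : (l2 <= w%:E)%E).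
Local Notation q := (tcr k n a P d).
Local Notation r := (tcr k n b Q e).
Local Notation VV := (vq k n h a v).
Local Notation WW := (vq k n g b w).
Local Notation PP := (pk k n h a).
Local Notation QQ := (pk k n g b).

(** The bound [N * eps] on both changes is what makes the remainders of [taylor] quadratic in
    [eps]. *)
Definition perturbable : Prop :=
  exists2 N, 1 <= N & exists2 e0, 0 < e0 & forall eps, 0 < eps -> eps <= e0 ->
  exists q' r', [/\ pair_ok h a v g b w (PP q') (hd k n h a q') (QQ r') (hd k n g b r'),
    q' + r' = q + r - eps, `|q' - q| <= N * eps & `|r' - r| <= N * eps].

Hypothesis ok : pair_ok h a v g b w P d Q e.
Hypothesis nr : nonrigid a b P d Q e.

Let c0 : 0 < k + n. Proof. exact: addr_gt0. Qed.

Let PPq : PP q = P /\ hd k n h a q = d.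
Proof.
have [[hP _] _ _ _] := ok.
apply: (peak_unique (a := a) (pk_ok a k0 n0 h0 q) (half_peak hP)).
by rewrite tcr_pk.
Qed.

Let QQr : QQ r = Q /\ hd k n g b r = e.
Proof.
have [[_ hQ] _ _ _] := ok.
apply: (peak_unique (a := b) (pk_ok b k0 n0 g0 r) (half_peak hQ)).
by rewrite tcr_pk.
Qed.

Let VE : VV q = vel k n a v P d. Proof. by rewrite /vq PPq.1 PPq.2. Qed.
Let WE : WW r = vel k n b w Q e. Proof. by rewrite /vq QQr.1 QQr.2. Qed.

Let convL s t : VV s + PP s * (t - s) <= VV t.
Proof.
have := vel_convex a v k0 n0 (pk_ok a k0 n0 h0 s) (pk_ok a k0 n0 h0 t).
by rewrite !tcr_pk.
Qed.

Let convR s t : WW s + QQ s * (t - s) <= WW t.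
Proof.
have := vel_convex b w k0 n0 (pk_ok b k0 n0 g0 s) (pk_ok b k0 n0 g0 t).
by rewrite !tcr_pk.
Qed.

Let lowL : 0 < P -> 0 <= a \/ (l2 <= (low k a v)%:E)%E.
Proof.
have [[[_ _ _ lc _] _] _ _ _] := ok.
by case: lc => [?|?|?] ?; [exfalso; lra|left|right].
Qed.

Let lowR : 0 < Q -> 0 <= b \/ (l2 <= (low k b w)%:E)%E.
Proof.
have [[_ [_ _ _ lc _]] _ _ _] := ok.
by case: lc => [?|?|?] ?; [exfalso; lra|left|right].
Qed.

Let qgap : q - n * a = (k + n) * (P - a) + d. Proof. by rewrite /tcr; ring. Qed.
Let rgap : r - n * b = (k + n) * (Q - b) + e. Proof. by rewrite /tcr; ring. Qed.

Let qgap_gt0 : 0 <= Q -> 0 < q - n * a.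
Proof.
move=> Q0; have [[[aP [_ d0] _ _ _] _] _ _ _] := ok; have [_ _ n3] := nr.
rewrite qgap lt_neqAle addr_ge0// ?mulr_ge0 ?subr_ge0 ?(ltW c0)// andbT.
apply/negP => /eqP/esym/eqP; rewrite paddr_eq0 ?mulr_ge0 ?subr_ge0 ?(ltW c0)//.
rewrite mulf_eq0 (gt_eqF c0)/= subr_eq0 => /andP[/eqP PE /eqP dE].
exact: n3.
Qed.

Let rgap_gt0 : 0 <= P -> 0 < r - n * b.
Proof.
move=> P0; have [[_ [bQ [_ e_0] _ _ _]] _ _ _] := ok; have [_ n2 _] := nr.
rewrite rgap lt_neqAle addr_ge0// ?mulr_ge0 ?subr_ge0 ?(ltW c0)// andbT.
apply/negP => /eqP/esym/eqP; rewrite paddr_eq0 ?mulr_ge0 ?subr_ge0 ?(ltW c0)//.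
rewrite mulf_eq0 (gt_eqF c0)/= subr_eq0 => /andP[/eqP QE /eqP eE].
exact: n2.
Qed.

Let fc C : continuous (fun s => VV s - WW (C - s)).
Proof.
move=> s; apply: cvgB; first exact: vq_cts.
apply: (@continuous_comp _ _ _ (fun s => C - s) WW); last exact: vq_cts.
by apply: cvgB; [exact: cvg_cst|exact: cvg_id].
Qed.

(** Both halves are shortened. Taking the whole [eps] from one of them lowers the velocity of that
    half alone, which gives the two signs for the intermediate value theorem. The common velocity
    falls, so the bound [h2] is kept. *)
Lemma perturb_pos : 0 < P -> 0 < Q -> perturbable.
Proof.
move=> P0 Q0; have c0' := c0.
have qg := qgap_gt0 (ltW Q0); have rg := rgap_gt0 (ltW P0).
have [_ _ VW cr] := ok.
have Vh : ((vel k n a v P d)%:E <= h2)%E by case: cr => // ?; exfalso; lra.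
exists 1 => //.
(* The first two thresholds keep both peaks nonnegative, the other two keep the crossing times above
   their least values. *)
pose e0 := Num.min (Num.min ((k + n) * P) ((k + n) * Q)) (Num.min (q - n * a) (r - n * b)).
exists e0; first by rewrite !lt_min !mulr_gt0// qg rg.
move=> eps eps0; rewrite !le_min => /andP[/andP[eP eQ] /andP[eq er]].
have small X : eps <= (k + n) * X -> forall Y, (k + n) * (X - Y) <= eps -> 0 <= Y.
  move=> h1 Y h2'; have : 0 <= (k + n) * Y by lra.
  by rewrite pmulr_rge0.
have [s /andP[s1 s2] sE] : exists2 s, q - eps <= s <= q & VV s - WW (q + r - eps - s) = 0.
  apply: IVT_eq; first lra.
  - exact: fc.
  - have -> : q + r - eps - (q - eps) = r by ring.
    have := convL (q - eps) q; rewrite VE WE VW.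
    have le_q : q - eps <= q by lra.
    have [m1 m2] := pk_mono a k0 n0 h0 le_q.
    rewrite PPq.1 in m1 m2.
    have : 0 <= PP (q - eps) by apply: small eP _ _; lra.
    move=> pp; have := mulr_ge0 pp (ltW eps0); lra.
  - have -> : q + r - eps - q = r - eps by ring.
    have := convR (r - eps) r; rewrite VE WE VW.
    have le_r : r - eps <= r by lra.
    have [m1 m2] := pk_mono b k0 n0 g0 le_r.
    rewrite QQr.1 in m1 m2.
    have : 0 <= QQ (r - eps) by apply: small eQ _ _; lra.
    move=> pp; have := mulr_ge0 pp (ltW eps0); lra.
exists s, (q + r - eps - s).
have [mp1 mp2] := pk_mono a k0 n0 h0 s2; rewrite PPq.1 in mp1 mp2.
have rr : q + r - eps - s <= r by lra.
have [mq1 mq2] := pk_mono b k0 n0 g0 rr; rewrite QQr.1 in mq1 mq2.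
have P'0 : 0 <= PP s by apply: small eP _ _; lra.
have Q'0 : 0 <= QQ (q + r - eps - s) by apply: small eQ _ _; lra.
split.
- split.
  + split; apply: pair_hyp_half => //.
    * by apply: pk_ge => //; lra.
    * exact: pk_ok.
    * exact: lowL.
    * by apply: pk_ge => //; lra.
    * exact: pk_ok.
    * exact: lowR.
  + exact: addr_ge0.
  + by move: sE; rewrite /vq; lra.
  + constructor 3; apply: le_trans Vh; rewrite lee_fin -VE.
    have := convL s q; have := mulr_ge0 P'0 (_ : 0 <= q - s); rewrite subr_ge0 => /(_ s2).
    rewrite /vq; lra.
- ring.
- by rewrite ler_norml; lra.
- by rewrite ler_norml; lra.
Qed.

(** For [Q <= 0] the velocity of the second half does not fall when its crossing time shrinks. The
    second half is therefore shortened by at least [eps], and the first half is lengthened to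
    match. *)
Lemma perturb_mixed : 0 < P -> Q <= 0 -> perturbable.
Proof.
move=> P0 Q0; have c0' := c0.
have rg := rgap_gt0 (ltW P0).
have [[halfP halfQ] _ VW cr] := ok; have [PQ _ _] := nr.
have [B B0 tayl] := taylor b w k0 n0 (half_peak halfQ).
(* First-order matching would take [- Q / (P + Q)]. The extra [1 / (P + Q)] creates a velocity gap
   of [eps] at the far end, which pays for the quadratic remainder that [e0] keeps below [eps]. *)
pose N := (1 - Q) / (P + Q).
have N0 : 0 < N by rewrite divr_gt0//; lra.
have NE : (P + Q) * N = 1 - Q by rewrite mulrC divfK// gt_eqF.
have N1 : 0 < N + 1 by lra.
have BN : 0 <= B * (N + 1) ^+ 2 by rewrite mulr_ge0// exprn_ge0// ltW.
pose e0 := Num.min (Num.min ((N + 1)^-1) ((B * (N + 1) ^+ 2 + 1)^-1))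
  (Num.min ((k + n) * (P + Q) / (N + 1)) ((r - n * b) / (N + 1))).
exists (N + 1); first lra.
exists e0.
  rewrite !lt_min !invr_gt0 N1 !divr_gt0 ?mulr_gt0//=.
  by rewrite andbT; lra.
move=> eps eps0; rewrite !le_min => /andP[/andP[eN eB] /andP[ePQ er]].
have {}eN : (N + 1) * eps <= 1 by rewrite -(ler_pM2l N1) mulfV ?gt_eqF// in eN.
have {}eB : B * (N + 1) ^+ 2 * eps <= 1.
  have B1 : 0 < B * (N + 1) ^+ 2 + 1 by lra.
  rewrite -(ler_pM2l B1) mulfV ?gt_eqF// in eB; lra.
have {}ePQ : (N + 1) * eps <= (k + n) * (P + Q).
  by rewrite -(ler_pM2l N1) [leRHS]mulrC divfK ?gt_eqF// in ePQ.
have {}er : (N + 1) * eps <= r - n * b.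
  by rewrite -(ler_pM2l N1) [leRHS]mulrC divfK ?gt_eqF// in er.
have Ne := mulr_gt0 N0 eps0; have N1e := mulr_gt0 N1 eps0.
have [s /andP[s1 s2] sE] : exists2 s, q <= s <= q + N * eps &
    VV s - WW (q + r - eps - s) = 0.
  apply: IVT_eq; first lra.
  - exact: fc.
  - have -> : q + r - eps - q = r - eps by ring.
    have := convR r (r - eps); rewrite VE WE VW QQr.1.
    have := mulr_ge0 (_ : 0 <= - Q) (ltW eps0); rewrite oppr_ge0 => /(_ Q0); lra.
  - have -> : q + r - eps - (q + N * eps) = r - (N + 1) * eps by ring.
    have := convL q (q + N * eps); rewrite VE PPq.1 => hP.
    have := tayl _ _ (pk_ok b k0 n0 g0 (r - (N + 1) * eps)).
    rewrite tcr_pk => /(_ _)/wrap[|[hQ _]].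
      by rewrite ler_norml; lra.
    move: hQ; rewrite ler_norml => /andP[_ hQ].
    have : WW (r - (N + 1) * eps) <= vel k n b w Q e - Q * ((N + 1) * eps)
        + B * ((N + 1) * eps) ^+ 2 by move: hQ; rewrite /vq; lra.
    rewrite -VW => hQ'.
    have e1 : B * ((N + 1) * eps) ^+ 2 <= eps.
      have -> : B * ((N + 1) * eps) ^+ 2 = (B * (N + 1) ^+ 2 * eps) * eps by ring.
      by rewrite -[leRHS]mul1r ler_wpM2r// ltW.
    have e2 : (P + Q) * N * eps = (1 - Q) * eps by rewrite NE.
    lra.
exists s, (q + r - eps - s).
have [mp1 mp2] := pk_mono a k0 n0 h0 s1; rewrite PPq.1 in mp1 mp2.
have rr : q + r - eps - s <= r by lra.
have [mq1 mq2] := pk_mono b k0 n0 g0 rr; rewrite QQr.1 in mq1 mq2.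
have P'0 : 0 <= PP s by lra.
have Q'0 : QQ (q + r - eps - s) <= 0 by lra.
have PQ' : 0 <= PP s + QQ (q + r - eps - s).
  have : 0 <= (k + n) * (PP s + QQ (q + r - eps - s)).
    have := mulr_ge0 (ltW c0) mp1; lra.
  by rewrite pmulr_rge0.
have aP : a <= P by case: halfP.
have hP' : half k h l2 a v (PP s) (hd k n h a s).
  by apply: pair_hyp_half => //; [lra|exact: pk_ok|exact: lowL].
have VW' : VV s = WW (q + r - eps - s) by lra.
split.
- split => //.
  + split => //; have [Qg e_0 eg] := pk_ok b k0 n0 g0 (q + r - eps - s).
    split => //.
    * by apply: pk_ge => //; lra.
    * by constructor 1.
    (* As [- Q' <= P'] and [Q' <= 0], the second switch is no lower than the first on the common
       parabola and inherits its lower bound on [x_2]. *)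
    * have [_ _ _ _ lsw] := hP'; apply: le_trans lsw _; rewrite lee_fin.
      rewrite (vswE k n a) (vswE k n b); move: VW'; rewrite /vq => ->.
      set P' := PP s in P'0 PQ' *; set Q' := QQ _ in Q'0 PQ' *.
      have : 0 <= n * ((P' + Q') * (P' - Q')).
        by apply: mulr_ge0; [exact: ltW|apply: mulr_ge0; lra].
      lra.
  + by constructor 2.
- ring.
- rewrite ler_norml; lra.
- rewrite ler_norml; lra.
Qed.

End Direction.

End Perturbation.

(** Sum of two expansions: the terms in [V] add up to [- V * eps], those in [p2] and [q2] to
    [- pq * eps] up to [S]; [F1] and [F2] are the remainders. *)
Lemma first_order_bound (R : realFieldType)
  (X Y X' Y' V p2 q2 pq x y eps F1 F2 S D : R) :
  - F1 <= X' - X - (V + p2) * x -> - F2 <= Y' - Y - (V + q2) * y ->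
  y = - eps - x -> - S <= p2 * x + q2 * y + pq * eps ->
  0 <= X + Y - D - (V + pq) * eps - (F1 + F2 + S) -> D <= X' + Y'.
Proof. by move=> h1 h2 yE h3 h4; rewrite yE in h2 h3; lra. Qed.

(** * Shortening an arbitrary law *)

Section HiPerturb.
Variables (R : realType) (p : bounds R) (x0 xf : state R).
Hypotheses (hulo : ulo p < 0) (huhi : 0 < uhi p).
Hypothesis hxlo : forall k : 'I_2, (xlo p k < 0)%E.
Hypothesis hxhi : forall k : 'I_2, (0 < xhi p k)%E.
Hypotheses (wx0 : within p x0) (wxf : within p xf).
Implicit Types (P d Q e c : R).

Local Notation K := (uhi p).
Local Notation k := ((uhi p)^-1).
Local Notation n := ((- ulo p)^-1).
Local Notation l1 := (xlo p 0).
Local Notation h1 := (xhi p 0).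
Local Notation l2 := (xlo p 1).
Local Notation h2 := (xhi p 1).
Local Notation a := (x0.c1).
Local Notation v := (x0.c2).
Local Notation b := (- xf.c1).
Local Notation w := (xf.c2).

Let K0 : K != 0. Proof. exact: lt0r_neq0. Qed.
Let m0 : - ulo p != 0. Proof. by rewrite lt0r_neq0// oppr_gt0. Qed.
Let u0 : ulo p != 0. Proof. by rewrite ltr0_neq0. Qed.
Let k_gt0 : 0 < k := kgt0 huhi.
Let n_gt0 : 0 < n := ngt0 hulo.
Let Kk : K * k = 1. Proof. exact: mulfV. Qed.
Let mn : - ulo p * n = 1. Proof. exact: mulfV. Qed.
Let h1_gt0 : (0 < h1)%E. Proof. exact: hxhi. Qed.
Let l1_gt0 : (0 < - l1)%E. Proof. by rewrite oppe_gt0. Qed.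
Let ah : (a%:E <= h1)%E. Proof. by have /withinE[/andP[]] := wx0. Qed.
Let bh : (b%:E <= - l1)%E.
Proof. by rewrite EFinN leeN2; have /withinE[/andP[]] := wxf. Qed.

(** A positive gap outweighs both corrections for small [eps]; without a gap, a negative rate [q]
    outweighs the quadratic one. *)
Lemma small_step (gap q M : R) : 0 <= gap -> 0 < gap \/ q < 0 -> 0 <= M ->
  exists2 e1, 0 < e1 & forall eps, 0 < eps -> eps <= e1 ->
    0 <= gap - q * eps - M * eps ^+ 2 /\ eps <= 1.
Proof.
move=> g0 gq M0.
pose C := `|q| + M + 1.
have C0 : 0 < C by rewrite ltr_wpDl// addr_ge0.
have C1 : 1 <= C by rewrite /C; have := normr_ge0 q; lra.
have qC : - C <= q /\ q <= C.
  by have := ler_norm q; have := ler_norm (- q); rewrite normrN /C; lra.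
have [q0|q0] := ltP q 0.
  exists (Num.min 1 (- q / C)); first by rewrite lt_min ltr01 divr_gt0// oppr_gt0.
  move=> eps e0; rewrite le_min => /andP[e1 e2]; split => //.
  have e3 : C * eps <= - q by rewrite -(ler_pM2l C0) [leRHS]mulrC divfK ?gt_eqF// in e2.
  have : M * eps <= C * eps by rewrite ler_wpM2r ?(ltW e0)// /C; have := normr_ge0 q; lra.
  move=> e4; have := mulr_ge0 (ltW e0) (_ : 0 <= - q - M * eps); lra.
have {gq}gap0 : 0 < gap by case: gq => //; lra.
exists (Num.min 1 (gap / C)); first by rewrite lt_min ltr01 divr_gt0.
move=> eps e0; rewrite le_min => /andP[e1 e2]; split => //.
have e3 : C * eps <= gap by rewrite -(ler_pM2l C0) [leRHS]mulrC divfK ?gt_eqF// in e2.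
have qE : `|q| = q by rewrite ger0_norm.
have : eps ^+ 2 <= eps by rewrite expr2 ler_piMr// ltW.
move=> e4; have := ler_wpM2l M0 e4; rewrite /C qE in e3; lra.
Qed.

Let al2 : (l2 <= v%:E)%E. Proof. by have /withinE[_ /andP[]] := wx0. Qed.
Let bl2 : (l2 <= w%:E)%E. Proof. by have /withinE[_ /andP[]] := wxf. Qed.

(** With a cruise only its length is reduced, at the cost [V * eps], where [V = h2 > 0]. Otherwise
    the rate is [V + n P Q / 2], and the displacement stays above [D] either thanks to a gap or
    because a negative rate makes the shorter law go further. *)
Lemma hi_perturb P d Q e c (D : R) : hi_ok p x0 xf P d Q e c ->
  0 < c \/ nonrigid a b P d Q e ->
  D <= hi_dsp p x0 xf P d Q e c ->
  D < hi_dsp p x0 xf P d Q e c \/ vel k n a v P d + n * P * Q / 2 < 0 ->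
  exists2 e0, 0 < e0 & forall eps, 0 < eps -> eps <= e0 ->
    exists P' d' Q' e' c', [/\ hi_ok p x0 xf P' d' Q' e' c',
      hi_tot p x0 xf P' d' Q' e' c' = hi_tot p x0 xf P d Q e c - eps &
      D <= hi_dsp p x0 xf P' d' Q' e' c'].
Proof.
move=> ok nr Dle Dlt; have [hh PQVW c_ge0 cc cr] := ok; have [PQ VW] := PQVW.
set V := vel k n a v P d in Dlt *.
have [c0|c0] := ltP 0 c.
  case: cc => [cE|[P0 Q0 Vh]]; first by rewrite cE ltxx in c0.
  have V0 : 0 < V by rewrite -lte_fin Vh; exact: hxhi.
  have q0 : 0 <= n * P * Q / 2 by rewrite !mulr_ge0// ltW.
  have {}Dlt : D < hi_dsp p x0 xf P d Q e c by case: Dlt => // ?; exfalso; lra.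
  exists (Num.min c ((hi_dsp p x0 xf P d Q e c - D) / V)).
    by rewrite lt_min c0 divr_gt0// subr_gt0.
  move=> eps eps0; rewrite le_min ler_pdivlMr// => /andP[ec eV].
  exists P, d, Q, e, (c - eps); split.
  - split => //; first by rewrite subr_ge0.
    by right.
  - by rewrite /hi_tot; ring.
  - by move: eV; rewrite /hi_dsp -/V; lra.
have {}c0 : c = 0 by lra.
case: nr => [|nr]; first by rewrite c0 ltxx.
have ok2 : pair_ok k n l2 h2 h1 a v (- l1)%E b w P d Q e by [].
have k0' := k_gt0; have n0' := n_gt0.
have [PQ0 _ _] := nr.
have : perturbable k n l2 h2 h1 (- l1)%E a v b w P d Q e.
  have [P0|P0] := ltP 0 P.
    have [Q0|Q0] := ltP 0 Q.
      exact: (perturb_pos k_gt0 n_gt0 h1_gt0 l1_gt0 ah bh al2 bl2 ok2 nr).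
    exact: (perturb_mixed k_gt0 n_gt0 h1_gt0 l1_gt0 bh al2 ok2 nr P0 Q0).
  have Q0 : 0 < Q by lra.
  have nr' : nonrigid b a Q e P d.
    by case: nr => n1 n2 n3; split => //; rewrite addrC.
  have [N N1 [e0 e00 H]] :=
    perturb_mixed k_gt0 n_gt0 l1_gt0 h1_gt0 ah bl2 (pair_okC ok2) nr' Q0 P0.
  exists N => //; exists e0 => // eps eps0 eps1.
  have [r' [q' [okc E B1 B2]]] := H eps eps0 eps1.
  exists q', r'; split => //; first exact: pair_okC.
  by rewrite [LHS]addrC E; ring.
case=> N N1 [e0 e00 pert].
have [hP hQ] := hh.
have [B1 B10 tay1] := taylor a v k_gt0 n_gt0 (half_peak hP).
have [B2 B20 tay2] := taylor b w k_gt0 n_gt0 (half_peak hQ).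
pose B := B1 + B2; have B0 : 0 <= B by exact: addr_ge0.
(* The remainder of the displacement, plus that of the velocity matching amplified by
   [n / 2 * |P - Q|], for changes of size at most [N * eps]. *)
pose M := (1 + n / 2 * `|P - Q|) * B * N ^+ 2.
have N0 : 0 <= N by lra.
have M0 : 0 <= M.
  have t0 : 0 <= 1 + n / 2 * `|P - Q|.
    by rewrite addr_ge0// mulr_ge0// divr_ge0// ltW.
  by rewrite /M mulr_ge0 ?exprn_ge0// mulr_ge0.
have gap0 : 0 <= hi_dsp p x0 xf P d Q e c - D by rewrite subr_ge0.
have gap1 : 0 < hi_dsp p x0 xf P d Q e c - D \/ V + n * P * Q / 2 < 0.
  by rewrite subr_gt0.
have [e1 e10 sm] := small_step gap0 gap1 M0.
have Ni : 0 < N^-1 by rewrite invr_gt0; lra.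
exists (Num.min e0 (Num.min e1 N^-1)); first by rewrite !lt_min e00 e10.
move=> eps eps0; rewrite !le_min => /and3P[ee0 ee1 eN].
have {}eN : N * eps <= 1.
  have N1' : 0 < N by exact: lt_le_trans ltr01 N1.
  by rewrite -(ler_pM2l N1') mulfV ?gt_eqF// in eN.
have [q' [r' [ok' E bq br]]] := pert eps eps0 ee0.
have [gap _] := sm eps eps0 ee1.
set P' := pk _ _ _ _ q' in ok'; set d' := hd _ _ _ _ q' in ok'.
set Q' := pk _ _ _ _ r' in ok'; set e' := hd _ _ _ _ r' in ok'.
have tP : tcr k n a P' d' = q' by exact: tcr_pk.
have tQ : tcr k n b Q' e' = r' by exact: tcr_pk.
have [[hP' hQ'] PQ' VW' cr'] := ok'.
exists P', d', Q', e', 0; split.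
- by split => //; left.
- by rewrite /hi_tot tP tQ E c0; ring.
have := tay1 _ _ (half_peak hP'); rewrite tP => /(_ (le_trans bq eN)).
have := tay2 _ _ (half_peak hQ'); rewrite tQ => /(_ (le_trans br eN)).
set q := tcr k n a P d in bq E *; set r := tcr k n b Q e in br E *.
rewrite -VW -VW' -/V.
set V' := vel _ _ _ _ _ _.
rewrite !ler_norml => -[/andP[w1 w2] /andP[y1 y2]] [/andP[v1 v2] /andP[x1 x2]].
have sq (z : R) : `|z| <= N * eps -> z ^+ 2 <= N ^+ 2 * eps ^+ 2.
  move=> h; rewrite -exprMn -(ger0_norm (sqr_ge0 z)) normrX.
  by rewrite lerXn2r// ?nnegrE// mulr_ge0// ltW.
have s1 := sq _ bq; have s2 := sq _ br.
set X' := dsp k n a v P' d' in x1 x2; set Y' := dsp k n b w Q' e' in y1 y2.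
set X := dsp k n a v P d in x1 x2; set Y := dsp k n b w Q e in y1 y2.
have dspE : hi_dsp p x0 xf P' d' Q' e' 0 = X' + Y' by rewrite /hi_dsp mul0r addr0.
have dspE0 : hi_dsp p x0 xf P d Q e c = X + Y by rewrite /hi_dsp c0 mul0r addr0.
rewrite dspE dspE0 in gap *.
set E2 := eps ^+ 2 in s1 s2 gap.
have E20 : 0 <= E2 by exact: sqr_ge0.
pose F := N ^+ 2 * E2.
have F0 : 0 <= F by rewrite mulr_ge0// exprn_ge0.
have b1 : B1 * (q' - q) ^+ 2 <= B1 * F by rewrite ler_wpM2l.
have b2 : B2 * (r' - r) ^+ 2 <= B2 * F by rewrite ler_wpM2l.
have eta : `|P * (q' - q) - Q * (r' - r)| <= B * F.
  move: w1 w2 v1 v2 b1 b2; rewrite ler_norml /B mulrDl; lra.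
have prod : - (`|P - Q| * (B * F)) <= (P - Q) * (P * (q' - q) - Q * (r' - r)).
  rewrite lerNl (le_trans (ler_norm _))// normrN normrM ler_wpM2l//.
have n2 : 0 <= n / 2 by rewrite divr_ge0// ltW.
have := ler_wpM2l n2 prod.
have rE : r' - r = - eps - (q' - q) by lra.
(* Matching forces [P dq = Q dr] up to second order. Multiplied by [n (P - Q) / 2], this merges the
   coefficients [n P^2 / 2] and [n Q^2 / 2] into the single rate [n P Q / 2]. *)
have -> : n / 2 * ((P - Q) * (P * (q' - q) - Q * (r' - r))) =
  n * P ^+ 2 / 2 * (q' - q) + n * Q ^+ 2 / 2 * (r' - r) + n * P * Q / 2 * eps.
  by rewrite rE; field; rewrite ?m0.
move=> pr; apply: (@first_order_bound R X Y X' Y' V (n * P ^+ 2 / 2)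
  (n * Q ^+ 2 / 2) (n * P * Q / 2) (q' - q) (r' - r) eps (B1 * F) (B2 * F)
  (n / 2 * (`|P - Q| * (B * F)))) => //.
- by rewrite (le_trans _ x1)// lerN2.
- by rewrite (le_trans _ y1)// lerN2.
- by move: pr; rewrite mulrN.
- by move: gap; congr (_ <= _ - _); rewrite /M /F /B; ring.
Qed.

End HiPerturb.

(** * Minimal time *)

Section Closedness.
Variables (R : realType) (X : topologicalType).
Implicit Types f g : X -> R.

Lemma ctsD f g : continuous f -> continuous g -> continuous (fun x => f x + g x).
Proof. by move=> fc gc x; apply: cvgD; [exact: fc|exact: gc]. Qed.
Lemma ctsN f : continuous f -> continuous (fun x => - f x).
Proof. by move=> fc x; apply: cvgN; exact: fc. Qed.
Lemma ctsM f g : continuous f -> continuous g -> continuous (fun x => f x * g x).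
Proof. by move=> fc gc x; apply: cvgM; [exact: fc|exact: gc]. Qed.
Lemma ctsX f m : continuous f -> continuous (fun x => f x ^+ m).
Proof.
move=> fc; elim: m => [|m IH] x; first exact: cvg_cst.
have -> : (fun y => f y ^+ m.+1) = (fun y => f y * f y ^+ m).
  by apply/funext => y; rewrite exprS.
by apply: cvgM; [exact: fc|exact: IH].
Qed.

Lemma closed_fun_le f g : continuous f -> continuous g -> closed [set x | f x <= g x].
Proof.
move=> fc gc; have -> : [set x | f x <= g x] = (fun x => g x + - f x) @^-1` [set y | 0 <= y].
  by apply/seteqP; split => x /=; rewrite subr_ge0.
by apply: closed_comp; [move=> x _; apply: ctsD gc (ctsN fc) x|exact: closed_ge].
Qed.

Lemma closed_fun_eq f g : continuous f -> continuous g -> closed [set x | f x = g x].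
Proof.
move=> fc gc; have -> : [set x | f x = g x] = [set x | f x <= g x] `&` [set x | g x <= f x].
  apply/seteqP; split => x /=; first by move=> ->; rewrite lexx.
  by move=> [h1 h2]; apply/eqP; rewrite eq_le h1 h2.
by apply: closedI; exact: closed_fun_le.
Qed.

Lemma closed_fun_lee f (h : \bar R) : continuous f -> closed [set x | ((f x)%:E <= h)%E].
Proof.
move=> fc; case: h => [h| |].
- under eq_set do rewrite lee_fin; apply: closed_fun_le => //; exact: cst_continuous.
- rewrite (_ : [set _ | _] = setT); first exact: closedT.
  by apply/seteqP; split => x //= _; rewrite leey.
- rewrite (_ : [set _ | _] = set0); first exact: closed0.
  by apply/seteqP; split => x //=; rewrite leeNy_eq.
Qed.

Lemma closed_fun_gee f (h : \bar R) : continuous f -> closed [set x | (h <= (f x)%:E)%E].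
Proof.
move=> fc; case: h => [h| |].
- under eq_set do rewrite lee_fin; apply: closed_fun_le => //; exact: cst_continuous.
- rewrite (_ : [set _ | _] = set0); first exact: closed0.
  by apply/seteqP; split => x //=; rewrite leye_eq.
- rewrite (_ : [set _ | _] = setT); first exact: closedT.
  by apply/seteqP; split => x //= _; rewrite leNye.
Qed.

Lemma closed_fun_eqe f (h : \bar R) : continuous f -> closed [set x | (f x)%:E = h].
Proof.
move=> fc; have -> : [set x | (f x)%:E = h] =
    [set x | ((f x)%:E <= h)%E] `&` [set x | (h <= (f x)%:E)%E].
  apply/seteqP; split => x /=; first by move=> ->; rewrite lexx.
  by move=> [h1 h2]; apply/eqP; rewrite eq_le h1 h2.
by apply: closedI; [exact: closed_fun_lee|exact: closed_fun_gee].
Qed.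

Lemma closed_and (A B : X -> Prop) : closed [set x | A x] -> closed [set x | B x] ->
  closed [set x | A x /\ B x].
Proof. exact: closedI. Qed.
Lemma closed_or (A B : X -> Prop) : closed [set x | A x] -> closed [set x | B x] ->
  closed [set x | A x \/ B x].
Proof. exact: closedU. Qed.
Lemma closed_and3 (A B C : X -> Prop) : closed [set x | A x] -> closed [set x | B x] ->
  closed [set x | C x] -> closed [set x | [/\ A x, B x & C x]].
Proof.
move=> cA cB cC; have := closed_and cA (closed_and cB cC).
congr closed; apply/seteqP; split => x; first by case=> ? [].
by case.
Qed.
Lemma closed_or3 (A B C : X -> Prop) : closed [set x | A x] -> closed [set x | B x] ->
  closed [set x | C x] -> closed [set x | [\/ A x, B x | C x]].
Proof.
move=> cA cB cC; have := closed_or cA (closed_or cB cC).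
congr closed; apply/seteqP; split => x.
  by case=> [?|[?|?]]; [constructor 1|constructor 2|constructor 3].
by case=> ?; [left|right; left|right; right].
Qed.
Lemma closed_and5 (A B C D E : X -> Prop) : closed [set x | A x] ->
  closed [set x | B x] -> closed [set x | C x] -> closed [set x | D x] ->
  closed [set x | E x] -> closed [set x | [/\ A x, B x, C x, D x & E x]].
Proof.
move=> cA cB cC cD cE.
have := closed_and cA (closed_and cB (closed_and cC (closed_and cD cE))).
congr closed; apply/seteqP; split => x; first by case=> ? [? [? []]].
by case.
Qed.

End Closedness.

Ltac cts := cbv beta zeta; lazymatch goal with
  | |- continuous (fun _ => ?c) => exact: cst_continuous
  | |- continuous (fun x => @?f x + @?g x) => apply: (@ctsD _ _ f g); cts
  | |- continuous (fun x => - (@?f x)) => apply: (@ctsN _ _ f); cts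
  | |- continuous (fun x => @?f x * @?g x) => apply: (@ctsM _ _ f g); cts
  | |- continuous (fun x => (@?f x) ^+ ?m) => apply: (@ctsX _ _ f m); cts
  | _ => exact: coord_continuous
  end.

Section MinimalTime.
Variable R : realType.

Definition ord5 (i : nat) (h : (i < 5)%N) : 'I_5 := Ordinal h.
Definition vec5 (P d Q e c : R) : 'rV[R]_5 := \row_(i < 5) [:: P; d; Q; e; c]`_i.

Section Compact.
Variables (p : bounds R) (x0 xf : state R) (D Tf : R).
Hypotheses (hulo : ulo p < 0) (huhi : 0 < uhi p).
Local Notation k := ((uhi p)^-1).
Local Notation n := ((- ulo p)^-1).
Local Notation a := (x0.c1).
Local Notation b := (- xf.c1).

(** The parameters form one vector, so that compactness of boxes in dimension 5 applies; the cap
    [Tf] on the duration is what bounds them. *)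
Definition hi_params (z : 'rV[R]_5) : Prop :=
  let P := z 0 (@ord5 0 isT) in let d := z 0 (@ord5 1 isT) in
  let Q := z 0 (@ord5 2 isT) in let e := z 0 (@ord5 3 isT) in let c := z 0 (@ord5 4 isT) in
  [/\ hi_ok p x0 xf P d Q e c, D <= hi_dsp p x0 xf P d Q e c &
      hi_tot p x0 xf P d Q e c <= Tf].

Definition hi_time (z : 'rV[R]_5) : R :=
  hi_tot p x0 xf (z 0 (@ord5 0 isT)) (z 0 (@ord5 1 isT)) (z 0 (@ord5 2 isT))
    (z 0 (@ord5 3 isT)) (z 0 (@ord5 4 isT)).

Lemma vec5E P d Q e c : [/\ vec5 P d Q e c 0 (@ord5 0 isT) = P,
  vec5 P d Q e c 0 (@ord5 1 isT) = d, vec5 P d Q e c 0 (@ord5 2 isT) = Q,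
  vec5 P d Q e c 0 (@ord5 3 isT) = e & vec5 P d Q e c 0 (@ord5 4 isT) = c].
Proof. by split; rewrite mxE. Qed.

Lemma hi_time_cts : continuous hi_time.
Proof. rewrite /hi_time /hi_tot /tcr; cts. Qed.

Lemma closed_hi_params : closed [set z | hi_params z].
Proof.
rewrite /hi_params; apply: closed_and3.
- rewrite /hi_ok /half; apply: closed_and5.
  + by apply: closed_and; apply: closed_and5;
      repeat first [apply: closed_and | apply: closed_or3 | apply: closed_or
      | apply: closed_fun_le | apply: closed_fun_lee | apply: closed_fun_gee
      | apply: closed_fun_eqe | apply: closed_fun_eq]; rewrite /low /vsw /low; cts.
  + by apply: closed_and; [apply: closed_fun_le|apply: closed_fun_eq]; rewrite /vel; cts.
  + by apply: closed_fun_le; cts.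
  + apply: closed_or; first by apply: closed_fun_eq; cts.
    by apply: closed_and3; [apply: closed_fun_le|apply: closed_fun_le|
      apply: closed_fun_eqe]; rewrite /vel; cts.
  + by apply: closed_or3; [apply: closed_fun_le|apply: closed_fun_le|
      apply: closed_fun_lee]; rewrite /vel; cts.
- by apply: closed_fun_le; rewrite /hi_dsp /dsp /tail /dsp0 /vel /low; cts.
- by apply: closed_fun_le; rewrite /hi_tot /tcr; cts.
Qed.

Lemma compact_hi_params : compact [set z | hi_params z].
Proof.
have k0 : 0 < k by rewrite invr_gt0.
have n0 : 0 < n by rewrite invr_gt0 oppr_gt0.
have c0 : 0 < k + n by exact: addr_gt0.
(* The parts of [hi_tot] are bounded below through [a <= P] and [b <= Q], so the cap on their sum
   bounds each of them above. *)
pose m : R := `|a| + `|b|; pose S : R := `|Tf| + (k + n) * (2 * m).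
pose B : R := S + m + S / (k + n).
have box := @rV_compact R 5 (fun=> `[- B, B]%classic) (fun=> @segment_compact R _ _).
apply: subclosed_compact box _; first exact: closed_hi_params.
move=> z [ok _ tT].
set P := z 0 _ in ok tT; set d := z 0 _ in ok tT; set Q := z 0 _ in ok tT.
set e := z 0 _ in ok tT; set c := z 0 _ in ok tT.
have [[[aP [_ d0] _ _ _] [bQ [_ e0] _ _ _]] _ c_ge0 _ _] := ok.
have na := ler_norm a; have na' := ler_norm (- a); rewrite normrN in na'.
have nb := ler_norm b; have nb' := ler_norm (- b); rewrite normrN in nb'.
have nT := ler_norm Tf; have m0 : 0 <= m by rewrite addr_ge0.
have am : - m <= a <= m by rewrite /m; have := normr_ge0 b; lra.
have bm : - m <= b <= m by rewrite /m; have := normr_ge0 a; lra.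
have S0 : 0 <= S by rewrite addr_ge0// mulr_ge0 ?mulr_ge0// ltW.
have Sc0 : 0 <= S / (k + n) by rewrite divr_ge0// ltW.
have mul_m (x y : R) : 0 < y -> - m <= x <= m -> - (y * m) <= y * x <= y * m.
  by move=> y0 /andP[x1 x2]; rewrite -mulrN !ler_pM2l// x1.
have ka := mul_m a k k0 am; have kb := mul_m b k k0 bm.
have na2 := mul_m a n n0 am; have nb2 := mul_m b n n0 bm.
have SE : S = `|Tf| + 2 * (k * m) + 2 * (n * m) by rewrite /S; ring.
have km := mulr_ge0 (ltW k0) m0; have nm := mulr_ge0 (ltW n0) m0.
have cP : (k + n) * a <= (k + n) * P by rewrite ler_pM2l.
have cQ : (k + n) * b <= (k + n) * Q by rewrite ler_pM2l.
rewrite /hi_tot /tcr in tT.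
have P1 : P <= S / (k + n) by rewrite ler_pdivlMr// mulrC SE; lra.
have Q1 : Q <= S / (k + n) by rewrite ler_pdivlMr// mulrC SE; lra.
have d1 : d <= S by rewrite SE; lra.
have e1 : e <= S by rewrite SE; lra.
have c1 : c <= S by rewrite SE; lra.
move=> i /=; rewrite in_itv /= /B.
case: i => [[|[|[|[|[|//]]]]] hi].
- by rewrite (_ : z 0 _ = P) //; [lra|congr (z _ _); exact: val_inj].
- by rewrite (_ : z 0 _ = d) //; [lra|congr (z _ _); exact: val_inj].
- by rewrite (_ : z 0 _ = Q) //; [lra|congr (z _ _); exact: val_inj].
- by rewrite (_ : z 0 _ = e) //; [lra|congr (z _ _); exact: val_inj].
- by rewrite (_ : z 0 _ = c) //; [lra|congr (z _ _); exact: val_inj].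
Qed.

Definition hi_times : set R := [set T | exists P d Q e c,
  [/\ hi_ok p x0 xf P d Q e c, D <= hi_dsp p x0 xf P d Q e c,
      hi_tot p x0 xf P d Q e c <= Tf & hi_tot p x0 xf P d Q e c = T]].

Lemma compact_hi_times : compact hi_times.
Proof.
have -> : hi_times = hi_time @` [set z | hi_params z].
  apply/seteqP; split => T /=.
    move=> [P [d [Q [e [c [h1 h2 h3 h4]]]]]].
    have [E0 E1 E2 E3 E4] := vec5E P d Q e c.
    by exists (vec5 P d Q e c); rewrite /hi_params /hi_time E0 E1 E2 E3 E4.
  move=> [z [h1 h2 h3] <-].
  by exists (z 0 (@ord5 0 isT)), (z 0 (@ord5 1 isT)), (z 0 (@ord5 2 isT)),
    (z 0 (@ord5 3 isT)), (z 0 (@ord5 4 isT)).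
apply: continuous_compact; last exact: compact_hi_params.
exact/continuous_subspaceT/hi_time_cts.
Qed.

End Compact.
End MinimalTime.

(** * Extremality or a shorter law *)

Section Progress.
Variables (R : realType) (p : bounds R) (x0 xf : state R).
Hypotheses (hulo : ulo p < 0) (huhi : 0 < uhi p).
Hypothesis hxlo : forall k : 'I_2, (xlo p k < 0)%E.
Hypothesis hxhi : forall k : 'I_2, (0 < xhi p k)%E.
Hypotheses (wx0 : within p x0) (wxf : within p xf).
Implicit Types (P d Q e c : R).

Local Notation K := (uhi p).
Local Notation k := ((uhi p)^-1).
Local Notation n := ((- ulo p)^-1).
Local Notation l1 := (xlo p 0).
Local Notation h1 := (xhi p 0).
Local Notation a := (x0.c1).
Local Notation v := (x0.c2).
Local Notation b := (- xf.c1).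
Local Notation w := (xf.c2).

Let K0 : K != 0. Proof. exact: lt0r_neq0. Qed.
Let k_gt0 : 0 < k := kgt0 huhi.
Let n_gt0 : 0 < n := ngt0 hulo.
Let h1_gt0 : (0 < h1)%E. Proof. exact: hxhi. Qed.
Let l1_gt0 : (0 < - l1)%E. Proof. by rewrite oppe_gt0. Qed.

(* [V + n P Q / 2], where [V] is the velocity at the crossing of [x_1 = 0], is
   the rate of change of the displacement with the duration: it becomes the
   multiplier [lam0].  The other alternatives are laws whose parameters
   cannot be varied in both directions. *)
Definition multiplier_ok (P d Q e c : R) : Prop :=
  [\/ 0 < c, [/\ Q = b, e = 0 & 0 <= P], [/\ P = a, d = 0 & 0 <= Q] |
      [/\ P + Q = 0, d = 0 & e = 0] \/ 0 <= vel k n a v P d + n * P * Q / 2].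

Definition extremal (P d Q e c : R) : Prop :=
  [/\ hi_ok p x0 xf P d Q e c, hi_dsp p x0 xf P d Q e c = xf.c3 - x0.c3 &
      multiplier_ok P d Q e c].

(** If [P + Q = 0] and a hold is nonempty, then the peak or the trough sits at its bound, and the
    bounds on the end points force the other one to its end value: this is one of the first two
    cases. *)
Lemma rigid_cases (P d Q e c : R) : hi_ok p x0 xf P d Q e c -> ~ nonrigid a b P d Q e ->
  [\/ [/\ Q = b, e = 0 & 0 <= P], [/\ P = a, d = 0 & 0 <= Q] |
      [/\ P + Q = 0, d = 0 & e = 0]].
Proof.
move=> [[[aP [Ph d0] dh _ _] [bQ [Qh e0] eh _ _]] [PQ VW] _ _ _] nr.
have [A|nA] := pselect [/\ Q = b, e = 0 & 0 <= P]; first by constructor 1.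
have [B|nB] := pselect [/\ P = a, d = 0 & 0 <= Q]; first by constructor 2.
constructor 3; have PQ0 : P + Q = 0.
  apply/eqP; rewrite eq_le PQ andbT leNgt; apply/negP => PQ0.
  by apply: nr.
have lt1 : (l1 < h1)%E by exact: lt_trans (hxlo 0) (hxhi 0).
have [xf1 xf2] : (l1 <= xf.c1%:E)%E /\ (xf.c1%:E <= h1)%E.
  by have /withinE[/andP[]] := wxf.
have [x01 x02] : (l1 <= a%:E)%E /\ (a%:E <= h1)%E.
  by have /withinE[/andP[]] := wx0.
have h1P : P%:E = h1 -> 0 < P by move=> Pe; rewrite -lte_fin Pe.
have l1Q : Q%:E = (- l1)%E -> 0 < Q by move=> Qe; rewrite -lte_fin Qe.
have d00 : d = 0.
  case: dh => // Pe; have P0 := h1P Pe.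
  have e00 : e = 0 by case: eh => // /l1Q; lra.
  have Qb : Q = b.
    have : - b <= P by rewrite -lee_fin opprK Pe.
    lra.
  by case: nA; split => //; exact: ltW.
split => //; case: eh => // Qe; have Q0 := l1Q Qe.
have Pa : P = a.
  have : - a <= Q by rewrite -lee_fin Qe EFinN leeN2.
  lra.
by case: nB; split => //; exact: ltW.
Qed.

(** The [x_2] agree at both ends. Either ordering of the [x_1] makes [x_2] of [z] the smaller one:
    integrate forwards from 0 if [x_1] of [z] is below, backwards from [T] if it is above. *)
Lemma kinematic_squeeze m m' K1 K2 T (y z : R -> state R) :
  kinematic m K1 T y -> kinematic m' K2 T z -> 0 <= T -> y 0 = z 0 ->
  (y T).c2 = (z T).c2 ->
  (forall t, 0 < t <= T -> (y t).c1 <= (z t).c1) \/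
  (forall t, 0 < t <= T -> (z t).c1 <= (y t).c1) ->
  (z T).c3 <= (y T).c3.
Proof.
move=> ky kz T0 yz0 yzT yz.
have zy t : 0 < t <= T -> (z t).c2 <= (y t).c2.
  move=> /andP[t0 tT]; case: yz => yz.
    have := kinematic_cmp (k := 0) ky kz (ltW t0) tT (lexx _) _.
    rewrite nxt0 cur0 yzT => /(_ _)/wrap[|]; last lra.
    by move=> r /andP[tr rT]; apply: yz; rewrite rT andbT (lt_trans t0).
  have := kinematic_cmp (k := 0) kz ky (lexx 0) (ltW t0) tT _.
  rewrite nxt0 cur0 yz0 => /(_ _)/wrap[|]; last lra.
  by move=> r /andP[r0 rt]; apply: yz; rewrite r0 (le_trans rt).
have := kinematic_cmp (k := 1) kz ky (lexx 0) T0 (lexx _) _.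
rewrite nxt1 cur1 yz0 => /(_ _)/wrap[|]; last lra.
exact: zy.
Qed.

(** A rigid law is extremal in [x_1] over its whole duration: it is a first half followed by one
    [lo0] arc, a [lo0] arc followed by a second half, or [hi0] alone. The squeeze then applies to
    every competitor. *)
Lemma rigid_unique (P d Q e c : R) (y : R -> state R) :
  let T := hi_tot p x0 xf P d Q e c in
  hi_ok p x0 xf P d Q e c -> c = 0 -> ~ nonrigid a b P d Q e ->
  kinematic (- ulo p) K T y -> y 0 = x0 -> (y T).c1 = xf.c1 -> (y T).c2 = w ->
  (forall t : R, 0 <= t <= T -> within p (y t)) ->
  x0.c3 + hi_dsp p x0 xf P d Q e c <= (y T).c3.
Proof.
move=> T ok c0 nr ky y0 yT1 yT2 wy.
have l0 := hi_durs hulo huhi ok.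
have [[[aP [Ph d0] dh _ _] [bQ [Qh e_0] eh _ _]] [PQ VW] _ _ _] := ok.
have [[T10 T12 T23 T34] [T45 T56 T67]] := hi_arcs_times l0.
have TE := T7E p x0 xf P d Q e c; rewrite -/T in TE.
have kz' := hi_arcs_kinematic hulo huhi l0; rewrite -/T in kz'.
have zT : st x0 (hi_arcs p x0 xf P d Q e c) T = fin x0 (hi_arcs p x0 xf P d Q e c).
  by rewrite -TE st_hi_T7.
have fE := fin_hi_arcs hulo huhi c VW.
have -> : x0.c3 + hi_dsp p x0 xf P d Q e c =
    (st x0 (hi_arcs p x0 xf P d Q e c) T).c3 by rewrite zT fE mkst3.
have T0 : 0 <= T by rewrite -TE; lra.
apply: (kinematic_squeeze ky kz' T0); first by rewrite st_0.
  by rewrite zT fE mkst2.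
have T53 : T5 p x0 P d Q c = T3 p x0 P d Q c.
  by rewrite /T5 /T4 /mid5 c0 eqxx !addr0.
have left t : 0 < t <= T2 p x0 P d -> (y t).c1 <= (st x0 (hi_arcs p x0 xf P d Q e c) t).c1.
  by move=> /andP[t0 t2]; apply: cmp_left => //; rewrite t2 ltW.
case: (rigid_cases ok nr) => [[QE eE P0]|[PE dE Q0]|[PQ0 dE eE]].
- left => t /andP[t0 tT].
  have [t2|t2] := leP t (T2 p x0 P d); first by apply: left; rewrite t0.
  have T37 : T3 p x0 P d Q c = T.
    by rewrite -TE /T7 /T6 T53 QE eE subrr mul0r !addr0.
  have := cmp_mid3 l0 ky (ltW t2) tT; rewrite T37 => /(_ (lexx _)).
  by rewrite zT fE mkst1 yT1; lra.
- right => t /andP[t0 tT].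
  have T20 : T2 p x0 P d = 0 by rewrite /T2 /T1 PE dE subrr mul0r add0r.
  have [t3|t3] := leP (T3 p x0 P d Q c) t.
    by apply: cmp_right => //; rewrite T53 t3.
  have := @cmp_mid3 _ _ _ _ y P d Q e c l0 ky 0 t; rewrite T20 => /(_ (lexx _) (ltW t0) (ltW t3)).
  by rewrite st_0// y0; lra.
- left => t /andP[t0 tT].
  have [t2|t2] := leP t (T2 p x0 P d); first by apply: left; rewrite t0.
  have T62 : T6 p x0 P d Q e c = T2 p x0 P d.
    by rewrite /T6 T53 /T3 eE /mid3 c0 eqxx PQ0 mul0r !addr0.
  rewrite (arc7 l0) ?T62 ?(ltW t2) ?TE//.
  rewrite flow_c1 /s6 flow_c1 (z2E hulo huhi c VW) mkst1.
  have /andP[_] := proj1 ky 0 t (lexx _) (ltW t0) tT.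
  have : K * (t - T2 p x0 P d) = K * t - (P - a).
    by rewrite /T2 /T1 dE; field.
  rewrite y0; lra.
Qed.

Definition reachable_before (P d Q e c : R) : Prop :=
  exists2 e0, 0 < e0 & forall eps, 0 < eps -> eps <= e0 ->
    exists P' d' Q' e' c', [/\ hi_ok p x0 xf P' d' Q' e' c',
      hi_tot p x0 xf P' d' Q' e' c' = hi_tot p x0 xf P d Q e c - eps &
      xf.c3 - x0.c3 <= hi_dsp p x0 xf P' d' Q' e' c'].

(** [y] will be the reflected member of the mirror family with the same duration, which does not go
    beyond the target. In the rigid case it forces the law to end exactly at the target. *)
Lemma hi_progress (P d Q e c : R) (y : R -> state R) :
  let T := hi_tot p x0 xf P d Q e c in
  hi_ok p x0 xf P d Q e c -> xf.c3 - x0.c3 <= hi_dsp p x0 xf P d Q e c ->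
  kinematic (- ulo p) K T y -> y 0 = x0 -> (y T).c1 = xf.c1 -> (y T).c2 = w ->
  (forall t : R, 0 <= t <= T -> within p (y t)) -> (y T).c3 <= xf.c3 ->
  extremal P d Q e c \/ reachable_before P d Q e c.
Proof.
move=> T ok Dle ky y0 yT1 yT2 wy yT3.
have [c0|c0] := ltP 0 c.
  move: Dle; rewrite le_eqVlt => /orP[/eqP DE|Dlt].
    by left; split => //; constructor 1.
  by right; apply: hi_perturb => //; [left|exact: ltW|left].
have {}c0 : c = 0 by case: ok => _ _ cc _ _; lra.
have [nr|nr] := pselect (nonrigid a b P d Q e); last first.
  left; split => //.
    have := rigid_unique ok c0 nr ky y0 yT1 yT2 wy; lra.
  case: (rigid_cases ok nr) => h; first by constructor 2.
    by constructor 3.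
  by constructor 4; left.
move: (Dle); rewrite le_eqVlt => /orP[/eqP DE|Dlt].
  have [q0|q0] := leP 0 (vel k n a v P d + n * P * Q / 2).
    by left; split => //; constructor 4; right.
  by right; apply: hi_perturb => //; right.
by right; apply: hi_perturb => //; [right|left].
Qed.

End Progress.

(** * Reflection through the origin *)

Section Mirror.
Variable R : realType.
Implicit Types (p : bounds R).
Let mu := @lebesgue_measure R.

Lemma mirrorK p : mirror (mirror p) = p.
Proof.
case: p => ul uh xl xh; rewrite /mirror /= !opprK; congr Bounds; apply/funext => k;
  by rewrite oppeK.
Qed.

Lemma withinN p (x : state R) : within (mirror p) (- x) <-> within p x.
Proof.
split=> h k; have := h k; rewrite /= mxE EFinN !leeN2 andbC => /andP[-> ->]//.
Qed.

(** When an infinite value occurs, both sides are 0 by the default of [fine]. *)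
Lemma RintegralN d (T : measurableType d) (m : {measure set T -> \bar R})
  (D : set T) (f : T -> R) :
  \int[m]_(x in D) (- f x) = - \int[m]_(x in D) f x.
Proof.
rewrite /Rintegral; have -> : (fun x => (- f x)%:E) = (\- (EFin \o f))%E by [].
rewrite integralE [in RHS]integralE funeposN funenegN.
set A := integral _ _ _; set B := integral _ _ _.
by case: A => [r| |]; case: B => [s| |] //=; rewrite ?oppr0 ?opprB// addrC.
Qed.

Lemma feasibleN p (x0 xf : state R) (T : R) (x : R -> state R) (u : R -> R) :
  feasible p x0 xf T x u ->
  feasible (mirror p) (- x0) (- xf) T (fun t => - x t) (fun t => - u t).
Proof.
move=> [T0 [mu_ ub] xE xw xT]; split=> //.
- split; first exact: measurableT_comp.
  move: ub; apply: filterS; first exact: (ae_filter_ringOfSetsType mu).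
  by move=> t h /h /andP[h1 h2] /=; rewrite !lerN2 h1 h2.
- move=> t /xE[h1 h2]; split.
    by rewrite mxE h1 RintegralN mxE opprD.
  move=> k; rewrite mxE h2 mxE opprD; congr +%R.
  by rewrite -RintegralN; apply: eq_Rintegral => s _; rewrite mxE.
- by move=> t /xw/withinN.
- by rewrite xT.
Qed.

End Mirror.

(** * Selection of an extremal law *)

Section Select.
Variables (R : realType).
Implicit Types (p : bounds R).

Lemma minimal_time p (x0 xf : state R) (Tf : R) (y : R -> state R) (u : R -> R) :
  ulo p < 0 -> 0 < uhi p ->
  (forall k : 'I_2, (xlo p k < 0)%E) -> (forall k : 'I_2, (0 < xhi p k)%E) ->
  feasible p x0 xf Tf y u ->
  (exists P d Q e c, extremal p x0 xf P d Q e c) \/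
  (exists P d Q e c, extremal (mirror p) (- x0) (- xf) P d Q e c).
Proof.
move=> ul uh xl xh yf.
pose p' := mirror p.
have ul' : ulo p' < 0 by rewrite oppr_lt0.
have uh' : 0 < uhi p' by rewrite oppr_gt0.
have xl' (k : 'I_2) : (xlo p' k < 0)%E by rewrite /= oppe_lt0.
have xh' (k : 'I_2) : (0 < xhi p' k)%E by rewrite /= oppe_gt0.
have ends q z0 zf T (z : R -> state R) v : ulo q < 0 -> 0 < uhi q ->
    feasible q z0 zf T z v ->
    [/\ kinematic (- ulo q) (uhi q) T z, 0 <= T, z 0 = z0, z T = zf &
      (forall t, 0 <= t <= T -> within q (z t))].
  move=> q1 q2 zfe; have [kz z0E] := feasible_kinematic (ltW (lt_trans q1 q2)) zfe.
  case: zfe => T0 _ _ zw zT; split=> // t tT; apply: zw; by rewrite in_itv.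
have ex q z0 zf T (z : R -> state R) v : ulo q < 0 -> 0 < uhi q ->
    (forall k : 'I_2, (xlo q k < 0)%E) -> (forall k : 'I_2, (0 < xhi q k)%E) ->
    feasible q z0 zf T z v -> within q z0 /\ within q zf /\
    hi_times q z0 zf (zf.c3 - z0.c3) T T.
  move=> q1 q2 q3 q4 zfe; have [kz T0 z0E zT zw] := ends _ _ _ _ _ _ q1 q2 zfe.
  have wz0 : within q z0 by rewrite -z0E; apply: zw; rewrite lexx.
  have wzf : within q zf by rewrite -zT; apply: zw; rewrite T0 lexx.
  split=> //; split=> //.
  have [|||P [d [Q [e [c [h1 h2 h3]]]]]] := hi_exists q1 q2 q3 q4 wz0 wzf kz T0 z0E.
  - by rewrite zT.
  - by rewrite zT.
  - exact: zw.
  by move: h3; rewrite zT => h3; exists P, d, Q, e, c; split => //; rewrite h2.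
have [wx0 [wxf AT]] := ex _ _ _ _ _ _ ul uh xl xh yf.
have [wx0' [wxf' BT]] := ex _ _ _ _ _ _ ul' uh' xl' xh' (feasibleN yf).
set A := hi_times p x0 xf _ _ in AT.
set B := hi_times p' (- x0) (- xf) _ _ in BT.
have cA : compact A by exact: compact_hi_times.
have cB : compact B by exact: compact_hi_times.
(* [A] consists of the durations of laws that go at least as far as the target, [B] of those of
   mirror laws that, reflected, do not go beyond it. [Tf] belongs to both, and the least common
   duration is the one to take. *)
have cAB : compact (A `&` B).
  by apply: compact_closedI => //; apply: compact_closed => //; exact: Rhausdorff.
have [Ts TsAB min] : exists2 T, T \in A `&` B & forall t, t \in A `&` B -> T <= t.
  apply: (@compact_EVT_min _ _ id _ _ cAB); first by exists Tf.
  by apply: continuous_subspaceT => t; exact: cvg_id.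
move: TsAB; rewrite inE => -[].
move=> [P [d [Q [e [c [okP DP TP tP]]]]]] [P' [d' [Q' [e' [c' [okM DM TM tM]]]]]].
have fP := hi_feasible ul uh xl xh wx0 wxf okP.
have fM := hi_feasible ul' uh' xl' xh' wx0' wxf' okM.
have fP' := feasibleN fP; have fM' := feasibleN fM.
rewrite mirrorK !opprK in fM'.
have [kP _ P0 PT Pw] := ends _ _ _ _ _ _ ul' uh' fP'.
have [kM _ M0 MT Mw] := ends _ _ _ _ _ _ ul uh fM'.
rewrite tP -tM in kP PT Pw; rewrite tM -tP in kM MT Mw.
have [] := hi_progress ul uh xl xh wx0 wxf okP DP kM M0 _ _ Mw _.
- by rewrite MT !mxE /=; lra.
- by rewrite MT !mxE /=; lra.
- by rewrite MT; move: DM; rewrite !mxE /=; lra.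
- by move=> good; left; exists P, d, Q, e, c.
move=> [e1 e10 H1].
have [] := hi_progress ul' uh' xl' xh' wx0' wxf' okM DM kP P0 _ _ Pw _.
- by rewrite PT !mxE /=; lra.
- by rewrite PT !mxE /=; lra.
- by rewrite PT; move: DP; rewrite !mxE /=; lra.
- by move=> good; right; exists P', d', Q', e', c'.
(* If both laws could be shortened, the smaller threshold would give a common duration below the
   minimum. *)
move=> [e2 e20 H2]; exfalso.
pose ep := Num.min e1 e2.
have ep0 : 0 < ep by rewrite lt_min e10.
have m1 : ep <= e1 by rewrite ge_min lexx.
have m2 : ep <= e2 by rewrite ge_min lexx orbT.
have [P1 [d1 [Q1 [f1 [c1 [okP1 tP1 DP1]]]]]] := H1 ep ep0 m1.
have [P2 [d2 [Q2 [f2 [c2 [okP2 tP2 DP2]]]]]] := H2 ep ep0 m2.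
have : Ts <= Ts - ep; last by lra.
apply: min; rewrite inE; split.
  exists P1, d1, Q1, f1, c1; split => //; rewrite tP1 tP//.
  by rewrite tP in TP; lra.
exists P2, d2, Q2, f2, c2; split => //; rewrite tP2 tM//.
by rewrite tM in TM; lra.
Qed.

End Select.

(** * The costate *)

Section Toolbox.
Variable R : realType.
Let mu := @lebesgue_measure R.

Lemma ae_off_seq (s : seq R) (P : R -> Prop) :
  (forall t, t \notin s -> P t) -> {ae mu, forall t, P t}.
Proof.
move=> h; exists [set` s]; split.
- apply: countable_measurable; first by move=> x; exact: measurable_set1.
  exact/finite_set_countable/finite_seq.
- apply: countable_lebesgue_measure0; exact/finite_set_countable/finite_seq.
- by move=> t /= nP; apply: contrapT => /negP ts; apply: nP; exact: h.
Qed.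

Lemma lipschitz_abs_continuous (a b L : R) (f : R -> R) : 0 <= L ->
  (forall s t, a <= s -> s <= t -> t <= b -> `|f t - f s| <= L * (t - s)) ->
  abs_continuous a b f.
Proof.
move=> L0 lip e e0; have L1 : 0 < L + 1 by rewrite ltr_wpDl.
exists (e / (L + 1)); first exact: divr_gt0.
move=> s sab _; rewrite ltr_pdivlMr// mulrC => se.
have h : \sum_(q <- s) `|f q.2 - f q.1| <= L * \sum_(q <- s) (q.2 - q.1).
  rewrite mulr_sumr big_seq [leRHS]big_seq; apply: ler_sum => q qs.
  by have /and3P[h1 h2 h3] := sab q qs; exact: lip.
have s0 : 0 <= \sum_(q <- s) (q.2 - q.1).
  rewrite big_seq; apply: sumr_ge0 => q qs.
  by have /and3P[_ h2 _] := sab q qs; rewrite subr_ge0.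
by lra.
Qed.

Lemma is_derive_local (f g : R -> R) (a b t l : R) : a < t < b ->
  (forall x, a < x < b -> f x = g x) -> is_derive t (1 : R) g l ->
  is_derive t (1 : R) f l.
Proof.
move=> /andP[a_t tb] fg; apply: near_eq_is_derive; near=> x; apply/esym/fg.
by apply/andP; split; near: x; [exact: lt_nbhsr|exact: lt_nbhsl].
Unshelve. all: by end_near. Qed.

(** A [ramp] built on it is constant outside [[s, t]], so the first costate can be written as one
    sum that is continuous across all switches. *)
Definition clip (s t x : R) := Num.max s (Num.min x t).

Lemma clip_le s t x : x <= s -> clip s t x = s.
Proof. by move=> xs; rewrite /clip max_l// ge_min xs. Qed.

Lemma clip_in s t x : s <= x <= t -> clip s t x = x.
Proof. by move=> /andP[sx xt]; rewrite /clip min_l// max_r. Qed.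

Lemma clip_ge s t x : s <= t -> t <= x -> clip s t x = t.
Proof. by move=> st tx; rewrite /clip min_r// max_r. Qed.

Lemma clip_mono s t x y : s <= t -> x <= y ->
  [/\ s <= clip s t x, clip s t x <= clip s t y, clip s t y <= t &
      clip s t y - clip s t x <= y - x].
Proof.
move=> st xy.
have [xs|xs] := leP x s.
  rewrite (clip_le t xs).
  have [ys|ys] := leP y s; first by rewrite (clip_le t ys); split => //; lra.
  have [yt|yt] := leP y t; first by rewrite clip_in ?yt ?(ltW ys)//; split; lra.
  by rewrite (clip_ge st (ltW yt)); split; lra.
have [xt|xt] := leP x t.
  rewrite (@clip_in s t x) ?xt ?(ltW xs)//.
  have [yt|yt] := leP y t.
    by rewrite clip_in ?yt ?(le_trans (ltW xs))//; split; lra.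
  by rewrite (clip_ge st (ltW yt)); split; lra.
by rewrite (clip_ge st (ltW xt)) (clip_ge st (le_trans (ltW xt) xy)); split; lra.
Qed.

Definition quad (q m x : R) := q * x ^+ 2 / 2 - m * x.
(* the integral of [m - q y] for [y] between [s] and [t], up to [x] *)
Definition ramp (q m s t x : R) := quad q m s - quad q m (clip s t x).

Lemma ramp_le q m s t x : x <= s -> ramp q m s t x = 0.
Proof. by move=> xs; rewrite /ramp clip_le// subrr. Qed.
Lemma ramp_in q m s t x : s <= x <= t -> ramp q m s t x = quad q m s - quad q m x.
Proof. by move=> xs; rewrite /ramp clip_in. Qed.
Lemma ramp_ge q m s t x : s <= t -> t <= x ->
  ramp q m s t x = quad q m s - quad q m t.
Proof. by move=> st tx; rewrite /ramp clip_ge. Qed.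

(** The increment of a quadratic is its slope at the midpoint times the increment of the argument,
    and [clip] is nonexpansive with values in [[s, t]]. *)
Lemma ramp_lipschitz q m s t : s <= t -> exists2 L, 0 <= L &
  forall x y, x <= y -> `|ramp q m s t y - ramp q m s t x| <= L * (y - x).
Proof.
move=> st; exists (`|q| * (`|s| + `|t|) + `|m|).
  by rewrite addr_ge0// mulr_ge0// addr_ge0.
move=> x y xy; have [h1 h2 h3 h4] := clip_mono st xy.
set u := clip s t x in h1 h2 h4 *; set v := clip s t y in h2 h3 h4 *.
have -> : ramp q m s t y - ramp q m s t x = (m - q * ((u + v) / 2)) * (v - u).
  by rewrite /ramp -/u -/v /quad; field.
rewrite normrM [`|v - u|]ger0_norm ?subr_ge0//.
apply: ler_pM => //; first by rewrite subr_ge0.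
have hb z : s <= z <= t -> `|z| <= `|s| + `|t|.
  move=> /andP[sz zt]; rewrite ler_norml.
  have := ler_norm t; have := ler_norm (- s); rewrite normrN.
  have := normr_ge0 t; have := normr_ge0 s; lra.
have := hb ((u + v) / 2); move=> /(_ _)/wrap[|hz]; first lra.
rewrite (le_trans (ler_normB _ _))// addrC lerD2r normrM ler_wpM2l//.
Qed.

Lemma mkstD (a b c : R) : mkst a b c =
  a *: delta_mx 0 0 + b *: delta_mx 0 1 + c *: delta_mx 0 2%:R.
Proof. by apply: stP; rewrite !mxE /=; ring. Qed.

Lemma mkst_cvg (F : set_system R) {FF : Filter F} (f g h : R -> R) (a b c : R) :
  f @ F --> a -> g @ F --> b -> h @ F --> c ->
  mkst (f t) (g t) (h t) @[t --> F] --> mkst a b c.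
Proof.
move=> fa gb hc; rewrite mkstD; under eq_fun do rewrite mkstD.
by apply: cvgD; [apply: cvgD|]; apply: cvgZr_tmp || apply: cvgZl_tmp || apply: cvgZl.
Qed.

End Toolbox.

(** * The piecewise quadratic costate *)

Section Costate.
Variables (R : realType) (p : bounds R) (x0 xf : state R).
Hypotheses (hulo : ulo p < 0) (huhi : 0 < uhi p).
Hypothesis hxlo : forall k : 'I_2, (xlo p k < 0)%E.
Hypothesis hxhi : forall k : 'I_2, (0 < xhi p k)%E.
Hypotheses (wx0 : within p x0) (wxf : within p xf).
Implicit Types (P d Q e c : R).

Local Notation k := ((uhi p)^-1).

Variables (P d Q e c : R).
Hypothesis ok : hi_ok p x0 xf P d Q e c.
Variables (kap mu1 mu2 e0 lam0 : R).
Local Notation t1 := (T1 p x0 P).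
Local Notation t2 := (T2 p x0 P d).
Local Notation t3 := (T3 p x0 P d Q c).
Local Notation t4 := (T4 p x0 P d Q c).
Local Notation t5 := (T5 p x0 P d Q c).
Local Notation t6 := (T6 p x0 P d Q e c).
Local Notation t7 := (T7 p x0 xf P d Q e c).
Local Notation l := (hi_arcs p x0 xf P d Q e c).

(* The third costate is [- kap].  The second one has slope [kap], vanishes on
   the cruise and jumps at its ends; the first one is frozen on the holds and on
   the cruise. *)
Definition costate1 t := e0 - ramp kap mu1 0 t1 t1 + ramp kap mu1 0 t1 t
  + ramp kap mu1 t2 t3 t + ramp kap mu2 t4 t5 t + ramp kap mu2 t6 t7 t.
Definition costate2 t := if t <= t3 then kap * t - mu1
  else if t <= t4 then 0 else kap * t - mu2.
Definition costate t : state R := mkst (costate1 t) (costate2 t) (- kap).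
Local Notation E1 := (quad kap mu1).
Local Notation E2 := (quad kap mu2).
Definition costate1_mid := e0 + E1 t2 - E1 t3.
Definition costate1_end := costate1_mid + E2 t4 - E2 t5.

Let l0 : durs_ge0 l. Proof. by have h := hi_durs hulo huhi ok. Qed.
Let times := hi_arcs_times l0.

Lemma costate1_arc1 t : 0 <= t <= t1 -> costate1 t = e0 + E1 t1 - E1 t.
Proof.
have [[T10 T12 T23 T34] [T45 T56 T67]] := times => /andP[t0 tt].
rewrite /costate1 ramp_in ?T10 ?lexx// ramp_in ?t0// !ramp_le ?(le_trans tt)//; lra.
Qed.

Lemma costate1_arc2 t : t1 <= t <= t2 -> costate1 t = e0.
Proof.
have [[T10 T12 T23 T34] [T45 T56 T67]] := times => /andP[ta tb].
have [h1' h2' h3'] : [/\ t <= t2, t <= t4 & t <= t6] by split; lra.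
rewrite /costate1 ramp_in ?T10 ?lexx// (ramp_ge _ _ T10 ta) !ramp_le//; lra.
Qed.

Lemma costate1_arc3 t : t2 <= t <= t3 -> costate1 t = e0 + E1 t2 - E1 t.
Proof.
have [[T10 T12 T23 T34] [T45 T56 T67]] := times => /andP[ta tb].
have [h1' h2' h3'] : [/\ t1 <= t, t <= t4 & t <= t6] by split; lra.
rewrite /costate1 ramp_in ?T10 ?lexx// (ramp_ge _ _ T10 h1').
by rewrite (@ramp_in _ _ _ t2) ?ta// !ramp_le//; lra.
Qed.

Lemma costate1_arc4 t : t3 <= t <= t4 -> costate1 t = costate1_mid.
Proof.
have [[T10 T12 T23 T34] [T45 T56 T67]] := times => /andP[ta tb].
have [h1' h3'] : t1 <= t /\ t <= t6 by split; lra.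
rewrite /costate1 ramp_in ?T10 ?lexx// (ramp_ge _ _ T10 h1').
by rewrite (ramp_ge _ _ T23 ta) !ramp_le// /costate1_mid; lra.
Qed.

Lemma costate1_arc5 t : t4 <= t <= t5 -> costate1 t = costate1_mid + E2 t4 - E2 t.
Proof.
have [[T10 T12 T23 T34] [T45 T56 T67]] := times => /andP[ta tb].
have [h1' h2' h3'] : [/\ t1 <= t, t3 <= t & t <= t6] by split; lra.
rewrite /costate1 ramp_in ?T10 ?lexx// (ramp_ge _ _ T10 h1').
rewrite (ramp_ge _ _ T23 h2') (@ramp_in _ _ _ t4) ?ta// ramp_le// /costate1_mid; lra.
Qed.

Lemma costate1_arc6 t : t5 <= t <= t6 -> costate1 t = costate1_end.
Proof.
have [[T10 T12 T23 T34] [T45 T56 T67]] := times => /andP[ta tb].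
have [h1' h2'] : t1 <= t /\ t3 <= t by split; lra.
rewrite /costate1 ramp_in ?T10 ?lexx// (ramp_ge _ _ T10 h1').
rewrite (ramp_ge _ _ T23 h2') (ramp_ge _ _ T45 ta) ramp_le// /costate1_end /costate1_mid; lra.
Qed.

Lemma costate1_arc7 t : t6 <= t <= t7 -> costate1 t = costate1_end + E2 t6 - E2 t.
Proof.
have [[T10 T12 T23 T34] [T45 T56 T67]] := times => /andP[ta tb].
have [h1' h2' h3'] : [/\ t1 <= t, t3 <= t & t5 <= t] by split; lra.
rewrite /costate1 ramp_in ?T10 ?lexx// (ramp_ge _ _ T10 h1').
rewrite (ramp_ge _ _ T23 h2') (ramp_ge _ _ T45 h3').
by rewrite (@ramp_in _ _ _ t6) ?ta// /costate1_end /costate1_mid; lra.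
Qed.

Lemma costate1_lipschitz : exists2 L, 0 <= L &
  forall x y, x <= y -> `|costate1 y - costate1 x| <= L * (y - x).
Proof.
have [[T10 T12 T23 T34] [T45 T56 T67]] := times.
have [L1 L10 h1'] := ramp_lipschitz kap mu1 T10.
have [L2 L20 h2'] := ramp_lipschitz kap mu1 T23.
have [L3 L30 h3'] := ramp_lipschitz kap mu2 T45.
have [L4 L40 h4'] := ramp_lipschitz kap mu2 T67.
exists (L1 + L2 + L3 + L4); first by rewrite !addr_ge0.
move=> x y xy; rewrite /costate1.
set r1 := ramp _ _ 0 _ t1; set a1 := ramp _ _ 0 _ y; set b1 := ramp _ _ 0 _ x.
set a2 := ramp _ _ t2 _ y; set b2 := ramp _ _ t2 _ x.
set a3 := ramp _ _ t4 _ y; set b3 := ramp _ _ t4 _ x.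
set a4 := ramp _ _ t6 _ y; set b4 := ramp _ _ t6 _ x.
rewrite (_ : _ - _ = (a1 - b1) + (a2 - b2) + (a3 - b3) + (a4 - b4)); last by ring.
rewrite !mulrDl (le_trans (ler_normD _ _))// lerD ?h4'//.
rewrite (le_trans (ler_normD _ _))// lerD ?h3'//.
by rewrite (le_trans (ler_normD _ _))// lerD ?h2' ?h1'.
Qed.

Lemma costate1_cts : continuous costate1.
Proof.
have clip_cts s t : continuous (clip s t : R -> R).
  move=> x; apply: (@continuous_max _ _ (cst s) (fun x => Num.min x t)); first exact: cvg_cst.
  by apply: (@continuous_min _ _ id (cst t)); [exact: cvg_id|exact: cvg_cst].
have ramp_cts q m s t : continuous (ramp q m s t : R -> R).
  move=> x; apply: cvgB; first exact: cvg_cst.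
  apply: (@continuous_comp _ _ _ (clip s t) (quad q m)); first exact: clip_cts.
  have dq : is_derive (clip s t x) (1 : R) (quad q m) (q * clip s t x - m).
    by rewrite /quad; apply: is_derive_eq; rewrite /GRing.scale /=; field.
  exact: is_derive_cts dq.
by move=> x; rewrite /costate1; repeat (apply: cvgD; last exact: ramp_cts); exact: cvg_cst.
Qed.

End Costate.

(** * The conditions of the maximum principle on each arc *)

Section Multipliers.
Variables (R : realType) (p : bounds R) (x0 xf : state R).
Hypotheses (hulo : ulo p < 0) (huhi : 0 < uhi p).
Hypothesis hxlo : forall k : 'I_2, (xlo p k < 0)%E.
Hypothesis hxhi : forall k : 'I_2, (0 < xhi p k)%E.
Hypotheses (wx0 : within p x0) (wxf : within p xf).
Implicit Types (P d Q e c : R).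

Local Notation K := (uhi p).
Local Notation k := ((uhi p)^-1).
Local Notation n := ((- ulo p)^-1).
Local Notation l1 := (xlo p 0).
Local Notation h1 := (xhi p 0).
Local Notation h2 := (xhi p 1).
Local Notation a := (x0.c1).
Local Notation v := (x0.c2).
Local Notation b := (- xf.c1).
Local Notation w := (xf.c2).

Let K0 : K != 0. Proof. exact: lt0r_neq0. Qed.
Let m0 : - ulo p != 0. Proof. by rewrite lt0r_neq0// oppr_gt0. Qed.
Let u0 : ulo p != 0. Proof. by rewrite ltr0_neq0. Qed.
Let mn : - ulo p * n = 1. Proof. exact: mulfV. Qed.

Variables (P d Q e c : R).
Hypothesis ok : hi_ok p x0 xf P d Q e c.
Variables (kap mu1 mu2 e0 lam0 : R).
Local Notation V := (vel k n a v P d).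
Local Notation t1 := (T1 p x0 P).
Local Notation t2 := (T2 p x0 P d).
Local Notation t3 := (T3 p x0 P d Q c).
Local Notation t4 := (T4 p x0 P d Q c).
Local Notation t5 := (T5 p x0 P d Q c).
Local Notation t6 := (T6 p x0 P d Q e c).
Local Notation t7 := (T7 p x0 xf P d Q e c).
Local Notation l := (hi_arcs p x0 xf P d Q e c).

Local Notation m := (- ulo p).
Local Notation x := (st x0 l).
Let l0 : durs_ge0 l. Proof. by have h := hi_durs hulo huhi ok. Qed.
Let times := hi_arcs_times l0.
Let VW : V = vel k n b w Q e. Proof. by case: ok => _ []. Qed.

Lemma arc1_state t : 0 <= t <= t1 -> (x t).c1 = P + K * (t - t1) /\
  (x t).c2 = V - n * P ^+ 2 / 2 - P * d + P * (t - t1) + K * (t - t1) ^+ 2 / 2.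
Proof.
move=> tt; rewrite (arc1 l0)// !flowE /T1 -(vswE k n a v) /vsw /low.
by split; field; exact: K0.
Qed.

Lemma arc2_state t : t1 <= t <= t2 -> (x t).c1 = P /\
  (x t).c2 = V - n * P ^+ 2 / 2 - P * (t2 - t).
Proof.
move=> tt; rewrite (arc2 l0)// !flowE /T2 /T1 -(vswE k n a v) /vsw /low.
by split; field; exact: K0.
Qed.

Lemma arc3_state t : t2 <= t <= t3 -> (x t).c1 = P - m * (t - t2) /\
  (x t).c2 = V - n * P ^+ 2 / 2 + P * (t - t2) - m * (t - t2) ^+ 2 / 2.
Proof.
move=> tt; rewrite (arc3 l0)// flow_c1 flow_c2 (z1E x0 huhi) mkst1 mkst2.
by rewrite -(vswE k n a v); split; ring.
Qed.

Lemma arc4_state t : c != 0 -> t3 <= t <= t4 -> (x t).c1 = 0 /\ (x t).c2 = V.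
Proof.
move=> c0 tt; rewrite (arc4 l0)// (crossing_state x0 hulo huhi P d Q c0).
by rewrite flow_c1 flow_c2 mkst1 mkst2; split; ring.
Qed.

Lemma arc5_state t : c != 0 -> t4 <= t <= t5 -> (x t).c1 = - m * (t - t4) /\
  (x t).c2 = V - m * (t - t4) ^+ 2 / 2.
Proof.
move=> c0 tt; rewrite (arc5 l0)// /s4 (crossing_state x0 hulo huhi P d Q c0).
by rewrite !flowE mkst1 mkst2; split; ring.
Qed.

Lemma arc6_state t : t5 <= t <= t6 -> (x t).c1 = - Q /\
  (x t).c2 = V - n * Q ^+ 2 / 2 - Q * (t - t5).
Proof.
move=> tt; rewrite (arc6 l0)//; have := z2E hulo huhi c VW; move: (z2 _ _ _ _ _ _ _) => S SE.
rewrite flow_c1 flow_c2 SE mkst1 mkst2.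
by rewrite (vswE _ n) -VW; split; ring.
Qed.

Lemma arc7_state t : t6 <= t <= t7 -> (x t).c1 = - Q + K * (t - t6) /\
  (x t).c2 = V - n * Q ^+ 2 / 2 - Q * e - Q * (t - t6) + K * (t - t6) ^+ 2 / 2.
Proof.
move=> tt; rewrite (arc7 l0)// /s6; have := z2E hulo huhi c VW; move: (z2 _ _ _ _ _ _ _) => S SE.
rewrite !flowE SE mkst1 mkst2.
by rewrite (vswE _ n) -VW; split; ring.
Qed.

Lemma hold1 : t1 < t2 -> P%:E = h1.
Proof.
case: ok => -[[_ _ [->|//] _ _] _] _ _ _ _; by rewrite /T2 addr0 ltxx.
Qed.

Lemma hold2 : t5 < t6 -> Q%:E = (- l1)%E.
Proof.
case: ok => -[_ [_ _ [->|//] _ _]] _ _ _ _; by rewrite /T6 addr0 ltxx.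
Qed.

Lemma cruise : t3 < t4 -> [/\ 0 <= P, 0 <= Q & V%:E = h2].
Proof.
case: ok => _ _ _ [->|//] _; by rewrite /T4 addr0 ltxx.
Qed.

Lemma mid5_cruise : t4 < t5 -> c != 0 /\ t5 = t4 + Q * n.
Proof. by rewrite /T5 /mid5; case: ifPn => // c0; rewrite addr0 ltxx. Qed.

Local Notation L1 := (costate1 p x0 xf P d Q e c kap mu1 mu2 e0).
Local Notation L2 := (costate2 p x0 P d Q c kap mu1 mu2).
Local Notation L := (costate p x0 xf P d Q e c kap mu1 mu2 e0).
Local Notation costate1_mid := (costate1_mid p x0 P d Q c kap mu1 e0).
Local Notation costate1_end := (costate1_end p x0 P d Q c kap mu1 mu2 e0).
(** [HL] and [HR] are the Hamiltonian at the end of the first hold and at the start of the second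
    one, without the control term. They must vanish on a hold and balance the control term on the
    neighbouring arcs. *)
Let HL := lam0 + (kap * t2 - mu1) * P - kap * (V - n * P ^+ 2 / 2).
Let HR := lam0 - (kap * t5 - mu2) * Q - kap * (V - n * Q ^+ 2 / 2).

(** The Hamiltonian is constant on each arc, so one equation per arc suffices; it is asked only if
    the arc has positive length. In [co_cruise] the two implications concern the jumps: next to an
    empty [lo0] arc the bound on [x_2] is not left, so this end of the cruise must be an end of the
    trajectory. *)
Record costate_ok : Prop := CostateOk {
  co_lam0 : 0 <= lam0;
  co_kap : 0 <= kap;
  co_nontrivial : kap != 0 \/ forall t, 0 <= t <= t7 -> L t != 0;
  co_cruise : c = 0 /\ mu1 = mu2 \/
    [/\ 0 < c, 0 < kap, t2 = t3 -> t3 = 0 & t4 = t5 -> t4 = t7] /\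
      [/\ kap * t3 - mu1 = kap * (t3 - t2) / 2 & kap * t4 - mu2 = - (kap * (t5 - t4) / 2)];
  co1 : 0 < t1 -> HL + K * e0 = 0 /\ forall t, 0 < t < t1 -> L1 t < 0;
  co2 : t1 < t2 -> [/\ HL = 0, e0 = 0 & kap * t2 <= mu1];
  co3 : t2 < t3 -> HL = m * e0 /\ forall t, t2 < t < t3 -> 0 < L1 t;
  co4 : t3 < t4 -> lam0 = kap * V /\ costate1_mid = 0;
  co5 : t4 < t5 -> HR = m * costate1_end /\ forall t, t4 < t < t5 -> 0 < L1 t;
  co6 : t5 < t6 -> [/\ HR = 0, costate1_end = 0 & mu2 <= kap * t5];
  co7 : t6 < t7 -> HR + K * costate1_end = 0 /\ forall t, t6 < t < t7 -> L1 t < 0 }.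

(** On a hold the multiplier compensates the second costate, so that the first one stays constant;
    on the cruise it compensates [- kap], so that the second one stays at 0. *)
Definition eta (j : 'I_2) (s : bool) t : R :=
  if j == 0 then
    if s then if t1 < t < t2 then - L2 t else 0
    else if t5 < t < t6 then L2 t else 0
  else if s && (t3 < t < t4) then kap else 0.

Definition pmp_at t : Prop :=
  [/\ is_derive t (1 : R) (fun s => (L s).c3) 0 /\
        forall j : 'I_2, is_derive t (1 : R) (fun s => L s 0 (cur j))
          (- (L t 0 (nxt j) + eta j true t - eta j false t)),
      forall j s, eta j s t = 0 \/ active p (x t) j s,
      lam0 + (L t).c1 * ct l t + (L t).c2 * (x t).c1 + (L t).c3 * (x t).c2 = 0 &
      [/\ (L t).c1 < 0 -> ct l t = K, (L t).c1 = 0 -> ct l t = 0 &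
          0 < (L t).c1 -> ct l t = ulo p]].

Lemma costate2_le t : t <= t3 -> L2 t = kap * t - mu1.
Proof. by rewrite /costate2 => ->. Qed.

Lemma costate2_cruise t : t3 < t <= t4 -> L2 t = 0.
Proof. by rewrite /costate2 => /andP[tt ->]; rewrite leNgt tt. Qed.

Lemma costate2_gt t : t4 < t -> L2 t = kap * t - mu2.
Proof.
have [[T10 T12 T23 T34] _] := times => tt.
by rewrite /costate2 leNgt (le_lt_trans T34 tt)/= leNgt tt.
Qed.

Lemma pmp_atI t (dl1 dl2 : R) : is_derive t (1 : R) L1 dl1 ->
  is_derive t (1 : R) L2 dl2 ->
  dl1 = - (L2 t + eta 0 true t - eta 0 false t) ->
  dl2 = - (- kap + eta 1 true t - eta 1 false t) ->
  (forall j s, eta j s t = 0 \/ active p (x t) j s) ->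
  lam0 + L1 t * ct l t + L2 t * (x t).c1 - kap * (x t).c2 = 0 ->
  [/\ L1 t < 0 -> ct l t = K, L1 t = 0 -> ct l t = 0 &
          0 < L1 t -> ct l t = ulo p] -> pmp_at t.
Proof.
move=> d1 d2 E1' E2' ac hm sg.
have F1 : (fun s => (L s).c1) = L1 by apply/funext => s; rewrite mkst1.
have F2 : (fun s => (L s).c2) = L2 by apply/funext => s; rewrite mkst2.
have F3 : (fun s => (L s).c3) = cst (- kap) by apply/funext => s; rewrite mkst3.
split => //.
- split; first by rewrite F3; exact: is_derive_cst.
  apply: I2P; rewrite ?cur0 ?cur1 ?nxt0 ?nxt1.
    by rewrite F1 mkst2 -E1'.
  by rewrite F2 mkst3 -E2'.
- by rewrite mkst1 mkst2 mkst3 mulNr.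
- by rewrite mkst1.
Qed.

Lemma affine_derive (q r t : R) : is_derive t (1 : R) (fun s => q * s - r) q.
Proof. by apply: is_derive_eq; rewrite /GRing.scale /=; ring. Qed.

Lemma quad_derive (f q r t : R) :
  is_derive t (1 : R) (fun s => f - quad q r s) (- (q * t - r)).
Proof. by rewrite /quad; apply: is_derive_eq; rewrite /GRing.scale /=; field. Qed.

Lemma costate2_derive s1 s2 t : s1 < t < s2 -> s2 <= t3 \/ t4 <= s1 ->
  is_derive t (1 : R) L2 kap.
Proof.
move=> st [s3|s4].
  apply: (@is_derive_local _ _ (fun s => kap * s - mu1) s1 s2) => //; last exact: affine_derive.
  by move=> y /andP[_ ys]; rewrite costate2_le// (le_trans (ltW ys)).
apply: (@is_derive_local _ _ (fun s => kap * s - mu2) s1 s2) => //; last exact: affine_derive.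
by move=> y /andP[ys _]; rewrite costate2_gt// (le_lt_trans s4).
Qed.

Lemma eta_off t (s1 s2 : R) : s1 < t < s2 -> s2 <= t1 \/ t2 <= s1 /\ s2 <= t3 \/
   t4 <= s1 /\ s2 <= t5 \/ t6 <= s1 -> forall j s, eta j s t = 0.
Proof.
have [[T10 T12 T23 T34] [T45 T56 T67]] := times => /andP[s1t ts2] h.
move=> j s; rewrite /eta.
have -> : t1 < t < t2 = false by apply/negP => /andP[]; lra.
have -> : t3 < t < t4 = false by apply/negP => /andP[]; lra.
have -> : t5 < t < t6 = false by apply/negP => /andP[]; lra.
by rewrite andbF; case: ifP => _ //; case: ifP.
Qed.

Lemma eta_on t : [/\ t1 < t < t2 -> forall j s,
     eta j s t = if (j == 0) && s then - L2 t else 0,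
   t3 < t < t4 -> forall j s, eta j s t = if (j != 0) && s then kap else 0 &
   t5 < t < t6 -> forall j s, eta j s t = if (j == 0) && ~~ s then L2 t else 0].
Proof.
have [[T10 T12 T23 T34] [T45 T56 T67]] := times.
split=> tt j s; rewrite /eta tt; have /andP[ta tb] := tt.
- have -> : t3 < t < t4 = false by apply/negP => /andP[]; lra.
  have -> : t5 < t < t6 = false by apply/negP => /andP[]; lra.
  by case: (j == 0); case: s.
- have -> : t1 < t < t2 = false by apply/negP => /andP[]; lra.
  have -> : t5 < t < t6 = false by apply/negP => /andP[]; lra.
  by case: (j == 0); case: s.
- have -> : t1 < t < t2 = false by apply/negP => /andP[]; lra.
  have -> : t3 < t < t4 = false by apply/negP => /andP[]; lra.
  by case: (j == 0); case: s.
Qed.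

Section Build.
Hypothesis co : costate_ok.

Lemma pmp_at1 t : 0 < t < t1 -> pmp_at t.
Proof.
move=> tt; have /andP[t0 tt1] := tt.
have [[T10 T12 T23 T34] [T45 T56 T67]] := times.
have eta0 := eta_off tt (or_introl (lexx _)).
have tw : 0 <= t <= t1 by rewrite !ltW.
have [H0 /(_ t tt) sg] := co1 co (lt_trans t0 tt1).
have [x1 x2] := arc1_state tw.
have cl : ct l t = K by rewrite (ctl1 l0) ?t0 ?(ltW tt1).
apply: (pmp_atI (dl1 := - (kap * t - mu1)) (dl2 := kap)).
- apply: (@is_derive_local _ _ (fun s => (e0 + quad kap mu1 t1) - quad kap mu1 s) 0 t1) => //.
    by move=> y /andP[y0 y1]; rewrite (costate1_arc1 hulo huhi ok) ?ltW.
  exact: quad_derive.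
- by apply: (costate2_derive tt); left; lra.
- by rewrite !eta0 costate2_le; lra.
- by rewrite !eta0; lra.
- by left.
- rewrite cl x1 x2 costate2_le; last lra.
  rewrite (costate1_arc1 hulo huhi ok)//; move: H0; rewrite /HL /quad /T2.
  by lra.
- by rewrite cl; split => //; lra.
Qed.

Lemma pmp_at2 t : t1 < t < t2 -> pmp_at t.
Proof.
move=> tt; have /andP[ta tb] := tt.
have [[T10 T12 T23 T34] [T45 T56 T67]] := times.
have [/(_ tt) eta0 _ _] := eta_on t.
have tw : t1 <= t <= t2 by rewrite !ltW.
have [H0 e00 sg] := co2 co (lt_trans ta tb).
have [x1 x2] := arc2_state tw.
have cl : ct l t = 0 by rewrite (ctl2 l0) ?ta ?(ltW tb).
apply: (pmp_atI (dl1 := 0) (dl2 := kap)).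
- apply: (@is_derive_local _ _ (cst e0) t1 t2) => //.
  by move=> y /andP[y0 y1]; rewrite (costate1_arc2 hulo huhi ok) ?ltW.
- by apply: (costate2_derive tt); left; lra.
- by rewrite !eta0/= ; lra.
- by rewrite !eta0/=; lra.
- move=> j s; rewrite eta0; case: ifPn => [/andP[/eqP-> ->]|]; last by left.
  by right; rewrite /active cur0 x1 (hold1 (lt_trans ta tb)).
- rewrite cl x1 x2 costate2_le; last lra.
  by move: H0; rewrite /HL; lra.
- by rewrite cl (costate1_arc2 hulo huhi ok)// e00 ltxx; split.
Qed.

Lemma pmp_at3 t : t2 < t < t3 -> pmp_at t.
Proof.
move=> tt; have /andP[ta tb] := tt.
have [[T10 T12 T23 T34] [T45 T56 T67]] := times.
have eta0 := eta_off tt (or_intror (or_introl (conj (lexx _) (lexx _)))).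
have tw : t2 <= t <= t3 by rewrite !ltW.
have [H0 /(_ t tt) sg] := co3 co (lt_trans ta tb).
have [x1 x2] := arc3_state tw.
have cl : ct l t = ulo p by rewrite (ctl3 l0) ?ta ?(ltW tb).
apply: (pmp_atI (dl1 := - (kap * t - mu1)) (dl2 := kap)).
- apply: (@is_derive_local _ _ (fun s => (e0 + quad kap mu1 t2) - quad kap mu1 s) t2 t3) => //.
    by move=> y /andP[y0 y1]; rewrite (costate1_arc3 hulo huhi ok) ?ltW.
  exact: quad_derive.
- by apply: (costate2_derive tt); left; lra.
- by rewrite !eta0 costate2_le; lra.
- by rewrite !eta0; lra.
- by left.
- rewrite cl x1 x2 costate2_le; last lra.
  rewrite (costate1_arc3 hulo huhi ok)//; move: H0; rewrite /HL /quad.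
  by lra.
- by rewrite cl; split => //; lra.
Qed.

Lemma pmp_at4 t : t3 < t < t4 -> pmp_at t.
Proof.
move=> tt; have /andP[ta tb] := tt.
have [[T10 T12 T23 T34] [T45 T56 T67]] := times.
have [_ /(_ tt) eta0 _] := eta_on t.
have tw : t3 <= t <= t4 by rewrite !ltW.
have c0 : c != 0 by apply/eqP => cE; move: ta tb; rewrite /T4 cE; lra.
have [H0 e00] := co4 co (lt_trans ta tb).
have [x1 x2] := arc4_state c0 tw.
have [_ _ Vh] := cruise (lt_trans ta tb).
have cl : ct l t = 0 by rewrite (ctl4 l0) ?ta ?(ltW tb).
have L20 y : t3 < y < t4 -> L2 y = 0.
  by move=> /andP[y3 y4]; rewrite costate2_cruise// y3 ltW.
apply: (pmp_atI (dl1 := 0) (dl2 := 0)).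
- apply: (@is_derive_local _ _ (cst costate1_mid) t3 t4) => //.
  by move=> y /andP[y0 y1]; rewrite (costate1_arc4 hulo huhi ok) ?ltW.
- by apply: (@is_derive_local _ _ (cst 0) t3 t4).
- by rewrite !eta0/= L20//; lra.
- by rewrite !eta0/=; lra.
- move=> j s; rewrite eta0; case: ifPn => [/andP[j0 ->]|]; last by left.
  by right; move: j0; elim/I2P: j => // _; rewrite /active cur1 x2.
- by rewrite cl x1 x2 L20//; lra.
- by rewrite cl (costate1_arc4 hulo huhi ok)// e00 ltxx; split.
Qed.

Lemma pmp_at5 t : t4 < t < t5 -> pmp_at t.
Proof.
move=> tt; have /andP[ta tb] := tt.
have [[T10 T12 T23 T34] [T45 T56 T67]] := times.
have eta0 := eta_off tt (or_intror (or_intror (or_introl (conj (lexx _) (lexx _))))).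
have tw : t4 <= t <= t5 by rewrite !ltW.
have [H0 /(_ t tt) sg] := co5 co (lt_trans ta tb).
have [c0 t5E] := mid5_cruise (lt_trans ta tb).
have [x1 x2] := arc5_state c0 tw.
have cl : ct l t = ulo p by rewrite (ctl5 l0) ?ta ?(ltW tb).
apply: (pmp_atI (dl1 := - (kap * t - mu2)) (dl2 := kap)).
- apply: (@is_derive_local _ _ (fun s => (costate1_mid + quad kap mu2 t4) - quad kap mu2 s) t4 t5) => //.
    by move=> y /andP[y0 y1]; rewrite (costate1_arc5 hulo huhi ok) ?ltW.
  exact: quad_derive.
- by apply: (costate2_derive tt); right.
- by rewrite !eta0 costate2_gt//; lra.
- by rewrite !eta0; lra.
- by left.
- rewrite cl x1 x2 costate2_gt//.
  rewrite (costate1_arc5 hulo huhi ok)//; move: H0; rewrite /HR /costate1_end /quad t5E.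
  (* With [z = Q n] the length of the arc, [n Q^2 = m z^2]; this removes the inverse [n] from the
     identity. *)
  have : Q = m * (Q * n) by rewrite mulrCA mn mulr1.
  move: (Q * n) => z zE.
  have -> : n * Q ^+ 2 = m * z ^+ 2 by rewrite {1}zE exprMn; field; exact: u0.
  by rewrite zE; lra.
- by rewrite cl; split => //; lra.
Qed.

Lemma pmp_at6 t : t5 < t < t6 -> pmp_at t.
Proof.
move=> tt; have /andP[ta tb] := tt.
have [[T10 T12 T23 T34] [T45 T56 T67]] := times.
have [_ _ /(_ tt) eta0] := eta_on t.
have tw : t5 <= t <= t6 by rewrite !ltW.
have [H0 e00 sg] := co6 co (lt_trans ta tb).
have [x1 x2] := arc6_state tw.
have cl : ct l t = 0 by rewrite (ctl6 l0) ?ta ?(ltW tb).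
have L2E : L2 t = kap * t - mu2 by rewrite costate2_gt//; lra.
apply: (pmp_atI (dl1 := 0) (dl2 := kap)).
- apply: (@is_derive_local _ _ (cst costate1_end) t5 t6) => //.
  by move=> y /andP[y0 y1]; rewrite (costate1_arc6 hulo huhi ok) ?ltW.
- by apply: (costate2_derive tt); right.
- by rewrite !eta0/=; lra.
- by rewrite !eta0/=; lra.
- move=> j s; rewrite eta0; case: ifPn => [/andP[/eqP-> /negbTE->]|]; last by left.
  by right; rewrite /active cur0 x1 EFinN (hold2 (lt_trans ta tb)) oppeK.
- by rewrite cl x1 x2 L2E; move: H0; rewrite /HR; lra.
- by rewrite cl (costate1_arc6 hulo huhi ok)// e00 ltxx; split.
Qed.

Lemma pmp_at7 t : t6 < t < t7 -> pmp_at t.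
Proof.
move=> tt; have /andP[ta tb] := tt.
have [[T10 T12 T23 T34] [T45 T56 T67]] := times.
have eta0 := eta_off tt (or_intror (or_intror (or_intror (lexx _)))).
have tw : t6 <= t <= t7 by rewrite !ltW.
have [H0 /(_ t tt) sg] := co7 co (lt_trans ta tb).
have [x1 x2] := arc7_state tw.
have cl : ct l t = K by rewrite (ctl7 l0) ?ta ?(ltW tb).
have L2E : L2 t = kap * t - mu2 by rewrite costate2_gt//; lra.
apply: (pmp_atI (dl1 := - (kap * t - mu2)) (dl2 := kap)).
- apply: (@is_derive_local _ _ (fun s => (costate1_end + quad kap mu2 t6) - quad kap mu2 s) t6 t7) => //.
    by move=> y /andP[y0 y1]; rewrite (costate1_arc7 hulo huhi ok) ?ltW.
  exact: quad_derive.
- by apply: (costate2_derive tt); right; lra.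
- by rewrite !eta0 L2E//; lra.
- by rewrite !eta0; lra.
- by left.
- rewrite cl x1 x2 L2E (costate1_arc7 hulo huhi ok)//; move: H0.
  rewrite /HR /quad /T6; lra.
- by rewrite cl; split => //; lra.
Qed.

Lemma pmp_at_ae t : t \notin [:: 0; t1; t2; t3; t4; t5; t6; t7] ->
  0 <= t <= t7 -> pmp_at t.
Proof.
rewrite !inE !negb_or => /and4P[n0' n1 n2 /and5P[n3 n4 n5 n6 n7]] /andP[ta tb].
have {}ta : 0 < t by rewrite lt_def n0'.
have [h|h] := ltP t t1; first by apply: pmp_at1; rewrite ta.
have {}h : t1 < t by rewrite lt_def n1.
have [h'|h'] := ltP t t2; first by apply: pmp_at2; rewrite h.
have {h}h : t2 < t by rewrite lt_def n2.
have [h''|h''] := ltP t t3; first by apply: pmp_at3; rewrite h.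
have {h h'}h : t3 < t by rewrite lt_def n3.
have [h'|h'] := ltP t t4; first by apply: pmp_at4; rewrite h.
have {h h''}h : t4 < t by rewrite lt_def n4.
have [h''|h''] := ltP t t5; first by apply: pmp_at5; rewrite h.
have {h h'}h : t5 < t by rewrite lt_def n5.
have [h'|h'] := ltP t t6; first by apply: pmp_at6; rewrite h.
have {h h''}h : t6 < t by rewrite lt_def n6.
by apply: pmp_at7; rewrite h lt_neqAle n7.
Qed.

End Build.
End Multipliers.

(** * Jumps, junctions and the full maximum principle *)

Section Assembly.
Variables (R : realType) (p : bounds R) (x0 xf : state R).
Hypotheses (hulo : ulo p < 0) (huhi : 0 < uhi p).
Hypothesis hxlo : forall k : 'I_2, (xlo p k < 0)%E.
Hypothesis hxhi : forall k : 'I_2, (0 < xhi p k)%E.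
Hypotheses (wx0 : within p x0) (wxf : within p xf).
Implicit Types (P d Q e c : R).

Local Notation k := ((uhi p)^-1).
Local Notation n := ((- ulo p)^-1).
Local Notation h2 := (xhi p 1).
Local Notation a := (x0.c1).
Local Notation v := (x0.c2).

Let m0 : - ulo p != 0. Proof. by rewrite lt0r_neq0// oppr_gt0. Qed.
Let u0 : ulo p != 0. Proof. by rewrite ltr0_neq0. Qed.
Let mn : - ulo p * n = 1. Proof. exact: mulfV. Qed.

Variables (P d Q e c : R).
Hypothesis ok : hi_ok p x0 xf P d Q e c.
Variables (kap mu1 mu2 e0 lam0 : R).
Local Notation V := (vel k n a v P d).
Local Notation t1 := (T1 p x0 P).
Local Notation t2 := (T2 p x0 P d).
Local Notation t3 := (T3 p x0 P d Q c).
Local Notation t4 := (T4 p x0 P d Q c).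
Local Notation t5 := (T5 p x0 P d Q c).
Local Notation t6 := (T6 p x0 P d Q e c).
Local Notation t7 := (T7 p x0 xf P d Q e c).
Local Notation l := (hi_arcs p x0 xf P d Q e c).

Local Notation m := (- ulo p).
Local Notation x := (st x0 l).
Let l0 : durs_ge0 l. Proof. by have h := hi_durs hulo huhi ok. Qed.
Let times := hi_arcs_times l0.
Local Notation L1 := (costate1 p x0 xf P d Q e c kap mu1 mu2 e0).
Local Notation L2 := (costate2 p x0 P d Q c kap mu1 mu2).
Local Notation L := (costate p x0 xf P d Q e c kap mu1 mu2 e0).
Hypothesis co : costate_ok p x0 xf P d Q e c kap mu1 mu2 e0 lam0.
Local Notation eta := (eta p x0 P d Q e c kap mu1 mu2).

(** A cruise that begins at time 0 or ends at [t7] has no junction there, hence the filter. *)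
Definition jumps := if c == 0 then [::] else [seq t <- [:: t3; t4] | 0 < t < t7].
Definition zeta (j : 'I_2) (s : bool) t : R :=
  if [&& j != 0, s & t \in jumps] then
    if t == t3 then - (kap * t3 - mu1) else kap * t4 - mu2
  else 0.

Lemma closure_left (A : set R) (s t : R) : s < t -> (forall r, s < r < t -> A r) ->
  closure A t.
Proof.
move=> st h B /= nB; near (t^'-) => r; exists r; split.
  by apply: h; apply/andP; split; near: r; [exact: nbhs_left_gt|exact: nbhs_left_lt].
by near: r; exact: cvg_within.
Unshelve. all: by end_near. Qed.

Lemma closure_right (A : set R) (s t : R) : t < s -> (forall r, t < r < s -> A r) ->
  closure A t.
Proof.
move=> st h B /= nB; near (t^'+) => r; exists r; split.
  by apply: h; apply/andP; split; near: r; [exact: nbhs_right_gt|exact: nbhs_right_lt].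
by near: r; exact: cvg_within.
Unshelve. all: by end_near. Qed.

Lemma eta_ge0 j s t : 0 <= eta j s t.
Proof.
have [[T10 T12 T23 T34] [T45 T56 T67]] := times.
have kap0 := co_kap co; rewrite /eta; case: ifP => _; case: s => //=.
- case: ifPn => // /andP[ta tb]; have [_ _ h] := co2 co (lt_trans ta tb).
  rewrite costate2_le; last lra.
  have : kap * t <= kap * t2 by rewrite ler_wpM2l// ltW.
  lra.
- case: ifPn => // /andP[ta tb]; have [_ _ h] := co6 co (lt_trans ta tb).
  rewrite (costate2_gt hulo huhi ok); last lra.
  have : kap * t5 <= kap * t by rewrite ler_wpM2l// ltW.
  lra.
- by case: ifP.
Qed.

Lemma eta_infinite j t : (xhi p j = +oo%E -> eta j true t = 0) /\
  (xlo p j = -oo%E -> eta j false t = 0).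
Proof.
rewrite /eta; elim/I2P: j => /=; split => // inf; case: ifPn => // /andP[ta tb].
- by have := hold1 ok (lt_trans ta tb); rewrite inf.
- by have := hold2 ok (lt_trans ta tb); rewrite inf.
- by have [_ _] := cruise ok (lt_trans ta tb); rewrite inf.
Qed.

Lemma jumpsP t : t \in jumps -> [/\ c != 0, 0 < t < t7 & t = t3 \/ t = t4].
Proof.
rewrite /jumps; case: ifPn => // c0; rewrite mem_filter !inE => /andP[h].
by case/orP => /eqP tE; split => //; [left|right].
Qed.

Lemma mem_jumps t : c != 0 -> 0 < t < t7 -> t = t3 \/ t = t4 -> t \in jumps.
Proof.
by move=> c0 tt h; rewrite /jumps (negbTE c0) mem_filter tt !inE; case: h => ->;
  rewrite eqxx ?orbT.
Qed.

Let co_c : c != 0 -> [/\ 0 < c, 0 < kap, t2 = t3 -> t3 = 0 & t4 = t5 -> t4 = t7] /\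
      [/\ kap * t3 - mu1 = kap * (t3 - t2) / 2 & kap * t4 - mu2 = - (kap * (t5 - t4) / 2)].
Proof. by move=> c0; case: (co_cruise co) => // -[cE]; rewrite cE eqxx in c0. Qed.

(** At time distance [z] from the cruise, on the adjacent [lo0] arcs, [x_2 = V - m z^2 / 2]; so the
    bound is active on the cruise and inactive right outside. By [co_cruise] the [lo0] arc next to a
    jump time is nonempty. *)
Lemma junction_jumps t : t \in jumps -> junction p t7 x 1 true t.
Proof.
have [[T10 T12 T23 T34] [T45 T56 T67]] := times.
move=> /jumpsP[c0 tt h]; have [[c_gt0 kap0 h3 h4] _] := co_c c0.
have lt34 : t3 < t4 by rewrite /T4 ltrDl.
have [_ _ Vh] := cruise ok lt34.
have m0' : 0 < m by rewrite oppr_gt0.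
have act s : t3 <= s <= t4 -> active p (x s) 1 true.
  by move=> /(arc4_state hulo huhi ok c0)[_ x2]; rewrite /active cur1 x2.
have inact s : (t2 < s < t3) || (t4 < s < t5) -> ~ active p (x s) 1 true.
  move=> hs; have E z : 0 < z -> (x s).c2 = V - m * z ^+ 2 / 2 -> ~ active p (x s) 1 true.
    move=> z0 x2; rewrite /active cur1 x2 -Vh => -[].
    have : 0 < m * z ^+ 2 by rewrite mulr_gt0// exprn_gt0.
    lra.
  case/orP : hs => /andP[sa sb].
    have sw : t2 <= s <= t3 by rewrite !ltW.
    have [_ x2] := arc3_state hulo huhi ok sw.
    apply: (E (t3 - s)); first lra.
    rewrite x2 /T3 /mid3 (negbTE c0); have := mulrCA m P n; rewrite mn mulr1.
    move: (P * n) => z zE; have -> : n * P ^+ 2 = m * z ^+ 2.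
      by rewrite -zE exprMn; field; exact: u0.
    by rewrite -zE; move: (vel _ _ _ _ _ _) (T2 _ _ _ _) => v1 tt2; field.
  have sw : t4 <= s <= t5 by rewrite !ltW.
  have [_ x2] := arc5_state hulo huhi ok c0 sw.
  by apply: (E (s - t4)) => //; lra.
have /andP[t_gt0 t_lt7] := tt.
split => //.
- apply: subset_closure; split; first by rewrite in_itv/= !ltW.
  by apply: act; case: h => ->; rewrite ?lexx ?T34.
- case: h => tE.
    have lt23 : t2 < t3.
      rewrite lt_neqAle T23 andbT; apply/eqP => /h3 t30.
      by move: t_gt0; rewrite tE t30 ltxx.
    rewrite tE; apply: (@closure_left _ t2) => // r rr; split; last by apply: inact; rewrite rr.
    by have /andP[ra rb] := rr; rewrite in_itv/=; apply/andP; split; lra.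
  have lt45 : t4 < t5.
    rewrite lt_neqAle T45 andbT; apply/eqP => /h4 t47.
    by move: t_lt7; rewrite tE t47 ltxx.
  rewrite tE; apply: (@closure_right _ t5) => // r rr; split; last by apply: inact; rewrite rr orbT.
  by have /andP[ra rb] := rr; rewrite in_itv/=; apply/andP; split; lra.
Qed.

Lemma costate_abs_continuous (r s : R) : 0 <= r -> r < s -> s <= t7 ->
  (forall t, t \in jumps -> ~~ (r < t < s)) ->
  exists2 nu : R -> state R,
       forall i : 'I_3, abs_continuous r s (fun t => nu t 0 i) &
       forall t, t \in `[r, s] -> t \notin jumps -> L t = nu t.
Proof.
have [[T10 T12 T23 T34] [T45 T56 T67]] := times.
move=> rge0 rs s7 nj.
suff [q [z h]] : exists q z, forall t, r <= t <= s -> t \notin jumps -> L2 t = q * t + z.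
  exists (fun t => mkst (L1 t) (q * t + z) (- kap)); last first.
    by move=> t tt nt; rewrite /costate (h t)//; move: tt; rewrite in_itv.
  have [C C0 Clip] := costate1_lipschitz hulo huhi ok kap mu1 mu2 e0.
  apply: I3P.
  - apply: (lipschitz_abs_continuous C0) => t t' _ tt _.
    by rewrite !mkst1; exact: Clip.
  - apply: (@lipschitz_abs_continuous _ _ _ `|q|) => // t t' _ tt _.
    rewrite !mkst2 (_ : _ - _ = q * (t' - t)); last by ring.
    by rewrite normrM [`|t' - t|]ger0_norm// subr_ge0.
  - apply: (@lipschitz_abs_continuous _ _ _ 0) => // t t' _ tt _.
    by rewrite !mkst3 subrr normr0 mul0r.
case: (co_cruise co) => [[c0 muE]|[[c_gt0 kap0 h3 h4] [j3 j4]]].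
  exists kap, (- mu1) => t _ _; rewrite /costate2 /T4 c0 addr0 muE.
  by case: ifP => // ->.
have c0 : c != 0 by rewrite gt_eqF.
have lt34 : t3 < t4 by rewrite /T4 ltrDl.
have [s3|s3] := leP s t3.
  by exists kap, (- mu1) => t /andP[_ ts] _; rewrite costate2_le// (le_trans ts).
have [r4|r4] := leP t4 r.
  exists kap, (- mu2) => t /andP[rt ts] ntj; rewrite (costate2_gt hulo huhi ok)//.
  rewrite lt_def (le_trans r4 rt) andbT; apply: contraNneq ntj => tE.
  by apply: mem_jumps => //; [lra|right].
have nr3 : t3 <= r.
  rewrite leNgt; apply/negP => r3; have := nj t3 _; rewrite r3 s3 => /(_ _)/wrap[|//].
  by apply: mem_jumps => //; [lra|left].
have s4 : s <= t4.
  rewrite leNgt; apply/negP => s4; have := nj t4 _; rewrite r4 s4 => /(_ _)/wrap[|//].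
  by apply: mem_jumps => //; [lra|right].
exists 0, 0 => t /andP[rt ts] ntj; rewrite mul0r addr0.
have [t3t|t3t] := ltP t3 t; first by rewrite costate2_cruise// t3t (le_trans ts).
have tE : t = t3 by apply/eqP; rewrite eq_le t3t (le_trans nr3 rt).
(* At [t3] itself [costate2] takes its left branch. If [t3] is not a jump time it is 0, and the left
   branch then has the value 0 of the cruise. *)
have t30 : t3 = 0.
  apply/eqP/negPn; apply/negP => n3; move/negP: ntj; apply; apply: mem_jumps => //; last by left.
  by rewrite tE lt_def n3 /=; lra.
rewrite tE costate2_le// j3; have -> : t3 - t2 = 0 by lra.
by rewrite mulr0 mul0r.
Qed.

Lemma costate2_limits t : 0 < t < t7 -> exists y z : R,
  [/\ L2 s @[s --> t^'-] --> y, L2 s @[s --> t^'+] --> z & z - y = zeta 1 true t].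
Proof.
have [[T10 T12 T23 T34] [T45 T56 T67]] := times => tt.
have aff (q z : R) : (fun s : R => q * s - z) @ t --> q * t - z.
  exact: (is_derive_cts (affine_derive q z t)).
have left r (q z : R) : r < t -> (forall s, r < s < t -> L2 s = q * s - z) ->
    L2 s @[s --> t^'-] --> q * t - z.
  move=> rt h; apply: (@cvg_trans _ ((fun s : R => q * s - z) @ t^'-)); last first.
    by apply: cvg_at_left_filter; exact: aff.
  apply: near_eq_cvg; near=> s; apply/esym/h; apply/andP; split; near: s.
    exact: nbhs_left_gt.
  exact: nbhs_left_lt.
have right r (q z : R) : t < r -> (forall s, t < s < r -> L2 s = q * s - z) ->
    L2 s @[s --> t^'+] --> q * t - z.
  move=> rt h; apply: (@cvg_trans _ ((fun s : R => q * s - z) @ t^'+)); last first.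
    by apply: cvg_at_right_filter; exact: aff.
  apply: near_eq_cvg; near=> s; apply/esym/h; apply/andP; split; near: s.
    exact: nbhs_right_gt.
  exact: nbhs_right_lt.
have zeta0 : t \notin jumps -> zeta 1 true t = 0 by rewrite /zeta => /negbTE ->.
case: (co_cruise co) => [[c0 muE]|[[c_gt0 kap0 h3 h4] [j3 j4]]].
  have E s : L2 s = kap * s - mu1 by rewrite /costate2 /T4 c0 addr0 muE; case: ifP => // ->.
  exists (kap * t - mu1), (kap * t - mu1); split.
  - by apply: (left (t - 1)) => [|? _]; rewrite ?E//; lra.
  - by apply: (right (t + 1)) => [|? _]; rewrite ?E//; lra.
  - by rewrite subrr zeta0// /jumps c0 eqxx.
have c0 : c != 0 by rewrite gt_eqF.
have lt34 : t3 < t4 by rewrite /T4 ltrDl.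
have nj : t != t3 -> t != t4 -> zeta 1 true t = 0.
  move=> n3 n4; apply: zeta0; apply/negP => /jumpsP[_ _ []] tE.
    by rewrite tE eqxx in n3.
  by rewrite tE eqxx in n4.
have [t3t|t3t|t3t] := ltgtP t t3.
- exists (kap * t - mu1), (kap * t - mu1); split.
  + by apply: (left (t - 1)) => [|s /andP[_ st]]; rewrite ?costate2_le//; lra.
  + by apply: (right t3) => // s /andP[_ st]; rewrite costate2_le// ltW.
  + rewrite subrr nj//; by apply/eqP; lra.
- have [t4t|t4t|t4t] := ltgtP t t4.
  + exists (0 * t - 0), (0 * t - 0); split.
    * apply: (left t3) => // s /andP[s3 st]; rewrite costate2_cruise ?s3; first lra.
      by lra.
    * apply: (right t4) => // s /andP[s3 st]; rewrite costate2_cruise; first lra.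
      by apply/andP; lra.
    * rewrite subrr nj//; by apply/eqP; lra.
  + exists (kap * t - mu2), (kap * t - mu2); split.
    * by apply: (left t4) => // s /andP[s3 st]; rewrite (costate2_gt hulo huhi ok).
    * apply: (right (t + 1)) => [|s /andP[s3 st]]; first lra.
      by rewrite (costate2_gt hulo huhi ok)//; lra.
    * rewrite subrr nj//; by apply/eqP; lra.
  + exists (0 * t - 0), (kap * t - mu2); split.
    * apply: (left t3) => // s /andP[s3 st]; rewrite costate2_cruise ?s3; first lra.
      by lra.
    * apply: (right (t + 1)) => [|s /andP[s3 st]]; first lra.
      by rewrite (costate2_gt hulo huhi ok)//; lra.
    * rewrite mul0r subr0 subr0 /zeta mem_jumps//=; last by right.
      by rewrite gt_eqF// t4t.
- exists (kap * t - mu1), (0 * t - 0); split.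
  + by apply: (left (t - 1)) => [|s /andP[_ st]]; rewrite ?costate2_le//; lra.
  + apply: (right t4) => [|s /andP[s3 st]]; first lra.
    by rewrite costate2_cruise; lra.
  + rewrite mul0r subr0 sub0r /zeta mem_jumps//=; last by left.
    by rewrite t3t eqxx.
Unshelve. all: by end_near. Qed.

Lemma pmp_of_costate : pmp p t7 x (ct l).
Proof.
have [[T10 T12 T23 T34] [T45 T56 T67]] := times.
have zeta_jump j s t : ~ junction p t7 x j s t -> zeta j s t = 0.
  rewrite /zeta; case: ifPn => // /and3P[j0 ss tj] nj; exfalso; apply: nj.
  by move: j0 ss; elim/I2P: j => // _; case: s => // _; exact: junction_jumps.
have ae (X : R -> Prop) : (forall t, pmp_at p x0 xf P d Q e c kap mu1 mu2 e0 lam0 t -> X t) ->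
    {ae @lebesgue_measure R, forall t, t \in `[0, t7] -> X t}.
  move=> h; apply: (@ae_off_seq _ [:: 0; t1; t2; t3; t4; t5; t6; t7]) => t nt; rewrite in_itv => tt; apply: h.
  by have h2 := pmp_at_ae hulo huhi ok co; exact: h2 nt tt.
exists lam0, L, eta, zeta, jumps.
refine (conj (conj (co_lam0 co) (fun j s t _ => eta_ge0 j s t)) _).
refine (conj (fun j t _ => eta_infinite j t) _).
refine (conj _ (conj costate_abs_continuous (conj _ (conj _ (conj _ (conj _
  (conj _ (conj _ _)))))))).
- by move=> t /junction_jumps tj; exists 1, true.
- by apply: ae => t [].
- by apply: ae => t [].
- by apply: ae => t [].
- by apply: ae => t [].
- move=> j s t; split; last exact: zeta_jump.
  rewrite /zeta; case: ifPn => // /and3P[_ _ /jumpsP[c0 _ tE]].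
  have [[c_gt0 kap0 h3 h4] [j3 j4]] := co_c c0.
  have := mulr_ge0 (ltW kap0) (_ : 0 <= t3 - t2); rewrite subr_ge0 => /(_ T23) ?.
  have := mulr_ge0 (ltW kap0) (_ : 0 <= t5 - t4); rewrite subr_ge0 => /(_ T45) ?.
  case: ifP => _; lra.
- move=> t tt; have [y [z [yl zr zy]]] := costate2_limits tt.
  have c1 : {for t, continuous L1} by exact: costate1_cts.
  exists (mkst (L1 t) y (- kap)), (mkst (L1 t) z (- kap)); split.
  + by apply: mkst_cvg => //; [exact: cvg_at_left_filter|exact: cvg_cst].
  + by apply: mkst_cvg => //; [exact: cvg_at_right_filter|exact: cvg_cst].
  + rewrite big_ord_recl big_ord1 !big_bool.
    have -> : lift ord0 ord0 = 1 :> 'I_2 by exact/val_inj.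
    have -> : ord0 = 0 :> 'I_2 by exact/val_inj.
    rewrite /grad cur0 cur1 -zy /zeta/=.
    by apply: stP; rewrite !mxE/=; ring.
- move=> t; rewrite in_itv/= => tt; right; left; case: (co_nontrivial co) => [kn|]; last exact.
  by apply/eqP => /(congr1 (fun z : state R => z.c3)); rewrite mkst3 mxE => /eqP; rewrite oppr_eq0; apply/negP.
Qed.

End Assembly.

(** * Costates of the extremal laws *)

Section ExtremalCostate.
Variables (R : realType) (p : bounds R) (x0 xf : state R).
Hypotheses (hulo : ulo p < 0) (huhi : 0 < uhi p).
Hypothesis hxlo : forall k : 'I_2, (xlo p k < 0)%E.
Hypothesis hxhi : forall k : 'I_2, (0 < xhi p k)%E.
Hypotheses (wx0 : within p x0) (wxf : within p xf).
Implicit Types (P d Q e c : R).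

Local Notation K := (uhi p).
Local Notation k := ((uhi p)^-1).
Local Notation n := ((- ulo p)^-1).
Local Notation l1 := (xlo p 0).
Local Notation h1 := (xhi p 0).
Local Notation a := (x0.c1).
Local Notation v := (x0.c2).
Local Notation b := (- xf.c1).
Local Notation w := (xf.c2).

Let u0 : ulo p != 0. Proof. by rewrite ltr0_neq0. Qed.
Let m0 : - ulo p != 0. Proof. by rewrite lt0r_neq0// oppr_gt0. Qed.
Let k_gt0 : 0 < k := kgt0 huhi.
Let n_gt0 : 0 < n := ngt0 hulo.
Let mn : - ulo p * n = 1. Proof. exact: mulfV. Qed.

Variables (P d Q e c : R).
Hypothesis ok : hi_ok p x0 xf P d Q e c.
Local Notation V := (vel k n a v P d).
Local Notation t1 := (T1 p x0 P).
Local Notation t2 := (T2 p x0 P d).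
Local Notation t3 := (T3 p x0 P d Q c).
Local Notation t4 := (T4 p x0 P d Q c).
Local Notation t5 := (T5 p x0 P d Q c).
Local Notation t6 := (T6 p x0 P d Q e c).
Local Notation t7 := (T7 p x0 xf P d Q e c).
Local Notation l := (hi_arcs p x0 xf P d Q e c).

Local Notation m := (- ulo p).
Local Notation x := (st x0 l).
Let l0 : durs_ge0 l. Proof. by have h := hi_durs hulo huhi ok. Qed.
Let times := hi_arcs_times l0.
Let VW : V = vel k n b w Q e. Proof. by case: ok => _ []. Qed.
Local Notation co_ok := (costate_ok p x0 xf P d Q e c).

Lemma quadB (mu s t : R) : quad 1 mu s - quad 1 mu t = (t - s) * (mu - (s + t) / 2).
Proof. by rewrite /quad; field. Qed.

(** The first costate has to vanish at both ends of a [lo0] arc and be positive inside. As it is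
    quadratic there with leading coefficient [- kap / 2], the constants [mu1] and [mu2] must be the
    midpoints of the arcs. The last two hypotheses make the Hamiltonian vanish on the two sides. *)
Lemma regular_ok (mu1 mu2 lam0 : R) : 0 <= lam0 ->
  (c != 0 -> [/\ lam0 = V, t2 = t3 -> t3 = 0 & t4 = t5 -> t4 = t7]) ->
  mu1 = (t2 + t3) / 2 -> mu2 = (if c == 0 then mu1 else (t4 + t5) / 2) ->
  lam0 + (t2 - mu1) * P - (V - n * P ^+ 2 / 2) = 0 ->
  lam0 - (t5 - mu2) * Q - (V - n * Q ^+ 2 / 2) = 0 ->
  co_ok 1 mu1 mu2 0 lam0.
Proof.
have [[T10 T12 T23 T34] [T45 T56 T67]] := times => lam_ge0 hc mu1E mu2E HL HR.
have E3 : costate1_mid p x0 P d Q c 1 mu1 0 = 0.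
  by rewrite /costate1_mid add0r quadB mu1E subrr mulr0.
have E5 : costate1_end p x0 P d Q c 1 mu1 mu2 0 = 0.
  rewrite /costate1_end E3 add0r quadB mu2E; case: ifPn => [/eqP c0|_]; last by rewrite subrr mulr0.
  by rewrite /T5 /mid5 c0 eqxx addr0 subrr mul0r.
have t6mu : mu2 <= t5 by rewrite mu2E; case: ifPn => _; lra.
have ok' := ok.
split => //.
- by left; exact: oner_neq0.
- have [c0|c0] := eqVneq c 0; first by left; rewrite mu2E c0 eqxx.
  have [_ h3 h4] := hc c0; right; split; last first.
    by rewrite mu2E (negbTE c0) mu1E; split; field.
  have c_ge0 : 0 <= c by case: ok'.
  by split => //; rewrite lt_def c0.
- move=> _; split; first by lra.
  move=> t /andP[ta tb]; rewrite (costate1_arc1 hulo huhi ok) ?ltW// add0r quadB.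
  by rewrite nmulr_rlt0; lra.
- by move=> _; split; lra.
- move=> _; split; first by lra.
  move=> t /andP[ta tb]; rewrite (costate1_arc3 hulo huhi ok) ?ltW// add0r quadB.
  by rewrite mulr_gt0; lra.
- move=> t34; have c0 : c != 0 by apply/eqP => cE; move: t34; rewrite /T4 cE; lra.
  by have [-> _ _] := hc c0; rewrite mul1r.
- move=> t45; split; first by rewrite E5; lra.
  move=> t /andP[ta tb]; rewrite (costate1_arc5 hulo huhi ok) ?ltW// E3 add0r quadB.
  have [c0 _] := mid5_cruise t45.
  by rewrite mulr_gt0 ?mu2E ?(negbTE c0); lra.
- by move=> _; split; lra.
- move=> _; split; first by rewrite E5; lra.
  move=> t /andP[ta tb]; rewrite (costate1_arc7 hulo huhi ok) ?ltW// E5 add0r quadB.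
  by rewrite pmulr_rlt0; lra.
Qed.

Let mid3E : t3 - t2 = if c == 0 then (P + Q) * n else P * n.
Proof. by rewrite /T3 /mid3 addrAC subrr add0r. Qed.
Let mid5E : t5 - t4 = if c == 0 then 0 else Q * n.
Proof. by rewrite /T5 /mid5 addrAC subrr add0r. Qed.

Lemma generic_costate : c = 0 -> 0 <= V + n * P * Q / 2 ->
  co_ok 1 ((t2 + t3) / 2) ((t2 + t3) / 2) 0 (V + n * P * Q / 2).
Proof.
move=> c0 q0; have m3 := mid3E; have m5 := mid5E; rewrite c0 eqxx in m3 m5.
have t43 : t4 = t3 by rewrite /T4 c0 addr0.
rewrite c0 in t43.
apply: regular_ok => //; rewrite ?c0 ?eqxx//.
- have -> : T2 p x0 P d - (T2 p x0 P d + T3 p x0 P d Q 0) / 2 = - ((P + Q) * n) / 2 by lra.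
  by field.
- have -> : T5 p x0 P d Q 0 - (T2 p x0 P d + T3 p x0 P d Q 0) / 2 = ((P + Q) * n) / 2 by lra.
  by field.
Qed.

Lemma cruise_costate : 0 < c ->
  co_ok 1 ((t2 + t3) / 2) ((t4 + t5) / 2) 0 V.
Proof.
move=> c_gt0; have m3 := mid3E; have m5 := mid5E; have c0 : c != 0 by rewrite gt_eqF.
rewrite (negbTE c0) in m3 m5.
have lt34 : t3 < t4 by rewrite /T4 ltrDl.
have [P0 Q0 Vh] := cruise ok lt34.
have V0 : 0 < V by rewrite -lte_fin Vh.
have k0' := k_gt0; have n0' := n_gt0; have n1 : n != 0 by rewrite gt_eqF.
have [_ /andP[_ vh]] := (proj1 (withinE p x0)) wx0.
have [_ /andP[_ wh]] := (proj1 (withinE p xf)) wxf.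
rewrite -Vh !lee_fin in vh wh.
(* If the third arc is empty, then [P = 0], [d = 0] and [V = v - k a^2 / 2] with [v <= h2 = V];
   hence [a = 0] and the cruise begins at time 0. The other end is symmetric. *)
have rest (y z : R) : z <= z - k * y ^+ 2 / 2 -> y = 0.
  move=> yz; have : k * y ^+ 2 <= 0 by lra.
  by rewrite pmulr_rle0// => y0; apply/eqP; rewrite -sqrf_eq0 eq_le y0 sqr_ge0.
have [[[_ _ dh _ _] [_ _ eh _ _]] _ _ _ _] := ok.
have lP : P%:E = h1 -> 0 < P by rewrite -lte_fin => ->; exact: hxhi.
have lQ : Q%:E = (- l1)%E -> 0 < Q by rewrite -lte_fin => ->; rewrite oppe_gt0; exact: hxlo.
apply: regular_ok; rewrite ?(negbTE c0)//.
- exact: ltW.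
- move=> _; split => //.
  + move=> t23; have : P * n = 0 by lra.
    move=> /eqP; rewrite mulf_eq0 (negbTE n1) orbF => /eqP PE.
    have dE : d = 0 by case: dh => // /lP; lra.
    have aE : a = 0 by apply: (rest _ v); move: vh; rewrite /vel PE dE; lra.
    have t20 : t2 = 0 by rewrite /T2 /T1 aE PE dE; ring.
    by rewrite -t23 t20.
  + move=> t45; have : Q * n = 0 by lra.
    move=> /eqP; rewrite mulf_eq0 (negbTE n1) orbF => /eqP QE.
    have eE : e = 0 by case: eh => // /lQ; lra.
    have bE : b = 0 by apply: (rest _ w); move: wh; rewrite VW /vel QE eE; lra.
    by rewrite /T7 /T6 t45 (_ : Q - b = 0) ?mul0r; lra.
- have -> : t2 - (t2 + t3) / 2 = - (P * n) / 2 by lra.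
  by field.
- have -> : t5 - (t4 + t5) / 2 = (Q * n) / 2 by lra.
  by field.
Qed.

Lemma extremal_pmp : multiplier_ok p x0 xf P d Q e c -> pmp p t7 x (ct l).
Proof.
have [[T10 T12 T23 T34] [T45 T56 T67]] := times.
have [c_gt0|c0] : 0 < c \/ c = 0.
  by case: ok => _ _; rewrite le_eqVlt => /predU1P[->|]; [right|left].
  by move=> _; exact: (pmp_of_costate hulo huhi ok (cruise_costate c_gt0)).
have m3 : t3 - t2 = (P + Q) * n by rewrite mid3E c0 eqxx.
have m5 : t5 - t4 = 0 by rewrite mid5E c0 eqxx.
have t43 : t4 = t3 by rewrite /T4 c0 addr0.
have n0' := n_gt0.
have m_gt0 : 0 < m by rewrite oppr_gt0.
have ok' := ok; have K_gt0 := huhi.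
case => [|[Qb e0 P0]|[Pa d0 Q0]|[[PQ d0 e0]|q0]]; first by rewrite c0 ltxx.
(* The second half is empty. The costate ignores [x_3]: its second component is [-1], and the first
   one increases with slope 1 through 0 at the switch to [lo0]. *)
- have t67 : t7 = t3 by rewrite /T7 /T6 e0 (_ : Q - b = 0) ?mul0r; lra.
  have L2E (t : R) : costate2 p x0 P d Q c 0 1 1 t != 0.
    rewrite /costate2 t43; case: leP => _ //; rewrite mul0r sub0r oppr_eq0; exact: oner_neq0.
  apply: (pmp_of_costate hulo huhi ok (kap := 0) (mu1 := 1) (mu2 := 1) (e0 := 0) (lam0 := P)).
  split => //; rewrite ?mul0r ?mul1r ?subr0 ?addr0.
  + right => t _; apply/negP => /eqP/(congr1 (fun z : state R => z.c2)).
    by rewrite mkst2 mxE; apply/eqP.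
  + by left.
  + move=> _; split; first by lra.
    move=> t /andP[ta tb]; rewrite (costate1_arc1 hulo huhi ok) ?ltW// /quad; lra.
  + by move=> _; split; lra.
  + move=> _; split; first by lra.
    move=> t /andP[ta tb]; rewrite (costate1_arc3 hulo huhi ok) ?ltW// /quad; lra.
  + by lra.
  + by lra.
  + by lra.
  + by lra.
(* The first half is empty. The second component is [1], and the first one is [t3 - t] on the [lo0]
   arc and [t6 - t] on the last arc. *)
- have t20 : t2 = 0 by rewrite /T2 /T1 Pa d0 subrr mul0r addr0.
  have L2E (t : R) : costate2 p x0 P d Q c 0 (-1) (-1) t != 0.
    by rewrite /costate2 t43; case: leP => _ //; rewrite mul0r sub0r opprK; exact: oner_neq0.
  have e5E : costate1_end p x0 P d Q c 0 (-1) (-1) t3 = 0.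
    rewrite /costate1_end /costate1_mid /quad; lra.
  apply: (pmp_of_costate hulo huhi ok (kap := 0) (mu1 := -1) (mu2 := -1) (e0 := t3) (lam0 := Q)).
  split => //; rewrite ?mul0r ?mul1r ?subr0 ?addr0 ?e5E.
  + right => t _; apply/negP => /eqP/(congr1 (fun z : state R => z.c2)).
    by rewrite mkst2 mxE; apply/eqP.
  + by left.
  + by lra.
  + by lra.
  + move=> _; split.
      have : m * t3 = (P + Q) * (m * n) by rewrite mulrCA -m3 t20 subr0.
      by rewrite mn; lra.
    move=> t /andP[ta tb]; rewrite (costate1_arc3 hulo huhi ok) ?ltW// /quad; lra.
  + by lra.
  + by lra.
  + by move=> _; split; lra.
  + move=> _; split; first by lra.
    move=> t /andP[ta tb]; rewrite (costate1_arc7 hulo huhi ok) ?ltW// e5E /quad; lra.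
(* Only [hi0] remains, and the constant costate [(-1, 0, 0)] with [lam0 = K] serves. *)
- have t62 : t2 = t1 by rewrite /T2 d0 addr0.
  have t65 : t6 = t5 by rewrite /T6 e0 addr0.
  have t32 : t3 = t2 by move: m3; rewrite PQ mul0r; lra.
  have e3E : costate1_mid p x0 P d Q c 0 0 (-1) = -1 by rewrite /costate1_mid /quad; lra.
  have e5E : costate1_end p x0 P d Q c 0 0 0 (-1) = -1 by rewrite /costate1_end e3E /quad; lra.
  apply: (pmp_of_costate hulo huhi ok (kap := 0) (mu1 := 0) (mu2 := 0) (e0 := -1) (lam0 := K)).
  split => //; rewrite ?mul0r ?mul1r ?subr0 ?addr0 ?e5E.
  + exact: ltW.
  + right => t /andP[ta tb]; apply/negP => /eqP/(congr1 (fun z : state R => z.c1)).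
    rewrite mkst1 mxE; have [h|h] := leP t t1.
      by rewrite (costate1_arc1 hulo huhi ok) ?ta// /quad; lra.
    by rewrite (costate1_arc7 hulo huhi ok) ?tb ?e5E /quad; lra.
  + by left.
  + move=> _; split; first by lra.
    move=> t /andP[ta tb]; rewrite (costate1_arc1 hulo huhi ok) ?ltW// /quad; lra.
  + by lra.
  + by lra.
  + by lra.
  + by lra.
  + by lra.
  + move=> _; split; first by lra.
    move=> t /andP[ta tb]; rewrite (costate1_arc7 hulo huhi ok) ?ltW// e5E /quad; lra.
- exact: (pmp_of_costate hulo huhi ok (generic_costate c0 q0)).
Qed.

End ExtremalCostate.

(** * Membership in the manifolds *)

Section Sweeps.
Variables (R : realType) (p : bounds R).
Hypotheses (hulo : ulo p < 0) (huhi : 0 < uhi p).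
Hypothesis hxlo : forall k : 'I_2, (xlo p k < 0)%E.
Hypothesis hxhi : forall k : 'I_2, (0 < xhi p k)%E.
Implicit Types (y : state R) (D t r v : R).

Local Notation K := (uhi p).
Local Notation um := (ulo p).
Local Notation l1 := (xlo p 0).
Local Notation h1 := (xhi p 0).
Local Notation l2 := (xlo p 1).
Local Notation h2 := (xhi p 1).

Let K0 : K != 0. Proof. exact: lt0r_neq0. Qed.
Let u0 : um != 0. Proof. by rewrite ltr0_neq0. Qed.

(** An arc run forwards on [[r, r']] is a backward integration from its end point, its point at time
    [t] being reached after [r' - t]. *)
Lemma arc_sweep (S : set (state R)) v (T : state R -> \bar R) (x : R -> state R) (r r' : R) :
  r <= r' -> (forall t, r <= t <= r' -> x t = flow (x r) v (t - r)) ->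
  (forall t, r <= t <= r' -> within p (x t)) -> S (x r') ->
  ((r' - r)%:E <= T (x r'))%E -> forall t, r <= t <= r' -> sweep p S v T (x t).
Proof.
move=> rr xE wx Sr Tr t tt; have /andP[rt tr] := tt.
exists (x r'), (r' - t); split => //.
- split; first by rewrite subr_ge0.
  by apply: le_trans Tr; rewrite lee_fin lerD2l lerN2.
- move=> s /andP[s0 st]; rewrite (xE r') ?rr ?lexx// flowD.
  have -> : r' - r - s = (r' - s) - r by ring.
  by rewrite -xE; [apply: wx|]; apply/andP; split; lra.
- rewrite (xE r') ?rr ?lexx// flowD.
  by rewrite (_ : _ - (r' - t) = t - r); [exact: xE|ring].
Qed.

(** Here and in the lemmas that follow: the time range of a sweep, evaluated at the end of an arc,
    covers the arc because its start respects the bound that defines the range. For an infinite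
    bound the range is infinite. *)
Lemma to_l1_ge y D : (l1 <= y.c1%:E)%E -> (D%:E <= to_l1 p (flow y K D))%E.
Proof.
rewrite /to_l1 flow_c1; case: l1 (hxlo 0) => [r| |] //=.
- rewrite lee_fin -EFinB -EFinM lee_fin => _ ry.
  by rewrite ler_pdivlMr//; lra.
- by rewrite addey// gt0_mulye ?leey// lte_fin invr_gt0.
Qed.

Lemma to_h1_ge y D : (y.c1%:E <= h1)%E -> (D%:E <= to_h1 p (flow y um D))%E.
Proof.
rewrite /to_h1 flow_c1; case: h1 (hxhi 0) => [r| |] //=.
- rewrite lee_fin -EFinB -EFinM lee_fin => _ ry.
  by rewrite ler_ndivlMr//; lra.
- by rewrite addeNy// lt0_mulNye ?leey// lte_fin invr_lt0.
Qed.

Lemma along_l1_ge y D : y.c1%:E = l1 -> (y.c2%:E <= h2)%E ->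
  (D%:E <= (((flow y 0 D).c2)%:E - h2) * ((fine l1)^-1)%:E)%E.
Proof.
move=> yl; have : (l1 < 0)%E by []; rewrite -yl lte_fin /= flow_c2 => y0.
case: h2 (hxhi 1) => [r| |] //=.
- rewrite lee_fin -EFinB -EFinM lee_fin => _ ry.
  by rewrite ler_ndivlMr//; lra.
- by rewrite addeNy// lt0_mulNye ?leey// lte_fin invr_lt0.
Qed.

Lemma along_h1_ge y D : y.c1%:E = h1 -> (l2 <= y.c2%:E)%E ->
  (D%:E <= (((flow y 0 D).c2)%:E - l2) * ((fine h1)^-1)%:E)%E.
Proof.
move=> yl; have : (0 < h1)%E by []; rewrite -yl lte_fin /= flow_c2 => y0.
case: l2 (hxlo 1) => [r| |] //=.
- rewrite lee_fin -EFinB -EFinM lee_fin => _ ry.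
  by rewrite ler_pdivlMr//; lra.
- by rewrite addey// gt0_mulye ?leey// lte_fin invr_gt0.
Qed.

Lemma below_ge y D : (y.c1%:E <= h1)%E -> (flow y um D).c1 = 0 ->
  (D%:E <= (- h1) * (um^-1)%:E)%E.
Proof.
rewrite flow_c1 => yh y1; have yE : y.c1 = - (um * D) by lra.
move: yh; rewrite yE; case: h1 (hxhi 0) => [r| |] //=.
- rewrite lee_fin -EFinM lee_fin => _ ry.
  by rewrite ler_ndivlMr//; lra.
- by rewrite lt0_mulNye ?leey// lte_fin invr_lt0.
Qed.

Let sqrt_le (s z : R) : 0 <= z -> s <= z ^+ 2 -> Num.sqrt s <= z.
Proof.
by move=> z0 sz; rewrite -(ger0_norm z0) -sqrtr_sqr; exact: ler_wsqrtr.
Qed.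

(** The square root in [tau] gives the first time at which the backward [lo0] arc meets [x_2 = h2],
    and [x_1 <= 0] there. An arc that ends above [x2_10] must therefore start with [x_1 <= 0]. *)
Lemma tau_ge y D : (y.c1%:E <= h1)%E -> (y.c2%:E <= h2)%E ->
  (((flow y um D).c2)%:E <= x2_10 p)%E \/ y.c1 <= 0 ->
  (D%:E <= tau p (flow y um D))%E.
Proof.
move=> yh1 yh2 h; rewrite /tau; case: ifPn => [_|n1]; first exact: to_h1_ge.
case: h => [h|y1]; first by rewrite h in n1.
move: n1 yh2; rewrite /x2_10; case: h2 (hxhi 1) => [r| |] //= _ n1; last by rewrite leey in n1.
rewrite !lee_fin flow_c1 flow_c2 => yr.
set q := (X in Num.sqrt X).
have -> : q = y.c1 ^+ 2 - 2 * um * (y.c2 - r) by rewrite /q; field.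
rewrite ler_ndivlMr// [D * um]mulrC -[X in _ <= X]addr0 -subr_ge0.
have := @sqrt_le (y.c1 ^+ 2 - 2 * um * (y.c2 - r)) (- y.c1).
rewrite oppr_ge0 sqrrN => /(_ y1) h.
have : Num.sqrt (y.c1 ^+ 2 - 2 * um * (y.c2 - r)) <= - y.c1.
  apply: h; have : 0 <= um * (y.c2 - r) by rewrite nmulr_rge0//; lra.
  lra.
lra.
Qed.

Lemma sigma_ge y D : (l1 <= y.c1%:E)%E -> (l2 <= y.c2%:E)%E ->
  [\/ (flow y K D).c1 <= 0,
      (l2 <= ((flow y K D).c2 - (flow y K D).c1 ^+ 2 / (2 * K))%:E)%E | 0 <= y.c1] ->
  (D%:E <= sigma p (flow y K D))%E.
Proof.
move=> yl1 yl2 h; rewrite /sigma; case: ifPn => [_|]; first exact: to_l1_ge.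
rewrite negb_or => /andP[n1 n2].
have y1 : 0 <= y.c1.
  case: h => [h|h|//]; first by rewrite h in n1.
  move: h n2; case: l2 (hxlo 1) => [r| |] //=.
  - by rewrite !lee_fin => _ h1' /negP[]; lra.
  - by rewrite ?addNye !leNye.
move: n2 yl2; case: l2 (hxlo 1) => [r| |] //= _ n2; last by rewrite addNye leNye in n2.
rewrite !lee_fin flow_c1 flow_c2 => yr.
set q := (X in Num.sqrt X).
have -> : q = y.c1 ^+ 2 - 2 * K * (y.c2 - r) by rewrite /q; field.
rewrite ler_pdivlMr// [D * K]mulrC.
have : Num.sqrt (y.c1 ^+ 2 - 2 * K * (y.c2 - r)) <= y.c1.
  apply: sqrt_le => //; have : 0 <= K * (y.c2 - r) by rewrite mulr_ge0 ?(ltW huhi)//; lra.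
  lra.
lra.
Qed.

End Sweeps.

Local Arguments st : simpl never.

(** * The arcs of a law lie on the manifolds *)

Section LawMembership.
Variables (R : realType) (p : bounds R) (x0 xf : state R).
Hypotheses (hulo : ulo p < 0) (huhi : 0 < uhi p).
Hypothesis hxlo : forall k : 'I_2, (xlo p k < 0)%E.
Hypothesis hxhi : forall k : 'I_2, (0 < xhi p k)%E.
Hypotheses (wx0 : within p x0) (wxf : within p xf).
Implicit Types (P d Q e c : R).

Local Notation K := (uhi p).
Local Notation k := ((uhi p)^-1).
Local Notation n := ((- ulo p)^-1).
Local Notation l1 := (xlo p 0).
Local Notation h1 := (xhi p 0).
Local Notation h2 := (xhi p 1).
Local Notation a := (x0.c1).
Local Notation v := (x0.c2).
Local Notation b := (- xf.c1).
Local Notation w := (xf.c2).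

Let K0 : K != 0. Proof. exact: lt0r_neq0. Qed.
Let m0 : - ulo p != 0. Proof. by rewrite lt0r_neq0// oppr_gt0. Qed.
Let u0 : ulo p != 0. Proof. by rewrite ltr0_neq0. Qed.
Let k_gt0 : 0 < k := kgt0 huhi.
Let n_gt0 : 0 < n := ngt0 hulo.

Variables (P d Q e c : R).
Hypothesis ok : hi_ok p x0 xf P d Q e c.
Local Notation V := (vel k n a v P d).
Local Notation t1 := (T1 p x0 P).
Local Notation t2 := (T2 p x0 P d).
Local Notation t3 := (T3 p x0 P d Q c).
Local Notation t4 := (T4 p x0 P d Q c).
Local Notation t5 := (T5 p x0 P d Q c).
Local Notation t6 := (T6 p x0 P d Q e c).
Local Notation t7 := (T7 p x0 xf P d Q e c).
Local Notation l := (hi_arcs p x0 xf P d Q e c).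

Hypothesis disp : hi_dsp p x0 xf P d Q e c = xf.c3 - x0.c3.
Local Notation x := (st x0 l).
Let l0 : durs_ge0 l. Proof. by have h := hi_durs hulo huhi ok. Qed.
Let times := hi_arcs_times l0.
Let VW : V = vel k n b w Q e. Proof. by case: ok => _ []. Qed.

Lemma st_T7 : x t7 = xf.
Proof.
rewrite st_hi_T7// (fin_hi_arcs hulo huhi c VW) disp.
by apply: stP; rewrite mkstE//; ring.
Qed.

Lemma hi_within t : 0 <= t <= t7 -> within p (x t).
Proof.
move=> tt; apply: st_within => //; first exact: hi_arcs_within.
by rewrite dur_hi_arcs -T7E.
Qed.

Lemma restart1 t : 0 <= t <= t1 -> x t = flow (x 0) K (t - 0).
Proof. by move=> tt; rewrite (arc1 l0)// st_0// subr0. Qed.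

Lemma restart2 t : t1 <= t <= t2 -> x t = flow (x t1) 0 (t - t1).
Proof.
have [[T10 T12 T23 T34] [T45 T56 T67]] := times.
by move=> tt; rewrite !(arc2 l0)// ?lexx// subrr flow0.
Qed.

Lemma restart3 t : t2 <= t <= t3 -> x t = flow (x t2) (ulo p) (t - t2).
Proof.
have [[T10 T12 T23 T34] [T45 T56 T67]] := times.
by move=> tt; rewrite !(arc3 l0)// ?lexx// subrr flow0.
Qed.

Lemma restart4 t : t3 <= t <= t4 -> x t = flow (x t3) 0 (t - t3).
Proof.
have [[T10 T12 T23 T34] [T45 T56 T67]] := times.
by move=> tt; rewrite !(arc4 l0)// ?lexx// subrr flow0.
Qed.

Lemma restart6 t : t5 <= t <= t6 -> x t = flow (x t5) 0 (t - t5).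
Proof.
have [[T10 T12 T23 T34] [T45 T56 T67]] := times.
by move=> tt; rewrite !(arc6 l0)// ?lexx// subrr flow0.
Qed.

Lemma restart7 t : t6 <= t <= t7 -> x t = flow (x t6) K (t - t6).
Proof.
have [[T10 T12 T23 T34] [T45 T56 T67]] := times.
by move=> tt; rewrite !(arc7 l0)// ?lexx// subrr flow0.
Qed.

Definition last_lo := if c == 0 then t2 else t4.

Lemma last_lo_t5 : c = 0 -> t5 = t3.
Proof. by rewrite /T5 /T4 /mid5 => ->; rewrite eqxx !addr0. Qed.

Lemma restart5 t : last_lo <= t <= t5 -> x t = flow (x last_lo) (ulo p) (t - last_lo).
Proof.
have [[T10 T12 T23 T34] [T45 T56 T67]] := times.
rewrite /last_lo; case: ifPn => [/eqP c0|_].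
  by rewrite last_lo_t5//; exact: restart3.
by move=> tt; rewrite !(arc5 l0)// ?lexx// subrr flow0.
Qed.

Lemma last_lo_le : 0 <= last_lo <= t5.
Proof.
have [[T10 T12 T23 T34] [T45 T56 T67]] := times.
by rewrite /last_lo; case: ifPn => _; apply/andP; split; lra.
Qed.

(** The hold belongs to the law as soon as the trough attains its bound, even if its length is 0.
    With a cruise this is the borderline case of equality in [touches], and it makes [touchesP] an
    equivalence. *)
Definition tail_law := if Q%:E == (- l1)%E then [:: lo1; hi0] else [:: hi0].
Definition mid_law :=
  if c == 0 then lo0 :: tail_law else [:: lo0, hi2, lo0 & tail_law].
Definition pre_law := if P%:E == h1 then hi1 :: mid_law else mid_law.

Lemma member7 t : t6 <= t <= t7 -> c_0 p xf (x t).
Proof.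
have [[T10 T12 T23 T34] [T45 T56 T67]] := times.
apply: arc_sweep => //; first exact: restart7.
- by move=> s ss; apply: hi_within; apply/andP; lra.
- exact: st_T7.
- rewrite [X in to_l1 p X]restart7 ?T67 ?lexx//; apply: to_l1_ge => //.
  by have /hi_within/withinE[/andP[]] : 0 <= t6 <= t7 by apply/andP; lra.
Qed.

Lemma lo1_fine : Q%:E = (- l1)%E -> l1 = (- Q)%:E.
Proof. by move=> QE; rewrite EFinN QE oppeK. Qed.

Lemma pt_0E : Q%:E = (- l1)%E -> pt_0 p xf = x t6.
Proof.
have [[T10 T12 T23 T34] [T45 T56 T67]] := times.
move=> /lo1_fine QE; rewrite /pt_0 QE /= -{1}st_T7.
rewrite (restart7 (t := t7)) ?T67 ?lexx// flowD.
rewrite (_ : _ + _ = 0) ?flow0// /T7; field; exact: K0.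
Qed.

Lemma member6 t : t5 <= t <= t6 -> manifold_hi p xf tail_law (x t).
Proof.
have [[T10 T12 T23 T34] [T45 T56 T67]] := times.
rewrite /tail_law; case: ifPn => [/eqP QE|nQ].
  rewrite /= /c_10 (lo1_fine QE) /=.
  apply: arc_sweep => //; first exact: restart6.
  - by move=> s ss; apply: hi_within; apply/andP; lra.
  - by split; [rewrite /= -pt_0E|apply: member7; rewrite lexx].
  - rewrite restart6 ?T56 ?lexx//.
    have -> : - Q = fine l1 by rewrite (lo1_fine QE).
    apply: along_l1_ge => //.
      have t5b : t5 <= t5 <= t6 by rewrite lexx.
      by have [-> _] := arc6_state hulo huhi ok t5b; rewrite (lo1_fine QE).
    by have /hi_within/withinE[_ /andP[]] : 0 <= t5 <= t7 by apply/andP; lra.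
have t56 : t5 = t6.
  apply/eqP; rewrite eq_le T56 leNgt; apply: contra nQ => /(hold2 ok) ->.
  exact: eqxx.
by move=> tt; apply: member7; apply/andP; lra.
Qed.

Lemma x2_10_ge : Q%:E = (- l1)%E -> (V%:E <= h2)%E ->
  ((V - n * Q ^+ 2 / 2)%:E <= x2_10 p)%E.
Proof.
move=> /lo1_fine QE; rewrite /x2_10 QE /=; case: h2 (hxhi 1) => [r| |] //= _.
- rewrite !lee_fin sqrrN => Vr.
  have -> : Q ^+ 2 / (2 * ulo p) = - (n * Q ^+ 2 / 2) by field.
  by lra.
- by rewrite addye// !leey.
Qed.

Lemma member5 t : last_lo <= t <= t5 -> manifold_hi p xf (lo0 :: tail_law) (x t).
Proof.
have [[T10 T12 T23 T34] [T45 T56 T67]] := times.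
have /andP[ll0 ll5] := last_lo_le.
have wl : within p (x last_lo) by apply: hi_within; apply/andP; lra.
have /withinE[/andP[_ w1] /andP[_ w2]] := wl.
have m6 : manifold_hi p xf tail_law (x t5) by apply: member6; rewrite lexx.
move: m6; rewrite /tail_law; case: ifPn => [/eqP QE|nQ] m6 /=.
  apply: arc_sweep => //; first exact: restart5.
  - by move=> s ss; apply: hi_within; apply/andP; lra.
  - rewrite restart5 ?ll5 ?lexx//; apply: tau_ge => //.
    rewrite -restart5 ?ll5 ?lexx//.
    have t5b : t5 <= t5 <= t6 by rewrite lexx.
    have [_ ->] := arc6_state hulo huhi ok t5b; rewrite subrr mulr0 subr0.
    have [Vh|nV] := pselect (V%:E <= h2)%E; first by left; exact: x2_10_ge.
    right; have Q0 : 0 < Q by rewrite -lte_fin QE oppe_gt0; exact: hxlo.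
    have P0 : P <= 0 by case: ok => _ _ _ _ [//|/(lt_le_trans Q0)|//]; rewrite ltxx.
    rewrite /last_lo; case: ifPn => [_|c0]; last first.
      by case: ok => _ _ _ [cE|[_ _ Vh]]; [rewrite cE eqxx in c0|case: nV; rewrite Vh].
    have t2b : t2 <= t2 <= t3 by rewrite lexx.
    by have [-> _] := arc3_state hulo huhi ok t2b; rewrite subrr mulr0 subr0.
apply: arc_sweep => //; first exact: restart5.
- by move=> s ss; apply: hi_within; apply/andP; lra.
- by rewrite restart5 ?ll5 ?lexx//; exact: to_h1_ge.
Qed.

Lemma pt_2010E : Q%:E = (- l1)%E -> c != 0 ->
  pt_2010 p xf = x t4.
Proof.
have [[T10 T12 T23 T34] [T45 T56 T67]] := times.
move=> QE c0; have Q0 : 0 < Q by rewrite -lte_fin QE oppe_gt0; exact: hxlo.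
have Vh : V%:E = h2 by case: ok => _ _ _ [cE|[]//] _; rewrite cE eqxx in c0.
have t5E : t5 - t4 = Q * n by rewrite /T5 /mid5 (negbTE c0) addrAC subrr add0r.
have last : last_lo = t4 by rewrite /last_lo (negbTE c0).
rewrite /pt_2010 /pt_10 pt_0E// /x2_10 -Vh (lo1_fine QE) /=.
have t6b : t5 <= t6 <= t6 by rewrite T56 lexx.
have [_ ->] := arc6_state hulo huhi ok t6b.
rewrite restart6// flowD (_ : _ + _ = 0) ?flow0; last first.
  by rewrite sqrrN; field; rewrite ?u0 ?m0 ?gt_eqF.
rewrite restart5 ?last ?T45 ?lexx// flowD (_ : _ + _ = 0) ?flow0// t5E.
by field; rewrite ?u0 ?m0.
Qed.

(** If the trough stays short of its bound, the last [hi0] arc, prolonged backwards to [x_1 = l1],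
    ends above [x2_10] by [(n + k) (l1^2 - Q^2) / 2]. *)
Lemma touchesP : c != 0 -> touches p xf <-> Q%:E = (- l1)%E.
Proof.
have [[T10 T12 T23 T34] [T45 T56 T67]] := times.
move=> c0; have [P0 Q0 Vh] : [/\ 0 <= P, 0 <= Q & V%:E = h2].
  by case: ok => _ _ _ [cE|//] _; rewrite cE eqxx in c0.
have t6b : t5 <= t6 <= t6 by rewrite T56 lexx.
have [_ x62] := arc6_state hulo huhi ok t6b.
have t7b : t6 <= t7 <= t7 by rewrite T67 lexx.
have x71 : xf.c1 = - Q + K * (t7 - t6).
  by rewrite -{1}st_T7; have [] := arc7_state hulo huhi ok t7b.
have x72 : xf.c2 = V - n * Q ^+ 2 / 2 - Q * e - Q * (t7 - t6) + K * (t7 - t6) ^+ 2 / 2.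
  by rewrite -{1}st_T7; have [] := arc7_state hulo huhi ok t7b.
split=> [[l1f]|QE].
  have [l1r Er] : exists r, l1 = (- r)%:E.
    by exists (- fine l1); rewrite opprK fineK.
  rewrite /pt_0 /x2_10 -Vh Er /= flow_c2 lee_fin sqrrN => h.
  case: ok => -[_ [_ [Qr _] eh _ _]] _ _ _ _.
  rewrite Er -EFinN opprK lee_fin in Qr.
  suff -> : Q = l1r by rewrite ?Er ?opprK.
  apply/eqP; rewrite eq_le Qr leNgt; apply/negP => Qlt.
  have eE : e = 0.
    by case: eh => // QE; move: Qlt; rewrite -lte_fin QE Er -EFinN opprK ltxx.
  move: h; rewrite x72; move: (t7 - t6) x71 => z ->; rewrite eE.
  have : 0 < (n + k) * (l1r ^+ 2 - Q ^+ 2).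
    apply: mulr_gt0; first exact: (addr_gt0 n_gt0 k_gt0).
    by rewrite subr_gt0 ltr_sqr ?nnegrE// (le_trans Q0).
  set A := (X in X <= _) => pos Ah.
  have : (n + k) * (l1r ^+ 2 - Q ^+ 2) = 2 * (A - (V + l1r ^+ 2 / (2 * ulo p))).
    by rewrite /A; field; rewrite ?u0 ?m0 ?K0.
  lra.
split; first by rewrite (lo1_fine QE).
rewrite pt_0E// x62; apply: le_trans (x2_10_ge QE _); last by rewrite Vh.
rewrite lee_fin gerBl mulr_ge0//; lra.
Qed.

Lemma member4 t : c != 0 -> t3 <= t <= t4 ->
  manifold_hi p xf [:: hi2, lo0 & tail_law] (x t).
Proof.
have [[T10 T12 T23 T34] [T45 T56 T67]] := times.
move=> c0 tt; have /andP[ta tb] := tt.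
have Vh : V%:E = h2 by case: ok => _ _ _ [cE|[]//] _; rewrite cE eqxx in c0.
have V0 : 0 < V by rewrite -lte_fin Vh; exact: hxhi.
have last : last_lo = t4 by rewrite /last_lo (negbTE c0).
have m5 : manifold_hi p xf (lo0 :: tail_law) (x t4).
  by apply: member5; rewrite last lexx.
have line s : t3 <= s <= t4 -> line2 p (x s).
  by move=> ss; have [x1 x2] := arc4_state hulo huhi ok c0 ss; split => //; rewrite x2.
(* The curve of the cruise contains the points of the line whose [x_3] is at most that of the end of
   the cruise, and [x_3] increases on the way since [V > 0]. *)
have c3 : (x t).c3 <= (x t4).c3.
  have t3b : t3 <= t3 <= t4 by rewrite lexx.
  have [y1 y2] := arc4_state hulo huhi ok c0 t3b.
  rewrite (restart4 tt) [x t4]restart4 ?T34 ?lexx//.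
  move: (x t3) y1 y2 => y y1 y2; rewrite !flow_c3 y1 y2.
  by have := ler_wpM2l (ltW V0) (_ : t - t3 <= t4 - t3); rewrite lerD2r => /(_ tb); lra.
have tch := touchesP c0.
move: m5; rewrite /tail_law; case: ifPn => [/eqP QE|nQ] m5 /=.
  by split; rewrite ?pt_2010E//; [exact/tch|exact: line].
split; [by move/tch => QE; rewrite QE eqxx in nQ|exact: line|].
by exists (x t4) => //; split => //; apply: line; rewrite T34 lexx.
Qed.

Lemma member3 t : t2 <= t <= t3 -> manifold_hi p xf mid_law (x t).
Proof.
have [[T10 T12 T23 T34] [T45 T56 T67]] := times.
rewrite /mid_law; case: ifPn => [/eqP c0|c0].
  by move=> tt; apply: member5; rewrite (last_lo_t5 c0) /last_lo; case: eqP c0.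
have m4 : manifold_hi p xf [:: hi2, lo0 & tail_law] (x t3).
  by apply: member4 => //; rewrite lexx.
have below C : C (x t3) -> forall t, t2 <= t <= t3 -> below_2 p C (x t).
  move=> Cx; apply: arc_sweep => //; first exact: restart3.
  - by move=> s ss; apply: hi_within; apply/andP; lra.
  - have wl : within p (x t2) by apply: hi_within; apply/andP; lra.
    have /withinE[/andP[_ w1] _] := wl.
    apply: (below_ge hulo hxhi w1); rewrite -restart3 ?T23 ?lexx//.
    have t3b : t3 <= t3 <= t4 by rewrite lexx.
    by have [] := arc4_state hulo huhi ok c0 t3b.
by move: m4 t; rewrite /tail_law; case: ifPn => _ m4 /=; exact: below.
Qed.

Lemma member2 t : t1 <= t <= t2 -> manifold_hi p xf pre_law (x t).
Proof.
have [[T10 T12 T23 T34] [T45 T56 T67]] := times.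
have m3 : manifold_hi p xf mid_law (x t2) by apply: member3; rewrite lexx.
rewrite /pre_law; case: ifPn => [/eqP PE|nP].
  have x21 : (x t2).c1%:E = h1.
    have t2b : t1 <= t2 <= t2 by rewrite T12 lexx.
    by have [-> _] := arc2_state hulo huhi ok t2b.
  have x11 : (x t1).c1%:E = h1.
    have t1b : t1 <= t1 <= t2 by rewrite lexx.
    by have [-> _] := arc2_state hulo huhi ok t1b.
  have along S : S (x t2) -> forall t, t1 <= t <= t2 -> along_h1 p S (x t).
    move=> Sx; apply: arc_sweep => //; first exact: restart2.
    - by move=> s ss; apply: hi_within; apply/andP; lra.
    - have wl : within p (x t1) by apply: hi_within; apply/andP; lra.
      have /withinE[_ /andP[w2 _]] := wl.
      by rewrite restart2 ?T12 ?lexx//; exact: along_h1_ge.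
  move: m3 t; rewrite /mid_law /tail_law; case: ifPn => _; case: ifPn => _ m3 /=;
    exact: along.
have t12 : t1 = t2.
  by apply/eqP; rewrite eq_le T12 leNgt; apply: contra nP => /(hold1 ok) ->.
by move=> tt; apply: member3; apply/andP; lra.
Qed.

Lemma member1 t : 0 <= t <= t1 -> manifold_hi p xf (hi0 :: pre_law) (x t).
Proof.
have [[T10 T12 T23 T34] [T45 T56 T67]] := times.
have m2 : manifold_hi p xf pre_law (x t1) by apply: member2; rewrite lexx.
have wl : within p (x 0) by apply: hi_within; apply/andP; lra.
have /withinE[/andP[w1 w1'] /andP[w2 w2']] := wl.
have wr s : 0 <= s <= t1 -> within p (x s).
  by move=> ss; apply: hi_within; apply/andP; lra.
have ext S : S (x t1) -> forall t, 0 <= t <= t1 -> extrude p S (x t).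
  move=> Sx; apply: arc_sweep => //; first exact: restart1.
  by rewrite restart1 ?T10 ?lexx//; exact: to_l1_ge.
move: m2 t; rewrite /pre_law /mid_law /tail_law.
case: ifPn => [_|nP]; first by case: ifPn => _; case: ifPn => _ m2 /=; exact: ext.
case: ifPn => _; case: ifPn => _ m2 /=; try exact: ext.
apply: arc_sweep => //; first exact: restart1.
rewrite restart1 ?T10 ?lexx//; apply: sigma_ge => //.
rewrite -restart1 ?T10 ?lexx//.
have t1b : 0 <= t1 <= t1 by rewrite T10 lexx.
have [-> ->] := arc1_state hulo huhi ok t1b; rewrite subrr expr0n mulr0 mulr0 mul0r !addr0 st_0//.
case: ok => -[[_ _ [dE|PE] sw _] _] _ _ _ _; last by rewrite PE eqxx in nP.
case: sw => [?|?|low_ge]; [by constructor 1|by constructor 3|constructor 2].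
move: low_ge; congr (_ <= EFin _)%E.
by rewrite dE mulr0 subr0 -(vswE k n a v) /vsw; field; exact: K0.
Qed.

(** The last clause of [closed_loop] for the part of the trajectory after time [t], which allows
    building the law backwards arc by arc. *)
Definition follows (L : asl) t := exists ts : nat -> R,
  [/\ ts 0%N = t, ts (size L) = t7 &
    forall i, (i < size L)%N -> ts i <= ts i.+1 /\
      forall s, s \in `[ts i, ts i.+1] -> manifold p xf (drop i L) (x s)].

Lemma follows_cons aa L s t : s <= t ->
  (forall r, s <= r <= t -> manifold_hi p xf (aa :: L) (x r)) ->
  follows L t -> follows (aa :: L) s.
Proof.
move=> st sm [ts [t0 tn tm]].
exists (fun i => if i is j.+1 then ts j else s); split => // -[_|i].
  by rewrite t0; split => // r; rewrite in_itv => rr; left; exact: sm.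
by rewrite ltnS /= => /tm.
Qed.

Lemma law_follows : exists L, follows L 0.
Proof.
have [[T10 T12 T23 T34] [T45 T56 T67]] := times.
have f7 : follows [:: hi0] t6.
  apply: (follows_cons T67); first exact: member7.
  by exists (fun=> t7).
have f6 : follows tail_law t5.
  have := member6; rewrite /tail_law; case: ifPn => [_ m6|nQ _]; first exact: follows_cons f7.
  suff -> : t5 = t6 by [].
  by apply/eqP; rewrite eq_le T56 leNgt; apply: contra nQ => /(hold2 ok) ->.
have /andP[_ ll] := last_lo_le.
have f5 : follows (lo0 :: tail_law) last_lo := follows_cons ll member5 f6.
have f3 : follows mid_law t2.
  have := member3; rewrite /mid_law; case: ifPn => [c0|c0] m3.
    by move: f5; rewrite /last_lo c0.
  apply: (follows_cons T23 m3); apply: (follows_cons T34).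
    by move=> r; exact: member4.
  by move: f5; rewrite /last_lo (negbTE c0).
have f2 : follows pre_law t1.
  have := member2; rewrite /pre_law; case: ifPn => [_ m2|nP _]; first exact: follows_cons f3.
  suff -> : t1 = t2 by [].
  by apply/eqP; rewrite eq_le T12 leNgt; apply: contra nP => /(hold1 ok) ->.
by exists (hi0 :: pre_law); exact: (follows_cons T10 member1).
Qed.

End LawMembership.

(** * The control along the trajectory *)

Section Cofinite.
Variable R : realType.
Implicit Types (Z : R -> Prop) (t : R).

Definition cof Z := finite_set [set t | ~ Z t].

Lemma cofS Z Z' : cof Z -> (forall t, Z t -> Z' t) -> cof Z'.
Proof. by move=> fZ ZZ; apply: sub_finite_set fZ => t /= nZ /ZZ. Qed.

Lemma cofI Z Z' : cof Z -> cof Z' -> cof (fun t => Z t /\ Z' t).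
Proof.
move=> fZ fZ'; apply: (@sub_finite_set _ _ ([set t | ~ Z t] `|` [set t | ~ Z' t])).
  by move=> t /= /not_andP[]; [left|right].
by rewrite finite_setU.
Qed.

Lemma cof_ae Z : cof Z -> {ae @lebesgue_measure R, forall t, Z t}.
Proof.
move=> /finite_seqP[s sE]; apply: (@ae_off_seq _ s) => t ts.
apply: contrapT => nZ; suff : [set t | ~ Z t] t by rewrite sE /= (negbTE ts).
by [].
Qed.

Lemma cof_poly (q : {poly R}) : q != 0 -> cof (fun t => q.[t] != 0).
Proof.
have [N] := ubnP (size q); elim: N q => // N IH q qN q0.
have [[r qr]|nr] := pselect (exists r, root q r); last first.
  apply: (@sub_finite_set _ _ set0) => // t /= /negP; rewrite negbK => h.
  by apply: nr; exists t.
have /factor_theorem[q' qE] := qr.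
have q'0 : q' != 0 by apply: contraNneq q0 => q'0; rewrite qE q'0 mul0r.
have /IH : (size q' < N)%N.
  by move: qN; rewrite qE size_Mmonic ?monicXsubC// size_XsubC addn2.
move=> /(_ q'0) fq'; apply: (@sub_finite_set _ _ ([set r] `|` [set t | ~ q'.[t] != 0])).
  move=> t /= /negP; rewrite negbK qE hornerM mulf_eq0 => /orP[h|].
    by right; rewrite h.
  by rewrite hornerXsubC subr_eq0 => /eqP ->; left.
by rewrite finite_setU.
Qed.

Lemma cof_quartic (c0 c1 c2 c3 c4 : R) :
  [|| c1 != 0, c2 != 0, c3 != 0 | c4 != 0] ->
  cof (fun t => c0 + c1 * t + c2 * t ^+ 2 + c3 * t ^+ 3 + c4 * t ^+ 4 <> 0).
Proof.
move=> nz; have q0 : Poly [:: c0; c1; c2; c3; c4] != 0.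
  apply: contraTneq nz => /polyP q0.
  have := (q0 1%N, q0 2%N, (q0 3%N, q0 4%N)); rewrite !coef_Poly !coef0 /=.
  by move=> [[-> ->] [-> ->]]; rewrite eqxx.
apply: cofS (cof_poly q0) _ => t; rewrite horner_Poly /= => /eqP h E; apply: h.
by rewrite -[RHS]E; ring.
Qed.

Lemma cof_lin (c0 c1 : R) : c1 != 0 -> cof (fun t => c0 + c1 * t <> 0).
Proof.
move=> c1n; have := @cof_quartic c0 c1 0 0 0; rewrite c1n => /(_ isT) h.
by apply: cofS h _ => t h E; apply: h; rewrite E; ring.
Qed.

(** Turns finitely many exceptional values of [x_1] on an accelerated arc into finitely many
    exceptional times. *)
Lemma cof_affine Z (al ka : R) : ka != 0 -> cof Z -> cof (fun t => Z (al + ka * t)).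
Proof.
move=> ka0 fZ; apply: (@sub_finite_set _ _ [set (z - al) / ka | z in [set z | ~ Z z]]).
  by move=> t /= nZ; exists (al + ka * t) => //; field.
exact: finite_image.
Qed.

End Cofinite.

(** * Necessary conditions for membership in a manifold *)

Section Strata.
Variable R : realType.
Implicit Types (p : bounds R) (x y xf : state R).

Lemma flowN y v t : flow (- y) (- v) t = - flow y v t :> state R.
Proof. by apply: stP; rewrite /flow !mxE /=; field. Qed.

(** A superset of the surfaces of the first family that begin with [lo0], without the time range of
    the sweep. It serves to exclude membership, so a superset is enough. *)
Definition lo_surface p xf x : Prop := exists y s,
  [/\ 0 <= s, within p y, x = flow y (ulo p) (- s) &
      [\/ c_0 p xf y, c_10 p xf y | y.c1 = 0 /\ y.c2%:E = xhi p 1]].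

Definition stratum p xf x (o : option arc) (dm : nat) : Prop :=
  [\/ [/\ o = None, dm = 0%N & x = xf], [/\ o = Some hi0, dm = 1%N & c_0 p xf x],
      [/\ o = Some lo1, dm = 1%N & c_10 p xf x] |
  [\/ o = Some hi0 /\ dm = 3%N, [/\ o = Some hi1, dm = 2%N & x.c1%:E = xhi p 0],
      [/\ o = Some hi2, dm = 1%N & x.c1 = 0] |
      [/\ o = Some lo0, dm = 2%N & lo_surface p xf x]]].

Lemma sweepE p S v T x : sweep p S v T x -> exists y s,
  [/\ S y, 0 <= s, within p y & x = flow y v (- s)].
Proof.
move=> [y [s [Sy [s0 _] wy ->]]]; exists y, s; split => //.
by have := wy 0; rewrite oppr0 flow0; apply; rewrite lexx.
Qed.

Lemma manifold_hi_stratum p xf x L : manifold_hi p xf L x ->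
  stratum p xf x (ohead L) (mdim L).
Proof.
have along S y : along_h1 p S y -> y.c1%:E = xhi p 0.
  by move=> /sweepE[z [s [[_ /= zh] _ _ ->]]]; rewrite flow_c1 mul0r addr0.
have c2010 y : c_2010 p xf y -> y.c1 = 0 /\ y.c2%:E = xhi p 1 by case=> _ _ [].
have c200 y : c_200 p xf y -> y.c1 = 0 /\ y.c2%:E = xhi p 1 by case=> _ [].
have s00 : s_00 p xf x -> lo_surface p xf x.
  by move=> /sweepE[y [s [Sy s0 wy xE]]]; exists y, s; split => //; constructor 1.
have s010 : s_010 p xf x -> lo_surface p xf x.
  by move=> /sweepE[y [s [Sy s0 wy xE]]]; exists y, s; split => //; constructor 2.
have bel C : (forall y, C y -> y.c1 = 0 /\ y.c2%:E = xhi p 1) ->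
    below_2 p C x -> lo_surface p xf x.
  by move=> CE /sweepE[y [s [Sy s0 wy xE]]]; exists y, s; split => //; constructor 3; exact: CE.
rewrite /stratum.
(* The longest law has seven arcs; the eighth case analysis settles what follows them. *)
do 8 (try match goal with L : _ |- _ => is_var L; destruct L as [|[] L] end;
  cbn [manifold_hi ohead mdim arc_order]; try (by case)).
all: move=> mx.
all: try by constructor 1; split.
all: try by constructor 2; split.
all: try by constructor 3; split.
all: constructor 4.
all: try by constructor 1; split.
all: try by constructor 2; split => //; exact: along mx.
all: try by constructor 3; split => //; [have [] := c2010 _ mx|have [] := c200 _ mx].
all: try by constructor 3; split => //; have [] := c2010 _ mx.
all: try by constructor 3; split => //; have [] := c200 _ mx.
all: constructor 4; split => //.
all: try exact: s00.
all: try exact: s010.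
all: try exact: bel c2010 mx.
all: try exact: bel c200 mx.
Qed.

End Strata.

(** * Relative interiors and the value of the control *)

Section Relint.
Variables (R : realType) (p : bounds R) (xf : state R).
Hypotheses (hulo : ulo p < 0) (huhi : 0 < uhi p).
Hypothesis hxlo : forall k : 'I_2, (xlo p k < 0)%E.
Hypothesis hxhi : forall k : 'I_2, (0 < xhi p k)%E.
Implicit Types (x y : state R).

Local Notation K := (uhi p).
Local Notation um := (ulo p).
Local Notation l1 := (xlo p 0).
Local Notation h1 := (xhi p 0).

Lemma c_10_c1 q w x : 0 < uhi q -> c_10 q w x -> x.c1%:E = xlo q 0.
Proof.
rewrite /c_10 => q0; case: ifPn => // l1f /sweepE[y [s [[/= -> _] _ _ ->]]].
rewrite flow_c1 mul0r addr0 flow_c1 mulrC divfK ?gt_eqF//.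
by rewrite addrC subrK fineK.
Qed.

Lemma c_0_flow q w x : c_0 q w x -> exists2 s, 0 <= s & x = flow w (uhi q) (- s).
Proof. by move=> /sweepE[y [s [/= -> s0 _ ->]]]; exists s. Qed.

Definition lo_curve x := exists2 s, 0 <= s & x = flow xf um (- s).

Lemma lo_curve_mirror x : c_0 (mirror p) (- xf) (- x) -> lo_curve x.
Proof.
move=> /c_0_flow[s s0] /=; rewrite flowN => /oppr_inj ->; by exists s.
Qed.

(** Both families, sorted by first arc and dimension, with just enough about the point to show that
    the manifold is met at few times. Regions carry no information: having the greatest dimension,
    they are never part of a relative boundary. *)
Variant manifold_spec x (L : asl) : Prop :=
| SpecPoint of mdim L = 0%N & x = xf
| SpecHi of ohead L = Some hi0 & mdim L = 1%N & c_0 p xf x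
| SpecLo of ohead L = Some lo0 & mdim L = 1%N & lo_curve x
| SpecLo1 of ohead L = Some lo1 & (0 < mdim L)%N & x.c1%:E = l1
| SpecHi1 of ohead L = Some hi1 & (0 < mdim L)%N & x.c1%:E = h1
| SpecZero of (ohead L = Some hi2 \/ ohead L = Some lo2) & (0 < mdim L)%N & x.c1 = 0
| SpecLo0 of ohead L = Some lo0 & mdim L = 2%N & lo_surface p xf x
| SpecHi0 of ohead L = Some hi0 & mdim L = 2%N &
    lo_surface (mirror p) (- xf) (- x)
| SpecRegion of (ohead L = Some hi0 \/ ohead L = Some lo0) & mdim L = 3%N.

Lemma mdim_flip L : mdim (map flip L) = mdim L.
Proof. by elim: L => // -[] L /= ->. Qed.

Lemma manifold_cases x L : manifold p xf L x -> manifold_spec x L.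
Proof.
have oflip o : ohead (map flip L) = Some o -> ohead L = Some (flip o).
  by case: L => //= -[] ? [] <-.
have no (y : R) (z : \bar R) : (- y)%:E = (- z)%E -> y%:E = z.
  by rewrite EFinN => /oppe_inj.
case=> [/manifold_hi_stratum|/= /manifold_hi_stratum]; last rewrite mdim_flip.
- case=> [[oo d h]|[oo d h]|[oo d h]|[[oo d]|[oo d h]|[oo d h]|[oo d h]]].
  + exact: SpecPoint.
  + exact: SpecHi.
  + by apply: SpecLo1; rewrite ?d//; exact: c_10_c1 h.
  + by apply: SpecRegion => //; left.
  + by apply: SpecHi1; rewrite ?d.
  + by apply: SpecZero; rewrite ?d//; left.
  + exact: SpecLo0.
- case=> [[oo d h]|[oo d h]|[oo d h]|[[oo d]|[oo d h]|[oo d h]|[oo d h]]].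
  + by apply: SpecPoint => //; exact: oppr_inj.
  + by apply: SpecLo => //; [exact: oflip oo|exact: lo_curve_mirror].
  + apply: SpecHi1; [exact: oflip oo|by rewrite d|].
    by have := c_10_c1 _ h; rewrite /= mxE oppr_gt0 => /(_ hulo)/no.
  + by apply: SpecRegion => //; right; exact: oflip oo.
  + apply: SpecLo1; [exact: oflip oo|by rewrite d|].
    by move: h; rewrite /= mxE => /no.
  + apply: SpecZero; [by right; exact: oflip oo|by rewrite d|].
    by move: h; rewrite mxE => /eqP; rewrite oppr_eq0 => /eqP.
  + by apply: SpecHi0 => //; exact: oflip oo.
Qed.

(** Descent on the dimension: among the manifolds through [x] that begin with [o], one of least
    dimension has [x] in its relative interior. Lower-dimensional manifolds with the same first arc
    are thus harmless. *)
Lemma relint_fromI o x L : manifold p xf L x -> ohead L = Some o ->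
  (forall L', (mdim L' < mdim L)%N -> manifold p xf L' x ->
     exists L'', [/\ ohead L'' = Some o, manifold p xf L'' x & (mdim L'' <= mdim L')%N]) ->
  relint_from p xf o x.
Proof.
have [N] := ubnP (mdim L); elim: N L => // N IH L LN Lx Lo low.
have [[L' L'L L'x]|nlow] :=
  pselect (exists2 L', (mdim L' < mdim L)%N & manifold p xf L' x).
  have [L'' [ooL'' L''x dL'']] := low L' L'L L'x.
  have ltL : (mdim L'' < mdim L)%N by exact: leq_ltn_trans L'L.
  apply: (IH L'') => //; first exact: leq_trans ltL LN.
  by move=> M ML''; apply: low; exact: ltn_trans ltL.
exists L => //; split => // -[L' /= L'L L'x]; apply: nlow; by exists L'.
Qed.

Lemma relint_hi_curve x : c_0 p xf x -> x <> xf -> relint_from p xf hi0 x.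
Proof.
move=> cx nxf; apply: (@relint_fromI _ _ [:: hi0]) => //; first by left.
move=> L' /=; rewrite ltnS leqn0 => /eqP L'0 /manifold_cases[]; by rewrite ?L'0.
Qed.

Definition off_strata x := [/\ x <> xf, x.c1%:E <> l1, x.c1%:E <> h1 & x.c1 <> 0].

(** A [hi0] arc can run along the final curve [c_0], every point of which lies on [lo_surface];
    hence an implication in place of an exclusion. On [c_0] the control has the value of [hi0] as
    well. *)
Lemma relint_region x L : manifold p xf L x -> ohead L = Some hi0 -> mdim L = 3%N ->
  off_strata x -> ~ lo_curve x -> (lo_surface p xf x -> c_0 p xf x) ->
  relint_from p xf hi0 x.
Proof.
move=> Lx Lo L3 [nxf nl nh n0] nlo sc; apply: (relint_fromI Lx Lo) => L'.
rewrite L3 => L'3 L'x; have := manifold_cases L'x; case=> //.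
- by move=> o1 _ _; exists L'.
- move=> o1 d1 /sc cx; exists [:: hi0]; split => //; first by left.
  by rewrite d1.
- by move=> o1 _ _; exists L'.
- by move=> _ d1; rewrite d1 in L'3.
Qed.

Lemma relint_lo_surface x L : manifold p xf L x -> ohead L = Some lo0 ->
  mdim L = 2%N -> off_strata x -> ~ c_0 p xf x -> relint_from p xf lo0 x.
Proof.
move=> Lx Lo L2 [nxf nl nh n0] nc; apply: (relint_fromI Lx Lo) => L'.
rewrite L2 => L'2 L'x; have := manifold_cases L'x; case=> //.
- by move=> o1 _ _; exists L'.
- by move=> _ d1; rewrite d1 in L'2.
- by move=> _ d1; rewrite d1 in L'2.
- by move=> _ d1; rewrite d1 in L'2.
Qed.

Lemma relint_mdim o x L : manifold p xf L x -> relint_from p xf o x ->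
  exists L', [/\ ohead L' = Some o, manifold p xf L' x & (mdim L' <= mdim L)%N].
Proof.
move=> Lx [L' /= L'o [L'x nL']]; exists L'; split => //.
by rewrite leqNgt; apply/negP => LL'; apply: nL'; exists L.
Qed.

Lemma hold_curve x L : manifold p xf L x -> mdim L = 1%N -> x <> xf ->
  ~ c_0 p xf x -> ~ lo_curve x -> ~ (relint_from p xf hi0 `|` relint_from p xf lo0) x.
Proof.
move=> Lx L1 nxf nc nlo [] /(relint_mdim Lx)[L' [oo L'x]]; rewrite L1 => d1;
  case: (manifold_cases L'x); rewrite ?oo //;
  try (by move=> _ d2; rewrite d2 in d1); by case.
Qed.

Lemma hold_surface x L : manifold p xf L x -> mdim L = 2%N -> x <> xf ->
  x.c1%:E = h1 -> ~ c_0 p xf x -> ~ lo_curve x -> ~ lo_surface p xf x ->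
  ~ (relint_from p xf hi0 `|` relint_from p xf lo0) x.
Proof.
move=> Lx L2 nxf xh nc nlo ns.
have x1 : 0 < x.c1 by rewrite -lte_fin xh; exact: hxhi.
have main L' o : ohead L' = Some o -> o = hi0 \/ o = lo0 -> relint p xf L' x -> False.
  move=> L'o oE [L'x nL'].
  have d2 : (mdim L' <= 2)%N.
    by rewrite leqNgt; apply/negP => LL'; apply: nL'; exists L => //=; rewrite L2.
  case: (manifold_cases L'x); rewrite ?L'o //.
  - by case=> oo _; case: oE; rewrite oo.
  - by case=> oo _; case: oE; rewrite oo.
  - by case=> -[oo] _ xE; move: x1; rewrite xE ltxx.
  - move=> _ d2' [y [s [s0 wy xE]]].
    (* A mirrored surface through the point comes from a state with [x_1 = h1 + K * s], so the bound
       forces [s = 0]. The point then lies on the mirrored final curve, on a hold curve of smaller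
       dimension or on [x_1 = 0], all of which are excluded. *)
    have /withinE[/andP[wy1 _] _] := wy.
    have y1 : y.c1 = - x.c1 - K * s.
      have := congr1 (fun z : state R => z.c1) xE; rewrite flow_c1 mxE /=; lra.
    have sE : s = 0.
      move: wy1; rewrite /= y1 -xh -EFinN lee_fin => h.
      have : K * s <= 0 by lra.
      by rewrite pmulr_rle0// => s0'; apply/eqP; rewrite eq_le s0' s0.
    have yE : y = - x by rewrite xE sE oppr0 flow0.
    rewrite yE; case=> [/lo_curve_mirror//|cx|[xE0 _]].
      by apply: nL'; exists [:: hi1; lo0]; [rewrite /= d2'|right].
    by move: xE0 x1; rewrite mxE; lra.
  - by move=> _ d3; rewrite d3 in d2.
by case=> -[L' /= L'o rL']; apply: main L'o _ rL'; [left|right].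
Qed.

End Relint.

(** * Polynomial equations for the crossings *)

Section FinitelyManyCrossings.
Variable R : realType.

Lemma cofT (Z : R -> Prop) : (forall t, Z t) -> cof Z.
Proof. by move=> h; apply: (@sub_finite_set _ _ set0) => // t /(_ (h t)). Qed.

Lemma cof_ne (r : \bar R) : cof (fun z : R => z%:E <> r).
Proof.
apply: (@sub_finite_set _ _ [set fine r]) => [z /= /contrapT <- //|].
exact: finite_set1.
Qed.

(* The relation between the [x_1]-coordinates [z], [z'] of points of two [hi0]
   curves joined by the [lo0] flow; once squared it is polynomial in [z], and it
   is trivial only if the two curves coincide. *)
Lemma cof_cubics (B0 G0 B1 G1 C E : R) : 0 < C -> 0 < E -> 0 < C ^+ 2 - 3 * E ->
  cof (fun z => forall z', z' <= z -> B0 + C * z ^+ 2 / 2 = B1 + C * z' ^+ 2 / 2 ->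
    G0 + C * B0 * z + E * z ^+ 3 = G1 + C * B1 * z' + E * z' ^+ 3 -> z' = z).
Proof.
move=> C0 E0 CE; have C0' : C != 0 by rewrite gt_eqF.
have E0' : E != 0 by rewrite gt_eqF.
pose ee := 2 * (B0 - B1) / C; pose S := G0 - G1; pose g := C * B1 + E * ee.
have sq z z' : B0 + C * z ^+ 2 / 2 = B1 + C * z' ^+ 2 / 2 -> z' ^+ 2 = z ^+ 2 + ee.
  move=> h; apply: (mulfI C0'); rewrite /ee; have -> : C * (z ^+ 2 + 2 * (B0 - B1) / C) =
    C * z ^+ 2 + 2 * (B0 - B1) by field.
  lra.
have [nz|/norP[/negPn/eqP ee0 /negPn/eqP S0]] := boolP ((ee != 0) || (S != 0)).
  have := @cof_quartic _ (S ^+ 2 - ee * g ^+ 2) (2 * S * C * B0)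
    (C ^+ 2 * B0 ^+ 2 - g ^+ 2 - 2 * ee * g * E) (2 * S * E)
    (2 * C * B0 * E - 2 * g * E - ee * E ^+ 2).
  move=> /(_ _)/wrap[|F].
    (* The leading coefficient of the squared relation. It vanishes only for [ee = 0], when the
       cubic coefficient [2 S E] takes over; if [S = 0] too, only [z' = - z] is left to exclude. *)
    have c4 : 2 * C * B0 * E - 2 * g * E - ee * E ^+ 2 = E * ee * (C ^+ 2 - 3 * E).
      by rewrite /g /ee; field.
    case/orP: nz => [een|Sn]; apply/or4P.
      constructor 4; rewrite c4; apply: mulf_neq0; last by rewrite gt_eqF.
      exact: mulf_neq0.
    constructor 3; apply: mulf_neq0 => //; apply: mulf_neq0 => //.
  apply: cofS F _ => z F z' _ /sq z2 cub; exfalso; apply: F.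
  have cub' : S + C * B0 * z + E * z ^+ 3 = z' * (C * B1 + E * z' ^+ 2).
    by rewrite /S; lra.
  have : (S + C * B0 * z + E * z ^+ 3) ^+ 2 = (z ^+ 2 + ee) * (C * B1 + E * (z ^+ 2 + ee)) ^+ 2.
    by rewrite cub' exprMn z2.
  move=> /eqP; rewrite -subr_eq0 => /eqP h; rewrite -[RHS]h /g; ring.
have := @cof_quartic _ 0 (C * B0) 0 E 0; rewrite E0' !orbT => /(_ isT) F.
apply: cofS F _ => z F z' zz /sq; rewrite ee0 addr0 => /eqP; rewrite eqf_sqr.
move=> /orP[/eqP //|/eqP zE] cub; exfalso; apply: F.
have B01 : B0 = B1.
  move: ee0; rewrite /ee => /eqP; rewrite !mulf_eq0 invr_eq0 (negbTE C0') orbF pnatr_eq0 /=.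
  by rewrite subr_eq0 => /eqP.
move: cub; rewrite zE -B01 exprNn; move: S0; rewrite /S; lra.
Qed.

(** A [hi0] curve, parametrized by [z = x_1], against the [lo0] surface based on the hold at
    [x_1 = la], whose points are given by [y = x_2]. The cubic coefficient [E] survives the
    elimination of [y]. *)
Lemma cof_cubic_quad (B0 G0 C E n la ka : R) : E != 0 ->
  cof (fun z => forall y, B0 + C * z ^+ 2 / 2 = y + n * la ^+ 2 / 2 ->
    G0 + C * B0 * z + E * z ^+ 3 <>
      ka + y ^+ 2 / (2 * la) + n * la * y + n ^+ 2 * la ^+ 3 / 3).
Proof.
move=> E0; pose b0 := B0 - n * la ^+ 2 / 2; pose i := la^-1.
have := @cof_quartic _ (G0 - ka - b0 ^+ 2 * i / 2 - n * la * b0 - n ^+ 2 * la ^+ 3 / 3)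
  (C * B0) (- (b0 * C * i / 2 + n * la * C / 2)) E (- (C ^+ 2 * i / 8)).
rewrite E0 !orbT => /(_ isT) F; apply: cofS F _ => z F y yE cub; apply: F.
have {yE} yE : y = b0 + C * z ^+ 2 / 2 by rewrite /b0; lra.
move: cub; rewrite invfM -/i yE => /eqP; rewrite -subr_eq0 => /eqP h.
by rewrite -[RHS]h; field.
Qed.

(** A hold at [x_1 = h], parametrized by time, against the [lo0] surface based on a [hi0] curve;
    after squaring, [t^4] has the coefficient [h^2 / 4]. *)
Lemma cof_quad_cubic (v1 w1 h B1 G1 C E n : R) : C != 0 -> h != 0 ->
  cof (fun t => forall z, v1 + h * t + n * h ^+ 2 / 2 = B1 + C * z ^+ 2 / 2 ->
    w1 + v1 * t + h * t ^+ 2 / 2 + n * h * (v1 + h * t) + n ^+ 2 * h ^+ 3 / 3 <>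
      G1 + C * B1 * z + E * z ^+ 3).
Proof.
move=> C0 h0.
pose i0 := w1 + n * h * v1 + n ^+ 2 * h ^+ 3 / 3 - G1; pose i1 := v1 + n * h ^+ 2.
pose i2 := h / 2; pose p0 := 2 * (v1 + n * h ^+ 2 / 2 - B1) / C; pose p1 := 2 * h / C.
pose q0 := C * B1 + E * p0; pose q1 := E * p1.
have := @cof_quartic _ (i0 ^+ 2 - p0 * q0 ^+ 2)
  (2 * i0 * i1 - (p1 * q0 ^+ 2 + 2 * p0 * q0 * q1))
  (i1 ^+ 2 + 2 * i0 * i2 - (2 * p1 * q0 * q1 + p0 * q1 ^+ 2))
  (2 * i1 * i2 - p1 * q1 ^+ 2) (i2 ^+ 2).
rewrite sqrf_eq0 [i2 == 0]mulf_eq0 (negbTE h0) invr_eq0 pnatr_eq0 !orbT => /(_ isT) F.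
apply: cofS F _ => t F z zE cub; apply: F.
have z2 : z ^+ 2 = p0 + p1 * t.
  apply: (mulfI C0); rewrite /p0 /p1.
  have -> : C * (2 * (v1 + n * h ^+ 2 / 2 - B1) / C + 2 * h / C * t) =
    2 * (v1 + n * h ^+ 2 / 2 - B1) + 2 * h * t by field.
  lra.
have cub' : i0 + i1 * t + i2 * t ^+ 2 = z * (C * B1 + E * z ^+ 2).
  by rewrite /i0 /i1 /i2; lra.
have : (i0 + i1 * t + i2 * t ^+ 2) ^+ 2 = (p0 + p1 * t) * (q0 + q1 * t) ^+ 2.
  by rewrite cub' exprMn z2 /q0 /q1; ring.
by move=> /eqP; rewrite -subr_eq0 => /eqP hh; rewrite -[RHS]hh; ring.
Qed.

(** A hold against the surface based on the opposite hold: [t^2] has the coefficient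
    [(h - h^2 / la) / 2], positive because the bounds have opposite signs. *)
Lemma cof_quad_quad (v1 w1 h n la ka : R) : la < 0 < h ->
  cof (fun t => forall y, v1 + h * t + n * h ^+ 2 / 2 = y + n * la ^+ 2 / 2 ->
    w1 + v1 * t + h * t ^+ 2 / 2 + n * h * (v1 + h * t) + n ^+ 2 * h ^+ 3 / 3 <>
      ka + y ^+ 2 / (2 * la) + n * la * y + n ^+ 2 * la ^+ 3 / 3).
Proof.
move=> /andP[la0 h0]; pose j0 := v1 + n * h ^+ 2 / 2 - n * la ^+ 2 / 2; pose i := la^-1.
have i0 : i < 0 by rewrite invr_lt0.
have := @cof_quartic _ (w1 + n * h * v1 + n ^+ 2 * h ^+ 3 / 3 - ka - j0 ^+ 2 * i / 2
    - n * la * j0 - n ^+ 2 * la ^+ 3 / 3)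
  (v1 + n * h ^+ 2 - j0 * h * i - n * la * h) (h / 2 - h ^+ 2 * i / 2) 0 0.
have c2 : h / 2 - h ^+ 2 * i / 2 != 0.
  have : 0 < h ^+ 2 * - i by rewrite mulr_gt0 ?exprn_gt0 ?oppr_gt0.
  by move=> hi; rewrite gt_eqF//; lra.
rewrite c2 !orbT => /(_ isT) F; apply: cofS F _ => t F y yE cub; apply: F.
have {yE} yE : y = j0 + h * t by rewrite /j0; lra.
move: cub; rewrite invfM -/i yE => /eqP; rewrite -subr_eq0 => /eqP hh.
by rewrite -[RHS]hh; field.
Qed.

End FinitelyManyCrossings.

(** * Crossings of the arcs with the manifolds *)

Section Crossings.
Variables (R : realType) (p : bounds R) (xf : state R).
Hypotheses (hulo : ulo p < 0) (huhi : 0 < uhi p).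
Hypothesis hxlo : forall k : 'I_2, (xlo p k < 0)%E.
Hypothesis hxhi : forall k : 'I_2, (0 < xhi p k)%E.
Implicit Types (x y : state R).

Local Notation K := (uhi p).
Local Notation um := (ulo p).
Local Notation k := ((uhi p)^-1).
Local Notation n := ((- ulo p)^-1).
Local Notation l1 := (xlo p 0).
Local Notation h1 := (xhi p 0).
Let K0 : K != 0. Proof. exact: lt0r_neq0. Qed.
Let m0 : - um != 0. Proof. by rewrite lt0r_neq0// oppr_gt0. Qed.
Let u0 : um != 0. Proof. by rewrite ltr0_neq0. Qed.
Let k_gt0 : 0 < k. Proof. by rewrite invr_gt0. Qed.
Let n_gt0 : 0 < n. Proof. by rewrite invr_gt0 oppr_gt0. Qed.

(* [hiB] and [hiG] are invariant along the [hi0] flow, [loJ] and [loI] along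
   the [lo0] flow. *)
Definition hiB x := x.c2 - k * x.c1 ^+ 2 / 2.
Definition hiG x := x.c3 - k * hiB x * x.c1 - k ^+ 2 * x.c1 ^+ 3 / 6.
Definition loJ x := x.c2 + n * x.c1 ^+ 2 / 2.
Definition loI x := x.c3 + n * x.c1 * x.c2 + n ^+ 2 * x.c1 ^+ 3 / 3.
Local Notation C := (k + n).
Local Notation E := (k ^+ 2 / 6 + n * k / 2 + n ^+ 2 / 3).

Lemma hi_invariants x t : hiB (flow x K t) = hiB x /\ hiG (flow x K t) = hiG x.
Proof. by rewrite /hiG /hiB !flowE; split; field; exact: K0. Qed.

Lemma lo_invariants x t : loJ (flow x um t) = loJ x /\ loI (flow x um t) = loI x.
Proof. by rewrite /loJ /loI !flowE; split; field; rewrite ?u0 ?m0. Qed.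

(** With [loIE]: on a [hi0] curve the [lo0] invariants become polynomials in [x_1], with leading
    coefficients [C / 2] and [E]. *)
Lemma loJE x : loJ x = hiB x + C * x.c1 ^+ 2 / 2.
Proof. by rewrite /loJ /hiB; ring. Qed.

Lemma loIE x : loI x = hiG x + C * hiB x * x.c1 + E * x.c1 ^+ 3.
Proof. by rewrite /loI /hiG /hiB; ring. Qed.

Let C0 : 0 < C. Proof. exact: addr_gt0. Qed.
Let E0 : 0 < E.
Proof. by rewrite !addr_gt0// divr_gt0// ?mulr_gt0// exprn_gt0. Qed.
Let CE : 0 < C ^+ 2 - 3 * E.
Proof.
have -> : C ^+ 2 - 3 * E = k * (k + n) / 2 by move: k n => k' n'; field.
by rewrite divr_gt0// mulr_gt0.
Qed.

Lemma cof_off_strata : cof (fun z => forall x, x.c1 = z -> off_strata p xf x).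
Proof.
apply: cofS (cofI (cofI (cof_ne xf.c1%:E) (cof_ne 0%:E)) (cofI (cof_ne l1) (cof_ne h1))) _.
move=> z [[zf z0] [zl zh]] x xz; split; rewrite ?xz//.
- by move=> xf'; apply: zf; rewrite -xz xf'.
- by move=> zz; apply: z0; rewrite zz.
Qed.

(** While [x_1 = l1], the quantity [x_3 - x_2^2 / (2 l1)] is constant; this is its value on
    [c_10]. *)
Definition slow_const := (pt_0 p xf).c3 - (pt_0 p xf).c2 ^+ 2 / (2 * fine l1).

Lemma lo_surface_invariants x : lo_surface p xf x -> exists y s,
  [/\ 0 <= s, loJ x = loJ y, loI x = loI y, x = flow y um (- s) &
    [\/ c_0 p xf y /\ (hiB y = hiB xf /\ hiG y = hiG xf),
        [/\ fine l1 < 0, y.c1 = fine l1 & y.c3 = slow_const + y.c2 ^+ 2 / (2 * fine l1)] |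
        (loJ y)%:E = xhi p 1]].
Proof.
move=> [y [s [s0 wy xE h]]]; exists y, s; have [JE IE] := lo_invariants y (- s).
split; rewrite ?xE//; case: h => [cy|cy|[y1 y2]].
- by constructor 1; split => //; have [t _ ->] := c_0_flow cy; exact: hi_invariants.
- have yl := c_10_c1 huhi cy; constructor 2.
  have l0 : y.c1 < 0 by rewrite -lte_fin yl; exact: hxlo.
  rewrite -yl /=; split => //.
  move: cy; rewrite /c_10 -yl /= => /sweepE[z [r [[/= -> _] _ _ yE]]].
  have p1 : (pt_0 p xf).c1 = y.c1.
    by rewrite /pt_0 flow_c1 mulrC divfK// -yl /=; ring.
  have := yE; move: p1; rewrite /slow_const -yl /=; move: (pt_0 p xf) => pt p1 yE'.
  have -> : y.c3 = pt.c3 + pt.c2 * - r + pt.c1 * (- r) ^+ 2 / 2 + 0 * (- r) ^+ 3 / 6.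
    by rewrite yE' flow_c3.
  have -> : y.c2 = pt.c2 + pt.c1 * - r + 0 * (- r) ^+ 2 / 2 by rewrite yE' flow_c2.
  by rewrite p1; field; rewrite lt_eqF.
- by constructor 3; rewrite /loJ y1 expr0n mulr0 mul0r addr0.
Qed.

(** Points joined by the [lo0] flow share both [lo0] invariants, so a meeting with the surface is an
    equation in [x_1]. It can hold identically only for the part of the surface based on [c_0], and
    then the flow time is 0. *)
Lemma cof_hi_curve_surface (B0 G0 : R) : cof (fun z => forall x, x.c1 = z ->
  hiB x = B0 -> hiG x = G0 -> ~ lo_curve p xf x /\ (lo_surface p xf x -> c_0 p xf x)).
Proof.
have En0 : E != 0 by rewrite gt_eqF.
have Cn0 : C != 0 by rewrite gt_eqF.
have lin r : cof (fun z => (B0 + C * z ^+ 2 / 2)%:E <> r).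
  case: r => [r| |]; last 2 first.
  - exact: cofT.
  - exact: cofT.
  have := @cof_quartic _ (B0 - r) 0 (C / 2) 0 0.
  rewrite mulf_eq0 negb_or Cn0 invr_eq0 pnatr_eq0 !orbT => /(_ isT) F.
  by apply: cofS F _ => z F [] zr; apply: F; rewrite -zr; ring.
apply: cofS (cofI (cofI (lin (loJ xf)%:E) (lin (xhi p 1)))
  (cofI (cof_cubics B0 G0 (hiB xf) (hiG xf) C0 E0 CE)
        (cof_cubic_quad B0 G0 C n (fine l1) slow_const En0))) _.
move=> z [[zlo z2] [z0 z10]] x xz xB xG; split.
  move=> [s _ xE]; apply: zlo; rewrite -xB -xz -loJE xE.
  by have [->] := lo_invariants xf (- s).
move=> /lo_surface_invariants[y [s [s0 JE IE xE]]].
case=> [[cy [yB yG]]|[_ y1 y3]|yh].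
- suff sE : s = 0 by rewrite xE sE oppr0 flow0.
  have yx : x.c1 = y.c1 + um * - s by rewrite xE flow_c1.
  have := z0 y.c1; rewrite -xB -xG -yB -yG -xz -loJE -loIE -loJE -loIE.
  move=> /(_ _ JE IE)/wrap[|yE].
    by rewrite yx mulrN -mulNr lerDl mulr_ge0// oppr_ge0 ltW.
  have /eqP : um * s = 0 by lra.
  by rewrite mulf_eq0 (negbTE u0) => /eqP.
- exfalso; apply: (z10 y.c2); rewrite -xB -?xG -xz -?loJE -?loIE.
    by rewrite JE /loJ y1.
  by rewrite IE /loI y1 y3; ring.
- by exfalso; apply: z2; rewrite -xB -xz -loJE JE.
Qed.

Lemma cof_lo_curve (J0 : R) : cof (fun z => forall x, x.c1 = z -> loJ x = J0 ->
  ~ c_0 p xf x).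
Proof.
have Cn0 : C != 0 by rewrite gt_eqF.
have := @cof_quartic _ (hiB xf - J0) 0 (C / 2) 0 0.
rewrite mulf_eq0 negb_or Cn0 invr_eq0 pnatr_eq0 !orbT => /(_ isT) F.
apply: cofS F _ => z F x xz xJ /c_0_flow[s _ xE]; apply: F.
have [xB _] := hi_invariants xf (- s); rewrite -xE in xB.
by have := loJE x; rewrite xB xJ xz => ->; ring.
Qed.

Lemma cof_hold (v1 h : R) : h != 0 -> cof (fun t => forall x, x.c1 = h ->
  x.c2 = v1 + h * t -> [/\ x <> xf, ~ c_0 p xf x & ~ lo_curve p xf x]).
Proof.
move=> h0.
have := cofI (cof_lin (v1 - xf.c2) h0) (cofI
  (cof_lin (v1 - k * h ^+ 2 / 2 - hiB xf) h0)
  (cof_lin (v1 + n * h ^+ 2 / 2 - loJ xf) h0)).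
move=> F; apply: cofS F _ => t [F1 [F2 F3]] x x1 x2; split.
- by move=> xE; apply: F1; rewrite -xE x2; ring.
- move=> /c_0_flow[s _ xE]; apply: F2; have [xB _] := hi_invariants xf (- s).
  by rewrite -xB -xE /hiB x1 x2; ring.
- move=> [s _ xE]; apply: F3; have [xJ _] := lo_invariants xf (- s).
  by rewrite -xJ -xE /loJ x1 x2; ring.
Qed.

(** On the cruise [x_1] and [x_2] are fixed, so it is the invariants containing [x_3] that separate
    the points. *)
Lemma cof_cruise (w1 V : R) : V != 0 -> cof (fun t => forall x, x.c1 = 0 ->
  x.c2 = V -> x.c3 = w1 + V * t -> [/\ x <> xf, ~ c_0 p xf x & ~ lo_curve p xf x]).
Proof.
move=> V0.
have := cofI (cof_lin (w1 - xf.c3) V0) (cofI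
  (cof_lin (w1 - hiG xf) V0) (cof_lin (w1 - loI xf) V0)).
move=> F; apply: cofS F _ => t [F1 [F2 F3]] x x1 x2 x3; split.
- by move=> xE; apply: F1; rewrite -xE x3; ring.
- move=> /c_0_flow[s _ xE]; apply: F2; have [_ xB] := hi_invariants xf (- s).
  by rewrite -xB -xE /hiG /hiB x1 x3; ring.
- move=> [s _ xE]; apply: F3; have [_ xJ] := lo_invariants xf (- s).
  by rewrite -xJ -xE /loI x1 x3; ring.
Qed.

Lemma cof_hold_surface (v1 w1 h : R) : 0 < h -> cof (fun t => forall x,
  x.c1 = h -> x.c2 = v1 + h * t -> x.c3 = w1 + v1 * t + h * t ^+ 2 / 2 ->
  ~ lo_surface p xf x).
Proof.
move=> h_gt0; have h0 : h != 0 by rewrite gt_eqF.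
have Cn0 : C != 0 by rewrite gt_eqF.
have lin r : cof (fun t => (v1 + h * t + n * h ^+ 2 / 2)%:E <> r).
  case: r => [r| |]; last 2 first.
  - exact: cofT.
  - exact: cofT.
  apply: cofS (cof_lin (v1 + n * h ^+ 2 / 2 - r) h0) _ => t F [] tr; apply: F.
  by rewrite -tr; ring.
have quad : cof (fun t => fine l1 < 0 -> forall y : R,
    v1 + h * t + n * h ^+ 2 / 2 = y + n * (fine l1) ^+ 2 / 2 ->
    w1 + v1 * t + h * t ^+ 2 / 2 + n * h * (v1 + h * t) + n ^+ 2 * h ^+ 3 / 3 <>
      slow_const + y ^+ 2 / (2 * fine l1) + n * fine l1 * y + n ^+ 2 * (fine l1) ^+ 3 / 3).
  have [l0|l0] := ltP (fine l1) 0.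
    have lh : fine l1 < 0 < h by rewrite l0.
    by apply: cofS (cof_quad_quad v1 w1 n slow_const lh) _.
  by apply: cofT.
apply: cofS (cofI (lin (xhi p 1)) (cofI quad
  (cof_quad_cubic v1 w1 (hiB xf) (hiG xf) E n Cn0 h0))) _.
move=> t [z2 [z10 z0]] x x1 x2 x3.
have JE' : loJ x = v1 + h * t + n * h ^+ 2 / 2 by rewrite /loJ x1 x2.
have IE' : loI x = w1 + v1 * t + h * t ^+ 2 / 2 + n * h * (v1 + h * t) + n ^+ 2 * h ^+ 3 / 3.
  by rewrite /loI x1 x2 x3.
move=> /lo_surface_invariants[y [s [s0 JE IE xE]]].
case=> [[cy [yB yG]]|[l0 y1 y3]|yh].
- by apply: (z0 y.c1); rewrite -?JE' -?IE' ?JE ?IE -yB -?yG ?loJE ?loIE.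
- apply: (z10 l0 y.c2); rewrite -?JE' -?IE' ?JE ?IE /loJ /loI y1 ?y3; ring.
- by apply: z2; rewrite -JE' JE.
Qed.

End Crossings.

Local Arguments ct : simpl never.

(** * The law as a trajectory of the closed-loop control *)

Section ClosedLoopControl.
Variables (R : realType) (p : bounds R) (x0 xf : state R).
Hypotheses (hulo : ulo p < 0) (huhi : 0 < uhi p).
Hypothesis hxlo : forall k : 'I_2, (xlo p k < 0)%E.
Hypothesis hxhi : forall k : 'I_2, (0 < xhi p k)%E.
Hypotheses (wx0 : within p x0) (wxf : within p xf).
Implicit Types (P d Q e c : R).

Local Notation K := (uhi p).
Local Notation k := ((uhi p)^-1).
Local Notation n := ((- ulo p)^-1).
Local Notation a := (x0.c1).
Local Notation v := (x0.c2).
Local Notation w := (xf.c2).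

Let K0 : K != 0. Proof. exact: lt0r_neq0. Qed.
Let u0 : ulo p != 0. Proof. by rewrite ltr0_neq0. Qed.

Variables (P d Q e c : R).
Hypothesis ok : hi_ok p x0 xf P d Q e c.
Local Notation V := (vel k n a v P d).
Local Notation t1 := (T1 p x0 P).
Local Notation t2 := (T2 p x0 P d).
Local Notation t3 := (T3 p x0 P d Q c).
Local Notation t4 := (T4 p x0 P d Q c).
Local Notation t5 := (T5 p x0 P d Q c).
Local Notation t6 := (T6 p x0 P d Q e c).
Local Notation t7 := (T7 p x0 xf P d Q e c).
Local Notation l := (hi_arcs p x0 xf P d Q e c).

Hypothesis disp : hi_dsp p x0 xf P d Q e c = xf.c3 - x0.c3.
Local Notation x := (st x0 l).
Let l0 : durs_ge0 l. Proof. by have h := hi_durs hulo huhi ok. Qed.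
Let times := hi_arcs_times l0.
Local Notation tail_law := (tail_law p Q).
Local Notation mid_law := (mid_law p Q c).
Local Notation pre_law := (pre_law p P Q c).

Let dim_tail : mdim tail_law = 1%N.
Proof. by rewrite /tail_law; case: ifP. Qed.
Let dim_mid : ohead mid_law = Some lo0 /\ mdim mid_law = 2%N.
Proof. by rewrite /mid_law; case: ifP => _; rewrite /= dim_tail. Qed.
Let dim_pre : mdim pre_law = 2%N.
Proof. by rewrite /pre_law; case: ifP => _; rewrite /= (proj2 dim_mid). Qed.

Let manif L y : manifold_hi p xf L y -> manifold p xf L y. Proof. by left. Qed.

Lemma control1 : cof (fun t => 0 < t < t1 -> control p xf (x t) (ct l t)).
Proof.
have F := cof_affine (P - K * t1) K0 (cofI (cof_off_strata p xf)
  (cof_hi_curve_surface xf hulo huhi hxlo (hiB p x0) (hiG p x0))).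
apply: cofS F _ => t [F1 F2] tt; have /andP[t0 tt1] := tt.
have tw : 0 <= t <= t1 by rewrite !ltW.
have [x1 _] := arc1_state hulo huhi ok tw.
have x1E : (x t).c1 = P - K * t1 + K * t by rewrite x1; ring.
have [xB xG] := hi_invariants huhi x0 t; rewrite -(arc1 l0)// in xB xG.
have [nlo sc] := F2 _ x1E xB xG.
constructor 1; rewrite (ctl1 l0) ?t0 ?(ltW tt1)//; split => //.
have m1 := manif (member1 hulo huhi hxlo hxhi wx0 wxf ok disp tw).
apply: (relint_region hulo huhi m1) => //; first by rewrite /= dim_pre.
exact: F1.
Qed.

Lemma control2 : cof (fun t => t1 < t < t2 -> control p xf (x t) (ct l t)).
Proof.
have [[T10 T12 T23 T34] [T45 T56 T67]] := times.
have [t12|t12] := ltP t1 t2; last by apply: cofT => t /andP[ta tb]; lra.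
have PE := hold1 ok t12.
have P0 : 0 < P by rewrite -lte_fin PE; exact: hxhi.
pose v1 := V - n * P ^+ 2 / 2 - P * t2.
pose w1 := (x t1).c3 - v1 * t1 - P * t1 ^+ 2 / 2.
have F := cofI (cof_hold xf hulo huhi v1 (lt0r_neq0 P0)) (cof_hold_surface xf hulo huhi hxlo v1 w1 P0).
apply: cofS F _ => t [F1 F2] tt; have /andP[ta tb] := tt.
have tw : t1 <= t <= t2 by rewrite !ltW.
have tw1 : t1 <= t1 <= t2 by rewrite lexx.
have [x1 x2] := arc2_state hulo huhi ok tw; have [y1 y2] := arc2_state hulo huhi ok tw1.
have x2E : (x t).c2 = v1 + P * t by rewrite x2 /v1; ring.
have [nxf nc nlo] := F1 _ x1 x2E.
constructor 3; rewrite (ctl2 l0) ?ta ?(ltW tb)//; split => //.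
have m2 := manif (member2 hulo huhi hxlo hxhi wx0 wxf ok disp tw).
apply: (hold_surface hulo huhi hxhi m2) => //; first by rewrite x1 PE.
apply: F2 => //; rewrite (restart2 hulo huhi ok tw) flow_c3 y1 y2 /w1 /v1.
by field.
Qed.

Lemma control_lo r r' L : ohead L = Some lo0 -> mdim L = 2%N ->
  (forall t, r <= t <= r' -> x t = flow (x r) (ulo p) (t - r)) ->
  (forall t, r < t <= r' -> ct l t = ulo p) ->
  (forall t, r <= t <= r' -> manifold_hi p xf L (x t)) ->
  cof (fun t => r < t < r' -> control p xf (x t) (ct l t)).
Proof.
move=> Lo L2 xE cE Lx.
have F := cof_affine ((x r).c1 - ulo p * r) u0 (cofI (cof_off_strata p xf)
  (cof_lo_curve xf hulo huhi (loJ p (x r)))).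
apply: cofS F _ => t [F1 F2] tt; have /andP[ta tb] := tt.
have tw : r <= t <= r' by rewrite !ltW.
have x1E : (x t).c1 = (x r).c1 - ulo p * r + ulo p * t by rewrite xE// flow_c1; ring.
have [xJ _] := lo_invariants hulo (x r) (t - r); rewrite -xE// in xJ.
constructor 2; rewrite cE ?ta ?(ltW tb)//; split => //.
apply: (relint_lo_surface hulo huhi (manif (Lx t tw))) => //; first exact: F1.
exact: F2 x1E xJ.
Qed.

Lemma control3 : cof (fun t => t2 < t < t3 -> control p xf (x t) (ct l t)).
Proof.
have [ho d2] := dim_mid; apply: control_lo ho d2 _ _ _.
- exact: restart3.
- by move=> t; exact: ctl3.
- by move=> t; exact: member3.
Qed.

Lemma control4 : cof (fun t => t3 < t < t4 -> control p xf (x t) (ct l t)).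
Proof.
have [[T10 T12 T23 T34] [T45 T56 T67]] := times.
have [t34|t34] := ltP t3 t4; last by apply: cofT => t /andP[ta tb]; lra.
have [P0 Q0 Vh] := cruise ok t34.
have V0 : 0 < V by rewrite -lte_fin Vh; exact: hxhi.
have c0 : c != 0 by apply: contraTneq t34 => c0; rewrite /T4 c0 addr0 ltxx.
apply: cofS (cof_cruise xf hulo huhi ((x t3).c3 - V * t3) (lt0r_neq0 V0)) _.
move=> t F tt; have /andP[ta tb] := tt.
have tw : t3 <= t <= t4 by rewrite !ltW.
have tw3 : t3 <= t3 <= t4 by rewrite lexx.
have [x1 x2] := arc4_state hulo huhi ok c0 tw; have [y1 y2] := arc4_state hulo huhi ok c0 tw3.
have [|nxf nc nlo] := F _ x1 x2.
  by rewrite (restart4 hulo huhi ok tw) flow_c3 y1 y2; ring.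
constructor 3; rewrite (ctl4 l0) ?ta ?(ltW tb)//; split => //.
have m4 := manif (member4 hulo huhi hxlo hxhi wx0 wxf ok disp c0 tw).
by apply: (hold_curve hulo huhi m4) => //=; rewrite dim_tail.
Qed.

Lemma control5 : cof (fun t => t4 < t < t5 -> control p xf (x t) (ct l t)).
Proof.
have [[T10 T12 T23 T34] [T45 T56 T67]] := times.
have [t45|t45] := ltP t4 t5; last by apply: cofT => t /andP[ta tb]; lra.
have [c0 _] := mid5_cruise t45.
have ll : last_lo p x0 P d Q c = t4 by rewrite /last_lo (negbTE c0).
apply: (@control_lo _ _ (lo0 :: tail_law)) => //=; first by rewrite dim_tail.
- by move=> t; rewrite -ll => tt; exact: restart5.
- by move=> t; exact: ctl5.
- by move=> t; rewrite -ll; exact: member5.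
Qed.

Lemma control6 : cof (fun t => t5 < t < t6 -> control p xf (x t) (ct l t)).
Proof.
have [[T10 T12 T23 T34] [T45 T56 T67]] := times.
have [t56|t56] := ltP t5 t6; last by apply: cofT => t /andP[ta tb]; lra.
have QE := hold2 ok t56.
have Q0 : 0 < Q by rewrite -lte_fin QE oppe_gt0; exact: hxlo.
have Qn : - Q != 0 by rewrite oppr_eq0 gt_eqF.
apply: cofS (cof_hold xf hulo huhi (V - n * Q ^+ 2 / 2 + Q * t5) Qn) _.
move=> t F tt; have /andP[ta tb] := tt.
have tw : t5 <= t <= t6 by rewrite !ltW.
have [x1 x2] := arc6_state hulo huhi ok tw.
have [|nxf nc nlo] := F _ x1; first by rewrite x2; ring.
constructor 3; rewrite (ctl6 l0) ?ta ?(ltW tb)//; split => //.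
exact: (hold_curve hulo huhi (manif (member6 hulo huhi hxlo hxhi wx0 wxf ok disp tw))).
Qed.

(** No time is exceptional: on a curve only the point [xf] has smaller dimension, and [x_1]
    increases strictly to its final value. *)
Lemma control7 t : t6 < t < t7 -> control p xf (x t) (ct l t).
Proof.
have [[T10 T12 T23 T34] [T45 T56 T67]] := times.
move=> tt; have /andP[ta tb] := tt.
have tw : t6 <= t <= t7 by rewrite !ltW.
constructor 1; rewrite (ctl7 l0) ?ta ?(ltW tb)//; split => //.
apply: (relint_hi_curve hulo huhi).
  exact: (member7 hulo huhi hxlo hxhi wx0 wxf ok disp tw).
have t7w : t6 <= t7 <= t7 by rewrite T67 lexx.
rewrite -(st_T7 hulo huhi ok disp) => /(congr1 (fun z : state R => z.c1)).
have [-> _] := arc7_state hulo huhi ok tw; have [-> _] := arc7_state hulo huhi ok t7w.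
have : K * t < K * t7 by rewrite ltr_pM2l.
lra.
Qed.

Lemma hi_closed_loop : closed_loop p xf x0 t7 x (ct l).
Proof.
have [[T10 T12 T23 T34] [T45 T56 T67]] := times.
split.
  have h := hi_feasible hulo huhi hxlo hxhi wx0 wxf ok.
  have E : mkst xf.c1 w (x0.c3 + hi_dsp p x0 xf P d Q e c) = xf.
    by rewrite disp; apply: stP; rewrite mkstE//; ring.
  by rewrite E -T7E in h.
split; last exact: (law_follows hulo huhi hxlo hxhi wx0 wxf ok disp).
have F0 : cof (fun t => t \notin [:: 0; t1; t2; t3; t4; t5; t6; t7]).
  apply: (@sub_finite_set _ _ [set` [:: 0; t1; t2; t3; t4; t5; t6; t7]]).
    by move=> t /= /negP; rewrite negbK.
  exact: finite_seq.
have F := cofI F0 (cofI (cofI (cofI control1 control2) (cofI control3 control4)) (cofI control5 control6)).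
apply: cof_ae; apply: cofS F _ => t [nt [[[h1' h2'] [h3' h4']] [h5' h6']]].
rewrite !inE !negb_or in nt.
have /and4P[n0' n1 n2 /and5P[n3 n4 n5 n6 n7]] := nt.
rewrite /= in_itv /= => /andP[ta tb].
have {}ta : 0 < t by rewrite lt_def n0'.
have [h|h] := ltP t t1; first by apply: h1'; rewrite ta.
have {}h : t1 < t by rewrite lt_def n1.
have [h'|h'] := ltP t t2; first by apply: h2'; rewrite h.
have {h}h : t2 < t by rewrite lt_def n2.
have [h''|h''] := ltP t t3; first by apply: h3'; rewrite h.
have {h h'}h : t3 < t by rewrite lt_def n3.
have [h'|h'] := ltP t t4; first by apply: h4'; rewrite h.
have {h h''}h : t4 < t by rewrite lt_def n4.
have [h''|h''] := ltP t t5; first by apply: h5'; rewrite h.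
have {h h'}h : t5 < t by rewrite lt_def n5.
have [h'|h'] := ltP t t6; first by apply: h6'; rewrite h.
have {h h''}h : t6 < t by rewrite lt_def n6.
by apply: control7; rewrite h lt_neqAle n7.
Qed.

End ClosedLoopControl.

(** * Mirror symmetry *)

Section MirrorLaw.
Variable R : realType.
Implicit Types (p : bounds R) (y : state R).
Let mu := @lebesgue_measure R.

Lemma ae_imply (Y Z : R -> Prop) : (forall t, Y t -> Z t) ->
  {ae mu, forall t, Y t} -> {ae mu, forall t, Z t}.
Proof. by move=> YZ; apply: filterS; first exact: (ae_filter_ringOfSetsType mu). Qed.

Lemma flipK : involutive flip. Proof. by case. Qed.

Lemma manifoldN p xf L y :
  manifold p xf L y -> manifold (mirror p) (- xf) (map flip L) (- y).
Proof.
have LK : map flip (map flip L) = L by rewrite (mapK flipK).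
by rewrite /manifold /= mirrorK !opprK LK => -[|]; [right|left].
Qed.

Lemma manifold_flip p xf L y :
  manifold (mirror p) (- xf) L (- y) -> manifold p xf (map flip L) y.
Proof. by move=> /manifoldN; rewrite mirrorK !opprK. Qed.

Lemma relint_fromN p xf o y : relint_from p xf o y ->
  relint_from (mirror p) (- xf) (flip o) (- y).
Proof.
move=> [L /= Lo [Ly nL]]; exists (map flip L) => /=; first by case: L Lo {Ly nL} => //= ? ? [->].
split; first exact: manifoldN.
move=> [L' /=]; rewrite mdim_flip => L'L /manifold_flip L'y; apply: nL.
by exists (map flip L') => //=; rewrite mdim_flip.
Qed.

Lemma relint_from_flip p xf o y : relint_from (mirror p) (- xf) o (- y) ->
  relint_from p xf (flip o) y.
Proof. by move=> /relint_fromN; rewrite mirrorK !opprK. Qed.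

Lemma closed_loopN p xf (x0 : state R) T (x : R -> state R) (u : R -> R) :
  closed_loop p xf x0 T x u ->
  closed_loop (mirror p) (- xf) (- x0) T (fun t => - x t) (fun t => - u t).
Proof.
move=> [fe [co [L [ts [ts0 tsT mts]]]]]; split; first exact: feasibleN.
split; last first.
  exists (map flip L), ts; rewrite size_map; split => // i iL.
  by have [tt h] := mts i iL; split => // t /h; rewrite -map_drop; exact: manifoldN.
apply: ae_imply co => t h /h; case=> [[r ->]|[r ->]|[r ->]].
- by constructor 2; split => //; exact: relint_fromN r.
- by constructor 1; split => //; exact: relint_fromN r.
- constructor 3; rewrite oppr0; split => // -[] /relint_from_flip h'; apply: r;
    by [right|left].
Qed.

Lemma activeN p y (k : 'I_2) b : active (mirror p) (- y) k b <-> active p y k (~~ b).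
Proof.
by rewrite /active mxE; case: b => /=; rewrite EFinN; split => [/oppe_inj|->].
Qed.

Lemma junctionN p T (x : R -> state R) (k : 'I_2) b t :
  junction p T x k b t -> junction (mirror p) T (fun s => - x s) k (~~ b) t.
Proof.
have act s : active (mirror p) (- x s) k (~~ b) <-> active p (x s) k b.
  by rewrite -[in X in _ <-> X](negbK b); exact: activeN.
move=> [tt c1 c2]; split => //.
- apply: closureS c1 => s [sT a]; split => //; exact/act.
- by apply: closureS c2 => s [sT a]; split => // /act.
Qed.

(** The costate changes sign, [lam0] is kept since the products in the Hamiltonian are even, and the
    multipliers and jumps of the upper and lower bounds are exchanged. *)
Lemma pmpN p T (x : R -> state R) (u : R -> R) : pmp p T x u ->
  pmp (mirror p) T (fun t => - x t) (fun t => - u t).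
Proof.
move=> [lam0 [lam [eta [zeta [J [[l0 e0] [inf [ju [ac [de [cs [hm [sg [ze [li nt]]]]]]]]]]]]]]].
exists lam0, (fun t => - lam t), (fun k b => eta k (~~ b)), (fun k b => zeta k (~~ b)), J.
have N y i : (- y : state R) 0 i = - y 0 i by rewrite mxE.
split; first by split => // k b t; exact: e0.
split.
  move=> k t tT /=; have [h1 h2] := inf k t tT.
  by split => /eqP; rewrite eqe_oppLR /= => /eqP h; [exact: h2|exact: h1].
split; first by move=> t /ju[k [b jk]]; exists k, (~~ b); exact: junctionN.
split.
  move=> a b a0 ab bT nJ; have [nu ca cn] := ac a b a0 ab bT nJ.
  exists (fun t => - nu t) => [i e e_gt0|t tt nt']; last by rewrite cn.
  have [dl d0 h] := ca i e e_gt0; exists dl => // s s1 s2 s3.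
  have := h s s1 s2 s3; congr (_ < _); apply: eq_bigr => q _.
  by rewrite !N -opprD normrN.
split.
  apply: ae_imply de => t h /h[d3 dk]; split.
    have -> : (fun s => (- lam s).c3) = (fun s => - (lam s).c3) by apply/funext => s; rewrite N.
    by have dN := is_deriveN d3; rewrite oppr0 in dN.
  move=> k; have -> : (fun s => (- lam s) 0 (cur k)) = (fun s => - (lam s) 0 (cur k)).
    by apply/funext => s; rewrite N.
  have dN := is_deriveN (dk k); apply: is_derive_eq.
  by rewrite N /=; ring.
split.
  apply: ae_imply cs => t h tT k b; have [->|h'] := h tT k (~~ b); first by left.
  by right; apply/activeN.
split.
  by apply: ae_imply hm => t h /h; rewrite !N !mulrNN.
split.
  apply: ae_imply sg => t h /h[s1 s2 s3]; rewrite N /= oppr_lt0 oppr_gt0; split.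
  - by move=> /s3 ->.
  - by move=> /eqP; rewrite oppr_eq0 => /eqP/s2 ->; rewrite oppr0.
  - by move=> /s1 ->.
split.
  move=> k b t; have [z1 z2] := ze k (~~ b) t; split => // nj; apply: z2 => jk.
  by apply: nj; rewrite -(negbK b); exact: junctionN.
split.
  move=> t tt; have [lf [r [hl hr E]]] := li t tt; exists (- lf), (- r).
  split; [exact: cvgN|exact: cvgN|].
  have -> : - r - - lf = - (r - lf) by rewrite opprB opprK addrC.
  rewrite E -sumrN; apply: eq_bigr => k _; rewrite !big_bool /= /grad.
  by rewrite !scaleN1r !scale1r !scalerN; rewrite opprD opprK addrC.
move=> t tT; have := nt t tT; rewrite oppr_eq0.
case=> [->|[->|[[k [b kb]]|[k [b [s kb]]]]]]; [by left|by right; left| |].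
  by right; right; left; exists k, (~~ b); rewrite negbK.
by right; right; right; exists k, (~~ b), s; rewrite negbK.
Qed.

End MirrorLaw.

Lemma extremal_closed_loop (R : realType) (p : bounds R) (x0 xf : state R) P d Q e c :
  ulo p < 0 -> 0 < uhi p ->
  (forall k : 'I_2, (xlo p k < 0)%E) -> (forall k : 'I_2, (0 < xhi p k)%E) ->
  within p x0 -> within p xf -> extremal p x0 xf P d Q e c ->
  exists (T : R) (x : R -> state R) (u : R -> R),
    closed_loop p xf x0 T x u /\ pmp p T x u.
Proof.
move=> ul uh xl xh wx0 wxf [ok disp mo].
exists (T7 p x0 xf P d Q e c), (st x0 (hi_arcs p x0 xf P d Q e c)),
  (ct (hi_arcs p x0 xf P d Q e c)); split.
- exact: (hi_closed_loop ul uh xl xh wx0 wxf ok disp).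
- exact: (extremal_pmp ul uh xl xh wx0 wxf ok mo).
Qed.

Theorem theorem1 (R : realType) (p : bounds R)
    (hulo : ulo p < 0) (huhi : 0 < uhi p)
    (hxlo : forall k : 'I_2, (xlo p k < 0)%E)
    (hxhi : forall k : 'I_2, (0 < xhi p k)%E)
    (x0 xf : state R) :
  (exists (tf : R) (x : R -> state R) (u : R -> R), feasible p x0 xf tf x u) ->
  exists (tf : R) (x : R -> state R) (u : R -> R),
    closed_loop p xf x0 tf x u /\ pmp p tf x u.
Proof.
move=> [T [x [u fx]]].
have [_ xE] := feasible_kinematic (ltW (lt_trans hulo huhi)) fx.
have [T0 _ _ wx xT] := fx.
have wx0 : within p x0 by rewrite -xE; apply: wx; rewrite in_itv /= lexx.
have wxf : within p xf by rewrite -xT; apply: wx; rewrite in_itv /= lexx T0.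
case: (minimal_time hulo huhi hxlo hxhi fx) => -[P [d [Q [e [c ext]]]]].
  exact: extremal_closed_loop ext.
(* The extremal law belongs to the mirror family: the construction is applied to the reflected
   problem and its result reflected back. *)
have ul' : ulo (mirror p) < 0 by rewrite oppr_lt0.
have uh' : 0 < uhi (mirror p) by rewrite oppr_gt0.
have xl' (k : 'I_2) : (xlo (mirror p) k < 0)%E by rewrite /= oppe_lt0.
have xh' (k : 'I_2) : (0 < xhi (mirror p) k)%E by rewrite /= oppe_gt0.
have wx0' : within (mirror p) (- x0) by apply/withinN.
have wxf' : within (mirror p) (- xf) by apply/withinN.
have [T' [y [v [cl pm]]]] := extremal_closed_loop ul' uh' xl' xh' wx0' wxf' ext.
exists T', (fun t => - y t), (fun t => - v t).
by move: (closed_loopN cl) (pmpN pm); rewrite mirrorK !opprK.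
Qed.
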